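(* For $m,n\in\mathbb N$, the joint moment $V_{m,n}(x)=E[\tau(x)^mA(x)^n]$ is the solution of the problem $$\begin{cases}\frac12 V_{m,n}''(x)-\mu V_{m,n}'(x)=-m\,V_{m-1,n}(x)-n\,x\,V_{m,n-1}(x),\\ V_{m,n}(0)=0,\\ \lim_{\mu\to+\infty}V_{m,n}(x)=0.\end{cases}$$ Here $'$ denotes differentiation in $x$, and in the last condition $V_{m,n}(x)$ is regarded, for fixed $x$, as a function of the drift parameter $\mu$.
   Context: Let $B_t$ be a standard one-dimensional Brownian motion. For $x>0$ and $\mu>0$ let $X(t)=x-\mu t+B_t$ (Brownian motion with negative drift $-\mu$ started at $x$). The first-passage time below zero is $\tau(x)=\tau^\mu(x)=\inf\{t>0: X(t)\le 0\}$ (finite with probability one), and the first-passage area is $A(x)=A^\mu(x)=\int_0^{\tau(x)}X(t)\,dt$. For starting point $0$ one has $\tau(0)=0$ and $A(0)=0$. For integers $h,k\ge 0$, $V_{h,k}(x)=E[\tau(x)^hA(x)^k]$.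
   Formalization: ''Is the solution'' is proved as ''satisfies the problem'': uniqueness fails, as adding exp(-μ²)(exp(2μx)-1) to V gives another solution. The case m=n=0 is excluded, since V_{0,0}=1 violates V(0)=0. *)

(* Defs.v *)
From HB Require Import structures.
From mathcomp Require Import all_boot all_order all_algebra.
From mathcomp Require Import all_classical all_reals all_analysis.

Set Implicit Arguments.
Unset Strict Implicit.
Unset Printing Implicit Defensive.
Import Order.TTheory GRing.Theory Num.Theory.
Import numFieldNormedType.Exports.

Local Open Scope classical_set_scope.
Local Open Scope ring_scope.

(* Time is indexed by all of R, but only the values at t >= 0 are constrained
   or used. The second parameter of normal_prob is the standard deviation.
   Since the sets A i may be setT, the product rule over all i < n is mutual
   independence of the increments. *)
Record brownian_motion (R : realType) (d : measure_display)
    (T : measurableType d) (P : probability T R) (B : R -> {RV P >-> R}) :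
    Prop := BrownianMotion {
  bm_start : forall w, B 0 w = 0 ;
  bm_continuous : forall w,
    {within `[0, +oo[, continuous (fun t : R => B t w)} ;
  bm_gaussian : forall (s t : R) (A : set R), 0 <= s -> s < t ->
    measurable A ->
    P [set w | A (B t w - B s w)] = normal_prob 0 (Num.sqrt (t - s)) A ;
  bm_independent : forall (n : nat) (t : nat -> R) (A : nat -> set R),
    0 <= t 0%N -> (forall i, (i < n)%N -> t i <= t i.+1) ->
    (forall i, measurable (A i)) ->
    P [set w | forall i, (i < n)%N -> A i (B (t i.+1) w - B (t i) w)] =
    (\prod_(i < n) P [set w | A i (B (t i.+1) w - B (t i) w)%R])%E
}.

Definition drifted_path (R : realType) (T : Type) (B : R -> T -> R)
    (mu x : R) (w : T) : R -> R :=
  fun t => x - mu * t + B t w.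

(* +oo if the path never returns to ]-oo, 0] *)
Definition first_passage_time (R : realType) (X : R -> R) : \bar R :=
  ereal_inf [set t%:E | t in [set t : R | 0 < t /\ X t <= 0]].

Definition first_passage_area (R : realType) (X : R -> R) : \bar R :=
  let D := [set t : R | 0 <= t /\ (t%:E <= first_passage_time X)%E] in
  (\int[lebesgue_measure]_(t in D) (X t)%:E)%E.

Section moments.
Context {R : realType} {d : measure_display} {T : measurableType d}.
Variables (P : probability T R) (B : R -> {RV P >-> R}).

Definition joint_power (h k : nat) (mu x : R) (w : T) : \bar R :=
  let X := drifted_path (fun t => B t : T -> R) mu x w in
  (first_passage_time X ^+ h * first_passage_area X ^+ k)%E.

(* The library's 'E_P[_] takes real-valued functions only, whence the integral.
   fine sends an infinite expectation to 0, so statements about joint_moment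
   are meant to be read together with integrability of joint_power. *)
Definition joint_moment (h k : nat) (mu x : R) : R :=
  fine (\int[P]_w joint_power h k mu x w)%E.

End moments.

(* Main.v *)
(* For mu > 0 the recursive problem has polynomial solutions p_(m,n) with
   nonnegative coefficients, p_(0,0) = 1 and p_(m,n)(0) = 0. The function
     F(t, a, x) = sum_(i,j) C(m,i) C(n,j) t^(m-i) a^(n-j) p_(i,j)(x)
   is annihilated by d/dt + x d/da + 1/2 d^2/dx^2 - mu d/dx and dominates
   t^m a^n, so F(t, int_0^t X, X_t) is a martingale up to the passage time.
   Stochastic calculus is avoided: X is sampled at times k/r and the chain of
   states (elapsed time, area, position) is stopped once its position is at most
   eps > 0. By Taylor expansion one step changes the mean of F by O(r^(-3/2)), so
   over a horizon [0, T] the mean of F is p_(m,n)(x) + O(r^(-1/2)).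
   Upper bound: started 2 eps higher, the chain outlives the path, and Fatou's
   lemma gives E[tau^m A^n] <= p_(m,n)(x).
   Lower bound: at time T the chain either has stopped below eps, where F is
   within O(eps) of t^m a^n, or shows the time T, whence
   F_(m,n) <= F_(m+1,n) / T; truncating t^m a^n at T costs at most
   F_(2m,2n) / T. Dominated convergence applies to the truncated part; let then
   T go to infinity and eps to 0.
   Hence V_(m,n) = p_(m,n) on [0, +oo[, and p_(m,n)(x) = O(1/mu). *)

Require Import Defs.
From HB Require Import structures.
From mathcomp Require Import all_boot all_order all_algebra.
From mathcomp Require Import all_classical all_reals all_analysis.
From mathcomp Require Import measurable_realfun.
From mathcomp Require Import ring lra.

Set Implicit Arguments.
Unset Strict Implicit.
Unset Printing Implicit Defensive.
Import Order.TTheory GRing.Theory Num.Theory.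
Import numFieldNormedType.Exports.

Local Open Scope classical_set_scope.
Local Open Scope ring_scope.

(** * Gaussian moments *)

(** The moments are identified with polynomials before anything is differentiated, so regularity in
    x needs no argument about paths. Two obstacles shape the discrete argument. A step can jump
    below 0, where the p_(i,j) lose their sign and monotonicity. F is therefore evaluated at the
    positive part of the position, and the chain is stopped at eps > 0 instead of 0: from above eps,
    clipping matters only after a jump u of size at least eps, and its cost is then charged to (|u|
    / eps)^3, the order of the Taylor remainder. The other obstacle is that one-step errors are not
    bounded but grow like the exponential of a + 2 y in the area a and the position y. They are
    controlled in mean by an exponential weight whose rate in y decreases with the clock, just fast
    enough to absorb the growth of the area. Exponentials serve as majorants throughout because the
    Gaussian generating function is explicit. Almost sure finiteness of tau is not presupposed: it
    follows from the upper bound for (m, n) = (1, 0). *)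

Section normal_density.
Context {R : realType} (m s : R).
Local Notation mu := lebesgue_measure.
Import HBNNSimple.

Let integral_normal_prob_indic (A : set R) : measurable A ->
  (\int[normal_prob m s]_x (\1_A x)%:E =
   \int[mu]_x ((\1_A x)%:E * (normal_pdf m s x)%:E))%E.
Proof.
move=> mA; rewrite integral_indic//= setIT /normal_prob integral_mkcond/=.
apply: eq_integral => x _; rewrite patchE indicE.
by case: (x \in A); rewrite ?mul1e ?mul0e.
Qed.

Let measurable_fiber_indic (f : {nnsfun measurableTypeR R >-> R}) (r : R) :
  measurable_fun [set: measurableTypeR R] (fun x => r * \1_(f @^-1` [set r]) x).
Proof.
by apply: measurable_funM => //; apply: measurable_indic.
Qed.

Let integral_normal_prob_nnsfun (f : {nnsfun measurableTypeR R >-> R}) :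
  (\int[normal_prob m s]_x (f x)%:E =
   \int[mu]_x ((f x)%:E * (normal_pdf m s x)%:E))%E.
Proof.
have mpdf : measurable_fun [set: measurableTypeR R] (EFin \o normal_pdf m s).
  by apply/measurable_EFinP; exact: measurable_normal_pdf.
under [LHS]eq_integral do rewrite fimfunE -fsumEFin//.
rewrite [LHS]ge0_integral_fsum//; last 2 first.
  - move=> r.
    by apply/measurable_EFinP; exact: measurable_fiber_indic.
  - by move=> n x _; rewrite EFinM nnfun_muleindic_ge0.
under [RHS]eq_integral.
  move=> x xD; rewrite fimfunE -fsumEFin// ge0_mule_fsuml; last first.
    by move=> r; rewrite EFinM nnfun_muleindic_ge0.
  over.
rewrite [RHS]ge0_integral_fsum//; last 2 first.
  - move=> r; apply: emeasurable_funM => //.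
    by apply/measurable_EFinP; exact: measurable_fiber_indic.
  - move=> n x _; rewrite mule_ge0//; first by rewrite nnfun_muleindic_ge0.
    by rewrite lee_fin normal_pdf_ge0.
apply: eq_fsbigr => r _.
have mI : measurable (f @^-1` [set r]) by [].
have [r0|r0] := leP 0 r.
  under eq_integral do rewrite EFinM.
  under [RHS]eq_integral do rewrite EFinM -muleA.
  rewrite !ge0_integralZl_EFin//.
  - by rewrite integral_normal_prob_indic.
  - by move=> x _; rewrite mule_ge0// lee_fin ?normal_pdf_ge0.
  - apply: emeasurable_funM => //.
    by apply/measurable_EFinP; exact: measurable_indic.
  - by apply/measurable_EFinP; exact: measurable_indic.
(* For r < 0 the fibre is empty, as f is nonnegative, and both sides vanish. *)
have fr0 x : \1_(f @^-1` [set r]) x = 0 :> R.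
  rewrite indicE memNset//= => fxr.
  by have : 0 <= f x by []; rewrite fxr leNgt r0.
rewrite integral0_eq; last by move=> x _; rewrite fr0 mulr0.
by rewrite integral0_eq// => x _; rewrite fr0 mulr0 mul0e.
Qed.

(** The usual ladder: indicators, simple functions, then monotone limits. *)
Lemma ge0_integral_normal_prob (f : measurableTypeR R -> \bar R) :
  measurable_fun setT f -> (forall x, 0 <= f x)%E ->
  (\int[normal_prob m s]_x f x = \int[mu]_x (f x * (normal_pdf m s x)%:E))%E.
Proof.
move=> mf f0.
have mpdf : measurable_fun [set: measurableTypeR R] (EFin \o normal_pdf m s).
  by apply/measurable_EFinP; exact: measurable_normal_pdf.
pose f_ := nnsfun_approx measurableT mf.
have mf_ n : measurable_fun [set: measurableTypeR R] (EFin \o f_ n).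
  by apply/measurable_EFinP; exact: measurable_funPT.
have f_f x : (f_ n x)%:E @[n --> \oo] --> f x by exact: cvg_nnsfun_approx.
transitivity (lim (\int[normal_prob m s]_x (f_ n x)%:E @[n --> \oo])%E).
  rewrite -monotone_convergence//=.
  - by apply: eq_integral => x _; apply/esym/cvg_lim => //=; exact: f_f.
  - by move=> n ? _; rewrite lee_fin.
  - by move=> ? _ ? ? mn; rewrite lee_fin; exact/lefP/nd_nnsfun_approx.
under eq_fun do rewrite integral_normal_prob_nnsfun.
rewrite -monotone_convergence//=.
- apply: eq_integral => x _; apply/cvg_lim => //=.
  by apply: cvgeZr => //; exact: f_f.
- by move=> n; apply: emeasurable_funM => //; exact: mf_.
- by move=> n x _; apply: mule_ge0; rewrite lee_fin// normal_pdf_ge0.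
- move=> x _ a b ab; apply: lee_wpmul2r; first by rewrite lee_fin normal_pdf_ge0.
  by rewrite lee_fin; exact/lefP/nd_nnsfun_approx.
Qed.

End normal_density.

Lemma normal_mgf (R : realType) (s c : R) : s != 0 ->
  (\int[normal_prob 0 s]_x (expR (c * x))%:E = (expR (c ^+ 2 * s ^+ 2 / 2))%:E)%E.
Proof.
move=> s0; rewrite ge0_integral_normal_prob; last 2 first.
- by apply/measurable_EFinP; apply: measurableT_comp => //; exact: measurable_funM.
- by move=> x; rewrite lee_fin expR_ge0.
(* Completing the square: tilting the density by [expR (c * x)] recentres it at [c * s ^+ 2], up to
   a constant factor. *)
transitivity (\int[lebesgue_measure]_x
   ((expR (c ^+ 2 * s ^+ 2 / 2))%:E * (normal_pdf (c * s ^+ 2) s x)%:E))%E.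
  apply: eq_integral => x _; rewrite -!EFinM !normal_pdfE//; congr EFin.
  rewrite mulrCA [RHS]mulrCA; congr (_ * _).
  rewrite /normal_fun -!expRD; congr expR.
  by field.
rewrite ge0_integralZl//.
- by rewrite integral_normal_pdf mule1.
- by apply/measurable_EFinP; exact: measurable_normal_pdf.
- by move=> x _; rewrite lee_fin normal_pdf_ge0.
Qed.

Section expR_taylor.
Context {R : realType}.
Implicit Types (f : R -> R) (u v C : R).

(** Mean value theorem between 0 and u. Iterating it gives Taylor remainders of the right order in
    u, at the price of the factorial in the denominator. *)
Lemma le_norm_antiderivative f f' u C : f 0 = 0 ->
  (forall v, is_derive v 1 f (f' v)) ->
  (forall v, `|v| <= `|u| -> `|f' v| <= C) -> `|f u| <= `|u| * C.
Proof.
move=> f0 df hC.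
have cf : continuous f.
  by move=> v; apply/differentiable_continuous/derivable1_diffP; have [] := df v.
have [u0|u0|->] := ltgtP u 0; last by rewrite f0 !normr0 mul0r.
- have [v vu] := MVT u0 (fun v _ => df v) (continuous_subspaceT cf).
  rewrite f0 !sub0r => /(congr1 Num.norm); rewrite normrN normrM normrN => ->.
  rewrite mulrC ler_wpM2l// hC// !ltr0_norm//.
    by move: vu; rewrite in_itv/= => /andP[]; rewrite lerN2 => /ltW.
  by move: vu; rewrite in_itv/= => /andP[].
- have [v vu] := MVT u0 (fun v _ => df v) (continuous_subspaceT cf).
  rewrite f0 !subr0 => ->; rewrite normrM mulrC ler_wpM2l// hC//.
  move: vu; rewrite in_itv/= => /andP[v0 vu].
  by rewrite !gtr0_norm// ltW.
Qed.

Lemma expR_taylor1 u : `|expR u - 1| <= `|u| * expR `|u|.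
Proof.
apply: (@le_norm_antiderivative (fun v => expR v - 1) expR).
- by rewrite expR0 subrr.
- by move=> v; apply: is_derive_eq; rewrite subr0.
- by move=> v vu; rewrite ger0_norm ?expR_ge0// ler_expR (le_trans (ler_norm _)).
Qed.

Lemma expR_taylor2 u : `|expR u - 1 - u| <= `|u| ^+ 2 * expR `|u|.
Proof.
rewrite expr2 -mulrA.
apply: (@le_norm_antiderivative (fun v => expR v - 1 - v) (fun v => expR v - 1)).
- by rewrite expR0 !subr0 subrr.
- by move=> v; apply: is_derive_eq; rewrite subr0.
- move=> v vu; apply: (le_trans (expR_taylor1 _)).
  by apply: ler_pM => //; rewrite ?expR_ge0// ler_expR.
Qed.

Lemma expR_taylor3 u :
  `|expR u - 1 - u - u ^+ 2 / 2| <= `|u| ^+ 3 * expR `|u|.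
Proof.
rewrite (exprS `|u| 2) -mulrA.
apply: (@le_norm_antiderivative (fun v => expR v - 1 - v - v ^+ 2 / 2)
  (fun v => expR v - 1 - v)).
- by rewrite expR0 !subr0 subrr expr0n/= mul0r subr0.
- move=> v; apply: is_derive_eq; rewrite subr0.
  by rewrite /GRing.scale/=; field.
- move=> v vu; apply: (le_trans (expR_taylor2 _)).
  by apply: ler_pM => //; rewrite ?expR_ge0 ?exprn_ge0 ?ler_expR// lerXn2r.
Qed.

Lemma exprn_le_expR n u : 0 <= u -> u ^+ n <= n`!%:R * expR u.
Proof.
case: n => [|n] u0; first by rewrite expr0 mul1r -expR0 ler_expR.
rewrite mulrC -ler_pdivrMr ?ltr0n ?fact_gt0//.
by apply: le_trans (expR_ge1Dxn n u0); rewrite lerDr.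
Qed.

Lemma expR_norm_le u : expR `|u| <= expR u + expR (- u).
Proof.
have [u0|u0] := leP 0 u; first by rewrite ger0_norm// lerDl expR_ge0.
by rewrite ltr0_norm// lerDr expR_ge0.
Qed.

End expR_taylor.

Section normal_moments.
Context {R : realType} (s : R).
Hypotheses (s0 : 0 < s) (s1 : s <= 1).
Let g := normal_prob 0 s.

Let expR_scale_measurable c : measurable_fun [set: R] (fun z => expR (c * z)).
Proof. by apply: measurableT_comp => //; exact: measurable_funM. Qed.

Lemma normal_integrable_expR c :
  g.-integrable setT (fun z => (expR (c * z))%:E).
Proof.
apply/integrableP; split; first by apply/measurable_EFinP; exact: expR_scale_measurable.
under eq_integral do rewrite gee0_abs ?lee_fin ?expR_ge0//.
by rewrite normal_mgf ?gt_eqF// ltry.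
Qed.

Lemma normal_Rintegral_expR c :
  \int[g]_z expR (c * z) = expR (c ^+ 2 * s ^+ 2 / 2).
Proof. by rewrite /Rintegral normal_mgf// gt_eqF. Qed.

(** Writing |z|^3 as s^3 (|z| / s)^3 and bounding the last cube by 3! [expR (|z| / s)] extracts the
    factor s^3. The exponent [s^-1 + 1] that results is one at which the generating function stays
    bounded for s <= 1. *)
Let cubic_bound z : `|z| ^+ 3 * expR `|z| <=
  6 * s ^+ 3 * (expR ((s^-1 + 1) * z) + expR (- (s^-1 + 1) * z)).
Proof.
have -> : `|z| ^+ 3 = s ^+ 3 * (`|z| / s) ^+ 3.
  by rewrite exprMn exprVn mulrCA divff ?mulr1// expf_neq0// gt_eqF.
rewrite -[leLHS]mulrA -[leRHS]mulrA [leRHS]mulrCA.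
apply: ler_wpM2l; first by rewrite exprn_ge0 ?ltW.
have zs0 : 0 <= `|z| / s by rewrite divr_ge0// ltW.
apply: (@le_trans _ _ (6 * expR (`|z| / s) * expR `|z|)).
  apply: ler_wpM2r; first exact: expR_ge0.
  exact: (exprn_le_expR 3).
rewrite -mulrA -expRD ler_wpM2l// mulNr.
apply: le_trans (expR_norm_le _).
by rewrite normrM ger0_norm ?addr_ge0 ?invr_ge0 ?(ltW s0)// mulrDl mul1r mulrC.
Qed.

Let cubic_measurable :
  measurable_fun [set: R] (fun z : R => `|z| ^+ 3 * expR `|z|).
Proof.
apply: measurable_funM; first by apply: measurable_funX; exact: normr_measurable.
by apply: measurableT_comp => //; exact: normr_measurable.
Qed.

Let normal_integrable_sum : g.-integrable setT (EFin \o (fun z =>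
    expR ((s^-1 + 1) * z) + expR (- (s^-1 + 1) * z))).
Proof.
rewrite [X in integrable _ _ X](_ : _ =
    (fun z => (expR ((s^-1 + 1) * z))%:E) \+
    (fun z => (expR (- (s^-1 + 1) * z))%:E))%E//.
by apply: integrableD => //; exact: normal_integrable_expR.
Qed.

Let normal_integrable_pair : g.-integrable setT (EFin \o (fun z =>
    6 * s ^+ 3 * (expR ((s^-1 + 1) * z) + expR (- (s^-1 + 1) * z)))).
Proof.
rewrite [X in integrable _ _ X](_ : _ = (fun z => (6 * s ^+ 3)%:E *
    ((expR ((s^-1 + 1) * z))%:E + (expR (- (s^-1 + 1) * z))%:E))%E)//.
by apply: integrableZl => //; exact: normal_integrable_sum.
Qed.

Lemma normal_integrable_cubic :
  g.-integrable setT (EFin \o (fun z : R => `|z| ^+ 3 * expR `|z|)).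
Proof.
apply: le_integrable normal_integrable_pair => //.
  by apply/measurable_EFinP; exact: cubic_measurable.
move=> z _ /=; rewrite lee_fin ger0_norm ?mulr_ge0 ?exprn_ge0 ?expR_ge0//.
by rewrite (le_trans (cubic_bound z))// ler_norm.
Qed.

Lemma normal_cubic_le :
  \int[g]_z (`|z| ^+ 3 * expR `|z|) <= 12 * expR 2 * s ^+ 3.
Proof.
apply: le_trans (le_Rintegral _ normal_integrable_cubic normal_integrable_pair _) _ => //.
rewrite RintegralZl//.
rewrite RintegralD//; try exact: normal_integrable_expR.
rewrite !normal_Rintegral_expR sqrrN.
(* This is (1 + s)^2 / 2, at most 2 since s <= 1. Two exponentials of mean at most [expR 2], times
   the factor 6, give the constant 12. *)
have : (s^-1 + 1) ^+ 2 * s ^+ 2 / 2 <= 2.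
  rewrite -exprMn mulrDl mulVf ?gt_eqF// mul1r.
  rewrite ler_pdivrMr// (_ : 2 * 2 = 2 ^+ 2); last by rewrite expr2.
  rewrite lerXn2r ?nnegrE//; first by rewrite addr_ge0 ?(ltW s0).
  by rewrite -lerBrDl (le_trans s1)// (_ : 2 - 1 = 1)//; ring.
rewrite -ler_expR; set e := expR (_ / 2) => he.
have := exprn_ge0 3 (ltW s0).
by nra.
Qed.

Lemma normal_integrable_bounded (f : R -> R) C : measurable_fun [set: R] f ->
  (forall z, `|f z| <= C * expR `|z|) -> g.-integrable setT (EFin \o f).
Proof.
move=> mf fC.
have Cint : g.-integrable setT (fun z => C%:E *
    ((expR (1 * z))%:E + (expR (- 1 * z))%:E))%E.
  apply: integrableZl => //.
  by apply: integrableD => //; exact: normal_integrable_expR.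
apply: le_integrable Cint => //; first exact/measurable_EFinP.
move=> z _ /=; rewrite lee_fin (le_trans (fC z))// (le_trans _ (ler_norm _))//.
have C0 : 0 <= C by have := fC 0; rewrite normr0 expR0 mulr1; exact: le_trans.
by rewrite ler_wpM2l// mul1r mulN1r expR_norm_le.
Qed.

Lemma normal_integrable_expR_norm :
  g.-integrable setT (EFin \o (fun z : R => expR `|z|)).
Proof.
apply: (@normal_integrable_bounded _ 1) => [|z].
  by apply: measurableT_comp => //; exact: normr_measurable.
by rewrite mul1r ger0_norm// expR_ge0.
Qed.

Lemma normal_expR_norm_le : \int[g]_z expR `|z| <= 2 * expR 1.
Proof.
have i1 := normal_integrable_expR 1; have iN1 := normal_integrable_expR (- 1).
have i2 : g.-integrable setT (EFin \o (fun z : R => expR (1 * z) + expR (- 1 * z))).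
  exact: (integrableD measurableT i1 iN1).
apply: le_trans (le_Rintegral _ normal_integrable_expR_norm i2 _) _ => //.
  by move=> z _; rewrite mul1r mulN1r expR_norm_le.
rewrite RintegralD// !normal_Rintegral_expR sqrrN expr1n mul1r.
have : expR (s ^+ 2 / 2) <= expR 1.
  rewrite ler_expR ler_pdivrMr// mul1r (@le_trans _ _ 1) ?ler1n//.
  by rewrite exprn_ile1// ltW.
by move=> h; lra.
Qed.

Lemma normal_integrable_id : g.-integrable setT (EFin \o (fun z : R => z)).
Proof.
apply: (@normal_integrable_bounded _ 1) => // z.
by rewrite mul1r; have := exprn_le_expR 1 (normr_ge0 z); rewrite mul1r.
Qed.

Lemma normal_integrable_sqr :
  g.-integrable setT (EFin \o (fun z : R => z ^+ 2)).
Proof.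
apply: (@normal_integrable_bounded _ 2) => [|z]; first exact: measurable_funX.
by rewrite normrX; exact: (exprn_le_expR 2 (normr_ge0 z)).
Qed.

Let M c := \int[g]_z expR (c * z).
Let m1 := \int[g]_z z.
Let m2 := \int[g]_z z ^+ 2.

(** Mean and variance are read off from two second-order expansions of the generating function in c:
    here under the integral sign, in [mgf_expansion] from the closed form. Comparing them replaces
    differentiation under the integral. *)
Let mgf_taylor c : `|c| <= 1 ->
  `|M c - 1 - c * m1 - c ^+ 2 / 2 * m2| <= `|c| ^+ 3 * (12 * expR 2 * s ^+ 3).
Proof.
move=> c1.
have i1 : g.-integrable setT (EFin \o (fun z : R => c * z)).
  exact: (@integrableZl _ _ _ g _ measurableT c _ normal_integrable_id).
have i2 : g.-integrable setT (EFin \o (fun z : R => c ^+ 2 / 2 * z ^+ 2)).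
  exact: (@integrableZl _ _ _ g _ measurableT (c ^+ 2 / 2) _ normal_integrable_sqr).
have i0 : g.-integrable setT (EFin \o (cst 1 : R -> R)).
  exact: finite_measure_integrable_cst.
have ie := normal_integrable_expR c.
have i01 : g.-integrable setT (EFin \o (fun z : R => expR (c * z) - 1)).
  exact: (integrableB measurableT ie i0).
have i02 : g.-integrable setT (EFin \o (fun z : R => expR (c * z) - 1 - c * z)).
  exact: (integrableB measurableT i01 i1).
have i03 : g.-integrable setT
    (EFin \o (fun z : R => expR (c * z) - 1 - c * z - c ^+ 2 / 2 * z ^+ 2)).
  exact: (integrableB measurableT i02 i2).
have <- : \int[g]_z (expR (c * z) - 1 - c * z - c ^+ 2 / 2 * z ^+ 2) =
    M c - 1 - c * m1 - c ^+ 2 / 2 * m2.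
  rewrite RintegralB// RintegralB// RintegralB//.
  rewrite RintegralZl//; last exact: normal_integrable_id.
  rewrite RintegralZl//; last exact: normal_integrable_sqr.
  by rewrite Rintegral_cst// [X in fine X]probability_setT mulr1.
apply: le_trans (le_normr_Rintegral _ i03) _ => //.
apply: (@le_trans _ _ (\int[g]_z (`|c| ^+ 3 * (`|z| ^+ 3 * expR `|z|)))).
  apply: le_Rintegral => //.
  - exact: integrable_norm i03.
  - exact: (@integrableZl _ _ _ g _ measurableT (`|c| ^+ 3) _ normal_integrable_cubic).
  - move=> z _; have := expR_taylor3 (c * z).
    rewrite (_ : (c * z) ^+ 2 / 2 = c ^+ 2 / 2 * z ^+ 2); last by rewrite exprMn mulrAC.
    move=> /le_trans; apply.
    rewrite normrM exprMn -mulrA; apply: ler_wpM2l; first exact: exprn_ge0.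
    apply: ler_wpM2l; first exact: exprn_ge0.
    by rewrite ler_expR ler_piMl.
rewrite RintegralZl//; last exact: normal_integrable_cubic.
by apply: ler_wpM2l; [exact: exprn_ge0|exact: normal_cubic_le].
Qed.

Let mgf_expansion c : `|c| <= 1 ->
  `|M c - 1 - c ^+ 2 / 2 * s ^+ 2| <= `|c| ^+ 3 * expR 1.
Proof.
move=> c1; rewrite /M normal_Rintegral_expR (mulrAC (c ^+ 2)).
set u := c ^+ 2 / 2 * s ^+ 2.
apply: le_trans (expR_taylor2 u) _.
have c0 : 0 <= c ^+ 2 by exact: sqr_ge0.
have u0 : 0 <= u by rewrite mulr_ge0 ?divr_ge0 ?sqr_ge0.
have cc1 : c ^+ 2 <= 1 by rewrite -real_normK ?num_real// exprn_ile1.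
have uc : u <= c ^+ 2.
  rewrite /u -mulrA ler_piMr// mulr_ile1 ?invr_ge0 ?sqr_ge0 ?invf_le1 ?ler1n//.
  by rewrite exprn_ile1// ltW.
rewrite ger0_norm//; apply: ler_pM; rewrite ?exprn_ge0 ?expR_ge0 ?ler_expR//.
  apply: (@le_trans _ _ ((c ^+ 2) ^+ 2)); first by rewrite lerXn2r ?nnegrE.
  by rewrite -[c ^+ 2]real_normK ?num_real// -exprM exprS ler_piMl ?exprn_ge0.
exact: le_trans cc1.
Qed.

Let moment_le c : `|c| <= 1 ->
  `|c * m1 + c ^+ 2 / 2 * (m2 - s ^+ 2)| <=
    `|c| ^+ 3 * (12 * expR 2 * s ^+ 3 + expR 1).
Proof.
move=> c1; rewrite mulrDr.
rewrite (_ : _ + _ = M c - 1 - c ^+ 2 / 2 * s ^+ 2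
                   - (M c - 1 - c * m1 - c ^+ 2 / 2 * m2)); last by ring.
apply: le_trans (ler_normB _ _) _; rewrite [leRHS]mulrDr [leLHS]addrC lerD//.
- exact: mgf_taylor.
- exact: mgf_expansion.
Qed.

Let small_eq0 (a L : R) : 0 < L ->
  (forall c, 0 < c -> c <= 1 -> `|a| <= L * c) -> a = 0.
Proof.
move=> L0 aL; apply/eqP; apply/negPn/negP => a0.
have na : 0 < `|a| by rewrite normr_gt0.
have d0 : 0 < `|a| + 2 * L by rewrite addr_gt0// mulr_gt0.
(* At this c the bound amounts to [|a| + 2 * L <= L], which is absurd. *)
have := aL (`|a| / (`|a| + 2 * L)).
rewrite divr_gt0// ler_pdivrMr// mul1r lerDl mulr_ge0 ?(ltW L0)// => /(_ isT isT).
rewrite mulrCA ler_pMr// ler_pdivlMr// mul1r; apply/negP; rewrite -ltNge.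
by rewrite mulr2n mulrDl mul1r addrA ltrDr addr_gt0.
Qed.

Let L := 12 * expR 2 * s ^+ 3 + expR 1.

Let L_gt0 : 0 < L.
Proof. by rewrite ltr_wpDl ?expR_gt0// !mulr_ge0 ?expR_ge0 ?exprn_ge0 ?ltW. Qed.

Lemma normal_mean : \int[g]_z z = 0.
Proof.
apply: (small_eq0 L_gt0) => c c0 c1; rewrite -/m1.
have c1' : `|c| <= 1 by rewrite gtr0_norm.
have h := moment_le c1'.
(* The linear term is odd in c and the quadratic one even, so the difference of the estimates at c
   and - c isolates [c * m1]. *)
have h' := @moment_le (- c); rewrite normrN in h'; move/(_ c1') : h'.
rewrite sqrrN mulNr => h'.
have : `|c * m1 *+ 2| <= `|c| ^+ 3 * L *+ 2.
  rewrite [in leRHS]mulr2n; apply: le_trans (lerD h h').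
  apply: le_trans (ler_normB _ _).
  by rewrite le_eqVlt; apply/orP; left; apply/eqP; congr Num.norm; ring.
rewrite normrMn ler_pMn2r// normrM gtr0_norm// exprS -mulrA ler_pM2l// => /le_trans.
by apply; rewrite mulrC ler_wpM2l ?(ltW L_gt0)// expr2 ler_piMl ?(ltW c0).
Qed.

Lemma normal_variance : \int[g]_z z ^+ 2 = s ^+ 2.
Proof.
apply/eqP; rewrite -subr_eq0; apply/eqP.
have L2 : 0 < 2 * L by rewrite mulr_gt0.
apply: (small_eq0 L2) => c c0 c1; rewrite -/m2.
have c1' : `|c| <= 1 by rewrite gtr0_norm.
(* With zero mean only the quadratic term is left; dividing by c^2 / 2 leaves a bound of order c. *)
have := moment_le c1'; rewrite /m1 normal_mean mulr0 add0r.
rewrite normrM (@gtr0_norm _ (c ^+ 2 / 2)) ?divr_gt0 ?exprn_gt0//.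
rewrite (gtr0_norm c0) (exprSr c 2) -[leLHS]mulrA -[leRHS]mulrA.
rewrite ler_pM2l ?exprn_gt0// ler_pdivrMl//.
by rewrite (mulrC c) mulrA.
Qed.

End normal_moments.

(** * The polynomial solutions of the recursive problem *)

Section moment_polynomials.
Context {R : realType}.
Implicit Types (mu : R) (p q s : {poly R}).

(** At i = 0 the division by 0 yields 0, so the constant coefficient vanishes. *)
Definition antideriv q : {poly R} :=
  \poly_(i < (size q).+1) (q`_i.-1 / i%:R).

(** Neumann series of (mu - D / 2)^-1, with D the derivation; it terminates because D is nilpotent
    on polynomials of bounded degree. *)
Definition drift_inverse mu s : {poly R} :=
  \sum_(j < size s) (mu^-1 * (2 * mu) ^- j) *: s^`(j).

(** Solves v'' / 2 - mu v' = - s with v(0) = 0: v' is the polynomial w such that mu w - w' / 2 = s.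
    The solutions vanishing at 0 differ by multiples of expR (2 * mu * x) - 1, so this is the only
    polynomial one. *)
Definition drift_solve mu s : {poly R} := antideriv (drift_inverse mu s).

Lemma deriv_antideriv q : (antideriv q)^`() = q.
Proof.
apply/polyP => i; rewrite coef_deriv coef_poly ltnS.
case: ltnP => [iq|/(nth_default 0) ->]; last by rewrite mul0rn.
by rewrite -[LHS]mulr_natr divfK// pnatr_eq0.
Qed.

Lemma antideriv0 q : (antideriv q).[0] = 0.
Proof. by rewrite horner_coef0 coef_poly/= invr0 mulr0. Qed.

Definition nneg_poly p := forall i, 0 <= p`_i.

Lemma antideriv_ge0 q : nneg_poly q -> nneg_poly (antideriv q).
Proof.
by move=> q0 i; rewrite coef_poly; case: ifP => // _; rewrite divr_ge0// q0.
Qed.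

Lemma derivn_ge0 p k : nneg_poly p -> nneg_poly p^`(k).
Proof. by move=> p0 i; rewrite coef_derivn mulrn_wge0. Qed.

Lemma nneg_poly_horner p x : nneg_poly p -> 0 <= x -> 0 <= p.[x].
Proof.
by move=> p0 x0; rewrite horner_coef sumr_ge0// => i _; rewrite mulr_ge0// exprn_ge0.
Qed.

Lemma nneg_poly_horner_le p x y : nneg_poly p -> 0 <= x -> x <= y ->
  p.[x] <= p.[y].
Proof.
move=> p0 x0 xy; rewrite !horner_coef ler_sum// => i _.
by rewrite ler_wpM2l// lerXn2r// nnegrE// (le_trans x0).
Qed.

Lemma drift_inverseE mu s : mu != 0 ->
  mu *: drift_inverse mu s - 2^-1 *: (drift_inverse mu s)^`() = s.
Proof.
move=> mu0; rewrite /drift_inverse [_^`()]raddf_sum !scaler_sumr -sumrB.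
(* The sum telescopes in [u]: [- u 0] is s, and [u (size s)] is 0 because that many derivations kill
   s. *)
pose u j : {poly R} := - ((2 * mu) ^- j *: s^`(j)).
transitivity (\sum_(0 <= j < size s) (u j.+1 - u j)).
  rewrite big_mkord; apply: eq_bigr => j _.
  rewrite /= derivZ -derivnS !scalerA /u (mulrA mu) divff// mul1r opprK addrC.
  by congr (- (_ *: _) + _); rewrite exprS !invfM mulrA.
rewrite telescope_sumr// /u derivn0 expr0 invr1 scale1r opprK.
by rewrite derivn_poly0// scaler0 oppr0 add0r.
Qed.

Lemma drift_solveE mu s : mu != 0 ->
  2^-1 *: (drift_solve mu s)^`(2) - mu *: (drift_solve mu s)^`() = - s.
Proof.
move=> mu0; rewrite derivSn derivn1 /drift_solve deriv_antideriv.
by rewrite -[in RHS](drift_inverseE s mu0) opprB.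
Qed.

Lemma drift_solve0 mu s : (drift_solve mu s).[0] = 0.
Proof. exact: antideriv0. Qed.

Lemma drift_inverse_ge0 mu s : 0 <= mu ->
  nneg_poly s -> nneg_poly (drift_inverse mu s).
Proof.
move=> mu0 s0 i; rewrite /drift_inverse coef_sum sumr_ge0// => j _.
rewrite coefZ mulr_ge0//; last exact: derivn_ge0.
by rewrite mulr_ge0 ?invr_ge0 ?exprn_ge0 ?mulr_ge0.
Qed.

Lemma drift_solve_ge0 mu s : 0 <= mu ->
  nneg_poly s -> nneg_poly (drift_solve mu s).
Proof. by move=> mu0 s0; apply/antideriv_ge0/drift_inverse_ge0. Qed.

(** Each call lowers one index and keeps the other, hence the nested fixpoints; the cases with an
    index 0 are separate, so that no predecessor of 0 is called. *)
Fixpoint moment_poly mu (m : nat) : nat -> {poly R} :=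
  if m is m'.+1 then
    fix inner n := if n is n'.+1 then
      drift_solve mu (m%:R *: moment_poly mu m' n + n%:R *: ('X * inner n'))
    else drift_solve mu (m%:R *: moment_poly mu m' 0)
  else fix inner n := if n is n'.+1 then
      drift_solve mu (n%:R *: ('X * inner n'))
    else 1.

(** At an index 0 the truncated predecessor is harmless, since its coefficient is 0. *)
Definition moment_source mu m n : {poly R} :=
  m%:R *: moment_poly mu m.-1 n + n%:R *: ('X * moment_poly mu m n.-1).

Lemma moment_poly00 mu : moment_poly mu 0 0 = 1.
Proof. by []. Qed.

Lemma moment_polyE mu m n : (0 < m + n)%N ->
  moment_poly mu m n = drift_solve mu (moment_source mu m n).
Proof.
case: m n => [|m] [|n]//= _; rewrite /moment_source.
- by rewrite scale0r add0r.
- by rewrite scale0r addr0.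
Qed.

Lemma moment_poly_ode mu m n : mu != 0 ->
  2^-1 *: (moment_poly mu m n)^`(2) - mu *: (moment_poly mu m n)^`() =
  - moment_source mu m n.
Proof.
move=> mu0; have [|mn0] := posnP (m + n)%N.
  move=> /eqP; rewrite addn_eq0 => /andP[/eqP -> /eqP ->].
  by rewrite /moment_source !scale0r addr0 oppr0 derivSn derivn1 derivC derivC
    !scaler0 subr0.
by rewrite moment_polyE// drift_solveE.
Qed.

Lemma moment_poly_at0 mu m n : (0 < m + n)%N -> (moment_poly mu m n).[0] = 0.
Proof. by move=> mn; rewrite moment_polyE// drift_solve0. Qed.

Lemma moment_source_ge0 mu m n :
  (forall i j, (i + j < m + n)%N -> nneg_poly (moment_poly mu i j)) ->
  nneg_poly (moment_source mu m n).
Proof.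
move=> h k; rewrite coefD !coefZ coefXM; apply: addr_ge0.
  case: m h => [|m] h; first by rewrite mul0r.
  by rewrite mulr_ge0//; apply: h; rewrite addSn.
case: n h => [|n] h; first by rewrite mul0r.
by rewrite mulr_ge0//; case: ifP => // _; apply: h; rewrite addnS.
Qed.

(** Every operation of the recursion preserves nonnegative coefficients. This is the source of all
    positivity and monotonicity on [0, +oo[ used below. *)
Lemma moment_poly_ge0 mu m n : 0 <= mu -> nneg_poly (moment_poly mu m n).
Proof.
move=> mu0; have [k] := ubnP (m + n)%N; elim: k m n => // k IH m n mnk.
have [|mn0] := posnP (m + n)%N.
  move=> /eqP; rewrite addn_eq0 => /andP[/eqP -> /eqP ->] i.
  by rewrite coef1 ler0n.
rewrite moment_polyE//; apply: drift_solve_ge0 => //.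
by apply: moment_source_ge0 => i j ij; apply: IH; exact: leq_trans ij _.
Qed.

Lemma moment_poly_horner_ge0 mu m n x : 0 <= mu -> 0 <= x ->
  0 <= (moment_poly mu m n).[x].
Proof. by move=> mu0 x0; apply: nneg_poly_horner => //; exact: moment_poly_ge0. Qed.

Lemma coef_antideriv q i : (antideriv q)`_i = q`_i.-1 / i%:R.
Proof.
rewrite coef_poly ltnS; case: i => [|i]; first by rewrite leq0n.
by case: ltnP => // /(nth_default 0) ->; rewrite mul0r.
Qed.

Lemma drift_inverse_widen mu s n : (size s <= n)%N -> drift_inverse mu s =
  \sum_(j < n) (mu^-1 * (2 * mu) ^- j) *: s^`(j).
Proof.
move=> sn; rewrite /drift_inverse.
rewrite (big_ord_widen n (fun j => (mu^-1 * (2 * mu) ^- j) *: s^`(j)))//.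
rewrite big_mkcond; apply: eq_bigr => j _; case: ltnP => // sj.
by rewrite derivn_poly0// scaler0.
Qed.

(** One factor 1 / mu is set aside; the remaining factors (2 mu)^-j are at most 2^-j since 1 <=
    mu. *)
Lemma drift_solve_le mu p q i : 1 <= mu -> nneg_poly p ->
  (forall i, p`_i <= q`_i) ->
  (drift_solve mu p)`_i <= mu^-1 * (drift_solve 1 q)`_i.
Proof.
move=> mu1 p0 pq; have mu0 : 0 < mu by exact: lt_le_trans mu1.
rewrite !coef_antideriv mulrA ler_wpM2r ?invr_ge0//.
rewrite (@drift_inverse_widen _ p (maxn (size p) (size q))) ?leq_maxl//.
rewrite (@drift_inverse_widen _ q (maxn (size p) (size q))) ?leq_maxr//.
rewrite !coef_sum mulr_sumr ler_sum// => j _.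
rewrite !coefZ invr1 mul1r mulr1 -mulrA ler_wpM2l ?invr_ge0 ?(ltW mu0)//.
rewrite !coef_derivn; apply: ler_pM.
- by rewrite invr_ge0 exprn_ge0// mulr_ge0// ltW.
- by rewrite mulrn_wge0.
- rewrite lef_pV2 ?posrE ?exprn_gt0 ?mulr_gt0//.
  by rewrite lerXn2r ?nnegrE ?mulr_ge0 ?(ltW mu0)// ler_peMr.
- by rewrite lerMn2r pq orbT.
Qed.

Lemma moment_poly_le mu m n i : 1 <= mu ->
  (moment_poly mu m n)`_i <= (moment_poly 1 m n)`_i.
Proof.
move=> mu1; have mu0 : 0 < mu by exact: lt_le_trans mu1.
have [k] := ubnP (m + n)%N; elim: k m n i => // k IH m n i mnk.
have [|mn0] := posnP (m + n)%N.
  by move=> /eqP; rewrite addn_eq0 => /andP[/eqP -> /eqP ->].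
rewrite !moment_polyE//.
have h0 := @moment_source_ge0 _ _ _ (fun i j _ => @moment_poly_ge0 mu i j (ltW mu0)).
have h1 := @moment_source_ge0 _ _ _ (fun i j _ => @moment_poly_ge0 1 i j ler01).
apply: le_trans (drift_solve_le (q := moment_source 1 m n) i mu1 (h0 _ _) _) _.
  move=> j; rewrite !coefD !coefZ !coefXM; apply: lerD.
    case: m {mn0 h0 h1} mnk => [|m] mnk; first by rewrite !mul0r.
    by rewrite ler_wpM2l//; apply: IH; rewrite -ltnS -addSn.
  case: n {mn0 h0 h1} mnk => [|n] mnk; first by rewrite !mul0r.
  by rewrite ler_wpM2l//; case: ifP => // _; apply: IH; rewrite -ltnS -addnS.
rewrite ler_piMl ?invf_le1//.
exact: (drift_solve_ge0 ler01 (h1 _ _)).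
Qed.

(* Only positive powers of [1 / mu] occur in the coefficients. *)
Lemma moment_poly_horner_le mu m n x : 1 <= mu -> 0 <= x -> (0 < m + n)%N ->
  (moment_poly mu m n).[x] <= mu^-1 * (moment_poly 1 m n).[x].
Proof.
move=> mu1 x0 mn; have mu0 : 0 < mu by exact: lt_le_trans mu1.
set p := moment_poly mu m n; set q := moment_poly 1 m n.
rewrite (@horner_coef_wide _ (maxn (size p) (size q)) p) ?leq_maxl//.
rewrite (@horner_coef_wide _ (maxn (size p) (size q)) q) ?leq_maxr//.
rewrite mulr_sumr ler_sum// => i _; rewrite mulrA ler_wpM2r ?exprn_ge0//.
move: (nat_of_ord i) => {i}i.
rewrite /p /q !moment_polyE//; apply: drift_solve_le => //.
  by apply: moment_source_ge0 => a b _; exact: moment_poly_ge0 (ltW mu0).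
move=> j; rewrite !coefD !coefZ !coefXM; apply: lerD.
  by rewrite ler_wpM2l// moment_poly_le.
by rewrite ler_wpM2l//; case: ifP => // _; exact: moment_poly_le.
Qed.

End moment_polynomials.
Arguments moment_poly : simpl never.

(** * The martingale polynomial and its generator *)

Section martingale_polynomial.
Context {R : realType} (mu : R).
Hypothesis mu0 : 0 < mu.
Local Notation p := (moment_poly mu).

(* To be the expectation of [(t + tau x)^m (a + A x)^n]. *)
Definition mart_poly (m n : nat) (t a x : R) : R :=
  \sum_(i < m.+1) \sum_(j < n.+1)
    ('C(m, i)%:R * 'C(n, j)%:R) * (t ^+ (m - i) * a ^+ (n - j) * (p i j).[x]).

Let term_ge0 m n t a x i j : 0 <= t -> 0 <= a -> 0 <= x ->
  0 <= ('C(m, i)%:R * 'C(n, j)%:R) * (t ^+ (m - i) * a ^+ (n - j) * (p i j).[x]).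
Proof.
move=> t0 a0 x0; rewrite !mulr_ge0 ?exprn_ge0//.
by rewrite moment_poly_horner_ge0 ?(ltW mu0).
Qed.

Lemma mart_poly_ge0 m n t a x : 0 <= t -> 0 <= a -> 0 <= x ->
  0 <= mart_poly m n t a x.
Proof.
move=> t0 a0 x0; rewrite !sumr_ge0// => i _; rewrite sumr_ge0// => j _.
exact: term_ge0.
Qed.

Lemma mart_poly_at0 m n x : mart_poly m n 0 0 x = (p m n).[x].
Proof.
rewrite /mart_poly (bigD1 ord_max)//= (bigD1 ord_max)//= !binn !subnn !expr0 !mul1r.
rewrite big1 => [|j jn].
  rewrite addr0 big1 ?addr0// => i im.
  rewrite big1// => j _; rewrite (expr0n _ (m - i)) subn_eq0 leqNgt.
  have -> : (i < m)%N by rewrite ltn_neqAle -ltnS ltn_ord andbT.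
  by rewrite /= !(mul0r, mulr0).
rewrite (expr0n _ (n - j)) subn_eq0 leqNgt.
have -> : (j < n)%N by rewrite ltn_neqAle -ltnS ltn_ord andbT.
by rewrite /= !(mul0r, mulr0).
Qed.

(** The left-hand side is the term i = j = 0, and all other terms are nonnegative. *)
Lemma mart_poly_ge m n t a x : 0 <= t -> 0 <= a -> 0 <= x ->
  t ^+ m * a ^+ n <= mart_poly m n t a x.
Proof.
move=> t0 a0 x0; rewrite /mart_poly (bigD1 ord0)//= (bigD1 ord0)//=.
rewrite !bin0 !subn0 !mul1r moment_poly00 hornerC mulr1 -addrA lerDl.
rewrite addr_ge0//.
  rewrite sumr_ge0// => j _.
  by have := @term_ge0 m n t a x 0 j t0 a0 x0; rewrite bin0 subn0.
by rewrite sumr_ge0// => i _; rewrite sumr_ge0// => j _; exact: term_ge0.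
Qed.

Lemma mart_poly_le m n t a x y : 0 <= t -> 0 <= a -> 0 <= x -> x <= y ->
  mart_poly m n t a x <= mart_poly m n t a y.
Proof.
move=> t0 a0 x0 xy; rewrite ler_sum// => i _; rewrite ler_sum// => j _.
rewrite ler_wpM2l ?mulr_ge0// ler_wpM2l ?mulr_ge0 ?exprn_ge0//.
by apply: nneg_poly_horner_le => //; exact: moment_poly_ge0 (ltW mu0).
Qed.

(** Termwise: binomial coefficients grow with m, and the additional terms with i = m + 1 are
    nonnegative. *)
Lemma mart_polyS_ge m n t a x : 0 <= t -> 0 <= a -> 0 <= x ->
  t * mart_poly m n t a x <= mart_poly m.+1 n t a x.
Proof.
move=> t0 a0 x0; rewrite /mart_poly [leRHS]big_ord_recr/= mulr_sumr.
apply: ler_wpDr; first by rewrite sumr_ge0// => j _; exact: term_ge0.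
rewrite ler_sum// => i _; rewrite mulr_sumr ler_sum// => j _.
rewrite mulrCA; apply: ler_pM; rewrite ?mulr_ge0 ?exprn_ge0//.
- by rewrite moment_poly_horner_ge0 ?(ltW mu0).
- by rewrite ler_wpM2r// ler_nat leq_bin2l.
- by rewrite subSn -1?ltnS// exprS !mulrA.
Qed.

(* [d/dt + x d/da + 1/2 d^2/dx^2 - mu d/dx] applied to a monomial
   [t^i a^j q.[x]]. *)
Definition generator (i j : nat) (q : {poly R}) (t a x : R) : R :=
  i%:R * t ^+ i.-1 * a ^+ j * q.[x]
  + x * (t ^+ i * (j%:R * a ^+ j.-1)) * q.[x]
  + t ^+ i * a ^+ j * (2^-1 * (q^`(2)).[x] - mu * (q^`()).[x]).

(** From (m - i) C(m, i) = (i + 1) C(m, i + 1): differentiating the powers of t amounts to lowering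
    the index of g. *)
Let binomial_shift m t (g : nat -> R) :
  \sum_(i < m.+1) 'C(m, i)%:R * ((m - i)%:R * t ^+ (m - i).-1 * g i) =
  \sum_(i < m.+1) 'C(m, i)%:R * (i%:R * t ^+ (m - i) * g i.-1).
Proof.
rewrite big_ord_recr/= subnn !(mul0r, mulr0) addr0.
rewrite [RHS]big_ord_recl/= !(mul0r, mulr0) add0r.
apply: eq_bigr => i _; rewrite /= !mulrA -!natrM.
by rewrite mulnC -mul_bin_left mulnC subnS.
Qed.

(** The equation for p_(i,j) turns the x-part of the generator into minus the source. The i-part of
    the source cancels d/dt ([s3] against [s1]) and its j-part cancels x d/da ([s4] against [s2]),
    both by [binomial_shift]. *)
Lemma generator_mart_poly m n t a x :
  \sum_(i < m.+1) \sum_(j < n.+1)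
    ('C(m, i)%:R * 'C(n, j)%:R) * generator (m - i) (n - j) (p i j) t a x = 0.
Proof.
pose c (i j : nat) : R := 'C(m, i)%:R * 'C(n, j)%:R.
pose s1 (i j : nat) := c i j * ((m - i)%:R * t ^+ (m - i).-1 * a ^+ (n - j) * (p i j).[x]).
pose s2 (i j : nat) :=
  c i j * (x * t ^+ (m - i) * ((n - j)%:R * a ^+ (n - j).-1) * (p i j).[x]).
pose s3 (i j : nat) := c i j * (t ^+ (m - i) * a ^+ (n - j) * (i%:R * (p i.-1 j).[x])).
pose s4 (i j : nat) := c i j * (t ^+ (m - i) * a ^+ (n - j) * (j%:R * (x * (p i j.-1).[x]))).
transitivity (\sum_(i < m.+1) \sum_(j < n.+1) (s1 i j - s3 i j) +
              \sum_(i < m.+1) \sum_(j < n.+1) (s2 i j - s4 i j)).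
  rewrite -big_split/=; apply: eq_bigr => i _.
  rewrite -big_split/=; apply: eq_bigr => j _.
  rewrite /generator; have -> : 2^-1 * ((p i j)^`(2)).[x] - mu * ((p i j)^`()).[x] =
      - (i%:R * (p i.-1 j).[x] + j%:R * (x * (p i j.-1).[x])).
    rewrite -!hornerZ -hornerN -hornerD moment_poly_ode ?gt_eqF//.
    by rewrite hornerN hornerD !hornerZ hornerM hornerX.
  by rewrite /s1 /s2 /s3 /s4 /c; ring.
rewrite [X in X + _](_ : _ = 0) ?add0r.
  rewrite big1// => i _; rewrite sumrB; apply/eqP; rewrite subr_eq0; apply/eqP.
  transitivity ('C(m, i)%:R * t ^+ (m - i) * x * \sum_(j < n.+1) 'C(n, j)%:R *
      ((n - j)%:R * a ^+ (n - j).-1 * (p i j).[x])).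
    by rewrite mulr_sumr; apply: eq_bigr => j _; rewrite /s2 /c; ring.
  rewrite (binomial_shift n a (fun j => (p i j).[x])).
  by rewrite mulr_sumr; apply: eq_bigr => j _; rewrite /s4 /c; ring.
rewrite exchange_big/= big1// => j _; rewrite sumrB; apply/eqP; rewrite subr_eq0; apply/eqP.
transitivity ('C(n, j)%:R * a ^+ (n - j) * \sum_(i < m.+1) 'C(m, i)%:R *
    ((m - i)%:R * t ^+ (m - i).-1 * (p i j).[x])).
  by rewrite mulr_sumr; apply: eq_bigr => i _; rewrite /s1 /c; ring.
rewrite (binomial_shift m t (fun i => (p i j).[x])).
by rewrite mulr_sumr; apply: eq_bigr => i _; rewrite /s3 /c; ring.
Qed.

End martingale_polynomial.


(** * One step of the Euler chain *)

Section polynomial_bounds.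
Context {R : realType}.
Implicit Types (p q r : {poly R}) (x u C : R).

Lemma poly_le_expR q : exists2 C, 0 <= C & forall x, `|q.[x]| <= C * expR `|x|.
Proof.
exists (\sum_(i < size q) `|q`_i| * i`!%:R).
  by rewrite sumr_ge0// => i _; rewrite mulr_ge0.
move=> x; rewrite horner_coef mulr_suml; apply: le_trans (ler_norm_sum _ _ _) _.
rewrite ler_sum// => i _; rewrite normrM normrX -mulrA ler_wpM2l//.
exact: exprn_le_expR.
Qed.

Lemma poly_antiderivative_le p u C : p.[0] = 0 ->
  (forall v, `|v| <= `|u| -> `|p^`().[v]| <= C) -> `|p.[u]| <= `|u| * C.
Proof. by move=> p0 h; apply: (le_norm_antiderivative p0 _ h). Qed.

Lemma poly_taylor1 p u C : (forall v, `|v| <= `|u| -> `|p^`().[v]| <= C) ->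
  `|p.[u] - p.[0]| <= `|u| * C.
Proof.
move=> h; set g := p - p.[0]%:P.
have gE v : g.[v] = p.[v] - p.[0] by rewrite /g !hornerE.
rewrite -gE; apply: poly_antiderivative_le => [|v vu]; first by rewrite gE subrr.
by rewrite /g derivB derivC subr0 h.
Qed.

Lemma poly_taylor2 p u C : (forall v, `|v| <= `|u| -> `|p^`()^`().[v]| <= C) ->
  `|p.[u] - p.[0] - p^`().[0] * u| <= `|u| ^+ 2 * C.
Proof.
move=> h; set g := p - p.[0]%:P - p^`().[0] *: 'X.
have gE v : g.[v] = p.[v] - p.[0] - p^`().[0] * v by rewrite /g !hornerE.
rewrite -gE expr2 -mulrA; apply: poly_antiderivative_le => [|v vu].
  by rewrite gE subrr mulr0 subr0.
have -> : g^`().[v] = p^`().[v] - p^`().[0].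
  by rewrite /g !derivB derivC subr0 derivZ derivX !hornerE.
have C0 : 0 <= C by apply: le_trans (h 0 _) => //; rewrite normr0.
apply: le_trans (ler_wpM2r C0 vu); apply: poly_taylor1 => w wv.
by apply: h; exact: le_trans vu.
Qed.

Lemma poly_taylor3 p u C : (forall v, `|v| <= `|u| -> `|p^`()^`()^`().[v]| <= C) ->
  `|p.[u] - p.[0] - p^`().[0] * u - 2^-1 * p^`()^`().[0] * u ^+ 2| <= `|u| ^+ 3 * C.
Proof.
move=> h; set g := p - p.[0]%:P - p^`().[0] *: 'X - (2^-1 * p^`()^`().[0]) *: 'X^2.
have gE v : g.[v] = p.[v] - p.[0] - p^`().[0] * v - 2^-1 * p^`()^`().[0] * v ^+ 2.
  by rewrite /g !hornerE.
rewrite -gE (exprS `|u| 2) -mulrA; apply: poly_antiderivative_le => [|v vu].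
  by rewrite gE expr0n/=; ring.
have -> : g^`().[v] = p^`().[v] - p^`().[0] - p^`()^`().[0] * v.
  by rewrite /g !derivB derivC subr0 !derivZ derivX derivXn !hornerE/=; field.
have C0 : 0 <= C by apply: le_trans (h 0 _) => //; rewrite normr0.
have v2u2 : `|v| ^+ 2 <= `|u| ^+ 2 by rewrite lerXn2r.
apply: le_trans (ler_wpM2r C0 v2u2); apply: poly_taylor2 => w wv.
by apply: h; exact: le_trans vu.
Qed.

(** A step may overshoot below 0, where the moment polynomials are no longer nonnegative; clipping
    keeps their argument in [0, +oo[. *)
Definition pos_part x : R := Num.max x 0.

Lemma horner_shift_bound q : exists2 C, 0 <= C &
  forall x u, 0 <= x -> `|q.[x + u]| <= C * expR x * expR `|u|.
Proof.
have [C C0 qC] := poly_le_expR q; exists C => // x u x0.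
apply: le_trans (qC _) _; rewrite -mulrA -expRD ler_wpM2l// ler_expR.
by rewrite (le_trans (ler_normD _ _))// ger0_norm.
Qed.

(** Clipping acts only if u < - x <= - eps. The extra error |q(0) - q(x + u)| is then multiplied by
    (|u| / eps)^3 >= 1, which gives it the form of the cubic remainder and explains the term
    [2 * C / eps ^+ 3] of the constant. *)
Lemma clipped_taylor q eps : 0 < eps -> exists2 C, 0 <= C & forall x u, eps <= x ->
  `|q.[pos_part (x + u)] - q.[x] - q^`().[x] * u - 2^-1 * q^`()^`().[x] * u ^+ 2|
    <= C * expR x * (`|u| ^+ 3 * expR `|u|).
Proof.
move=> e0; have [C3 C30 q3] := horner_shift_bound q^`()^`()^`().
have [C C0 qC] := poly_le_expR q.
exists (C3 + 2 * C / eps ^+ 3).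
  by rewrite addr_ge0 ?divr_ge0 ?mulr_ge0 ?exprn_ge0 ?(ltW e0).
move=> x u ex; have x0 : 0 < x by exact: lt_le_trans ex.
have taylor : `|q.[x + u] - q.[x] - q^`().[x] * u - 2^-1 * q^`()^`().[x] * u ^+ 2|
    <= C3 * expR x * (`|u| ^+ 3 * expR `|u|).
  pose p := q \Po ('X + x%:P).
  have dp r : (r \Po ('X + x%:P))^`() = r^`() \Po ('X + x%:P).
    by rewrite deriv_comp derivD derivX derivC addr0 mulr1.
  have pE r v : (r \Po ('X + x%:P)).[v] = r.[x + v].
    by rewrite horner_comp !hornerE addrC.
  have := @poly_taylor3 p u (C3 * expR x * expR `|u|).
  rewrite /p !dp !pE addr0.
  move=> h; rewrite [leRHS]mulrCA; apply: h => v vu; rewrite pE.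
  apply: le_trans (q3 _ _ (ltW x0)) _.
  by rewrite ler_wpM2l ?mulr_ge0 ?expR_ge0// ler_expR.
rewrite 2!mulrDl; have [xu|xu] := leP 0 (x + u).
  rewrite /pos_part max_l//; apply: le_trans taylor _; rewrite lerDl.
  by rewrite !mulr_ge0 ?invr_ge0 ?expR_ge0 ?exprn_ge0 ?(ltW e0).
rewrite /pos_part max_r ?(ltW xu)//.
have -> : q.[0] - q.[x] - q^`().[x] * u - 2^-1 * q^`()^`().[x] * u ^+ 2 =
    (q.[x + u] - q.[x] - q^`().[x] * u - 2^-1 * q^`()^`().[x] * u ^+ 2)
    + (q.[0] - q.[x + u]) by ring.
apply: le_trans (ler_normD _ _) _; apply: lerD => //.
have un : `|u| = - u by rewrite ltr0_norm//; lra.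
have eu : eps <= `|u| by rewrite un; lra.
(* Here x + u < 0 < x, so |x + u| <= |u|, and both values of q are at most [C * expR |u|]. *)
apply: (@le_trans _ _ (2 * C * expR `|u|)).
  rewrite mulr2n mulrDl mul1r mulrDl; apply: le_trans (ler_normB _ _) _.
  apply: lerD; apply: le_trans (qC _) _; rewrite ler_wpM2l// ler_expR ?normr0//.
  by rewrite un ltr0_norm//; lra.
rewrite -[leRHS]mulrA; rewrite -[X in X <= _]mul1r.
have -> : 2 * C / eps ^+ 3 * (expR x * (`|u| ^+ 3 * expR `|u|)) =
  ((`|u| / eps) ^+ 3 * expR x) * (2 * C * expR `|u|).
  by rewrite expr_div_n; ring.
rewrite ler_wpM2r ?mulr_ge0 ?expR_ge0//.
rewrite mulr_ege1//; last by rewrite -expR0 ler_expR ltW.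
by rewrite exprn_ege1// ler_pdivlMr// mul1r.
Qed.

End polynomial_bounds.


Lemma Rintegral_dist_le d (T : measurableType d) (R : realType)
    (m : {measure set T -> \bar R}) (f g h : T -> R) :
  m.-integrable setT (EFin \o f) -> m.-integrable setT (EFin \o g) ->
  m.-integrable setT (EFin \o h) -> (forall x, `|f x - g x| <= h x) ->
  `|\int[m]_x f x - \int[m]_x g x| <= \int[m]_x h x.
Proof.
move=> mf mg mh fgh; rewrite -RintegralB//.
have mfg : m.-integrable setT (EFin \o (fun x => f x - g x)).
  exact: (integrableB measurableT mf mg).
apply: le_trans (le_normr_Rintegral _ mfg) _ => //.
by apply: le_Rintegral => //; exact: integrable_norm mfg.
Qed.

Section clipped_expectation.
Context {R : realType} (mu : R).
Hypothesis mu0 : 0 <= mu.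

Lemma measurable_pos_part : measurable_fun [set: R] (@pos_part R).
Proof. exact: measurable_funrpos (@measurable_id _ R setT). Qed.

(** The drift displacement [mu * s ^+ 2] is at most [mu * s], so it leaves the cubic moment of order
    s^3. An explicit majorant h is supplied because it serves as dominating integrable function
    later. *)
Lemma normal_drift_cubic_le : exists2 K, 0 <= K & forall s : R, 0 < s -> s <= 1 ->
  exists2 h : R -> R, (normal_prob 0 s).-integrable setT (EFin \o h) /\
      \int[normal_prob 0 s]_z h z <= K * s ^+ 3 &
    forall z, `|z - mu * s ^+ 2| ^+ 3 * expR `|z - mu * s ^+ 2| <= h z.
Proof.
pose L : R := 12 * expR 2 + mu ^+ 3 * (2 * expR 1).
exists (4 * expR mu * L).
  by rewrite !mulr_ge0 ?addr_ge0 ?mulr_ge0 ?expR_ge0 ?exprn_ge0.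
move=> s s0 s1; set g := normal_prob 0 s.
have i3 := normal_integrable_cubic s0; have i1 := normal_integrable_expR_norm s0.
have i1' : g.-integrable setT (EFin \o (fun z : R => mu ^+ 3 * s ^+ 3 * expR `|z|)).
  exact: (@integrableZl _ _ _ g _ measurableT (mu ^+ 3 * s ^+ 3) _ i1).
have i31 : g.-integrable setT (EFin \o (fun z : R =>
    `|z| ^+ 3 * expR `|z| + mu ^+ 3 * s ^+ 3 * expR `|z|)).
  exact: (integrableD measurableT i3 i1').
exists (fun z => 4 * expR mu *
  (`|z| ^+ 3 * expR `|z| + mu ^+ 3 * s ^+ 3 * expR `|z|)).
  split; first exact: (@integrableZl _ _ _ g _ measurableT (4 * expR mu) _ i31).
  rewrite RintegralZl// RintegralD// RintegralZl// -[leRHS]mulrA ler_wpM2l ?mulr_ge0 ?expR_ge0//.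
  rewrite /L mulrDl; apply: lerD; first exact: normal_cubic_le.
  rewrite mulrAC ler_wpM2r ?exprn_ge0 ?(ltW s0)// ler_wpM2l ?exprn_ge0//.
  exact: normal_expR_norm_le.
move=> z; set u := z - mu * s ^+ 2.
have m0 : 0 <= mu * s ^+ 2 by rewrite mulr_ge0 ?sqr_ge0.
have uz : `|u| <= `|z| + mu * s ^+ 2.
  by apply: le_trans (ler_normB _ _) _; rewrite [X in _ + X]ger0_norm.
have ms : mu * s ^+ 2 <= mu * s by rewrite ler_wpM2l// expr2 ler_piMl// ltW.
have ms1 : mu * s ^+ 2 <= mu.
  by rewrite ler_piMr// exprn_ile1// ltW.
have u3 : `|u| ^+ 3 <= 4 * (`|z| ^+ 3 + mu ^+ 3 * s ^+ 3).
  apply: (@le_trans _ _ ((`|z| + mu * s) ^+ 3)).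
    by rewrite lerXn2r ?nnegrE ?addr_ge0// ?(le_trans uz) ?lerD// (le_trans m0).
  rewrite -exprMn; set a := `|z|; set b := mu * s.
  have a0 : 0 <= a by rewrite /a.
  have b0 : 0 <= b by rewrite mulr_ge0// ltW.
  rewrite -subr_ge0 (_ : _ - _ = 3 * (a + b) * (a - b) ^+ 2); last by ring.
  by apply: mulr_ge0; [rewrite mulr_ge0 ?addr_ge0|exact: sqr_ge0].
have eu : expR `|u| <= expR mu * expR `|z|.
  by rewrite -expRD ler_expR (le_trans uz)// addrC lerD.
apply: le_trans (ler_pM _ _ u3 eu) _; rewrite ?exprn_ge0 ?expR_ge0//.
by rewrite le_eqVlt; apply/orP; left; apply/eqP; ring.
Qed.

Lemma clipped_integrable (q : {poly R}) (s x c : R) : 0 < s -> s <= 1 ->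
  (normal_prob 0 s).-integrable setT
    (EFin \o (fun z => q.[pos_part (x + (z - c))])).
Proof.
move=> s0 s1; have [C C0 qC] := poly_le_expR q.
apply: (@normal_integrable_bounded _ _ s0 _ (C * expR (`|x| + `|c|))) => [|z].
  have mz : measurable_fun [set: R] (fun z => x + (z - c)).
    by apply: measurable_funD => //; exact: measurable_funB.
  have mq : measurable_fun [set: R] (horner q) by exact: measurable_poly.
  exact: (measurableT_comp mq (measurableT_comp measurable_pos_part mz)).
apply: le_trans (qC _) _; rewrite -mulrA -expRD ler_wpM2l// ler_expR.
have -> : `|pos_part (x + (z - c))| = pos_part (x + (z - c)).
  by rewrite ger0_norm// /pos_part le_max lexx orbT.
rewrite /pos_part ge_max addr_ge0 ?addr_ge0// andbT.
apply: le_trans (ler_norm _) _; apply: le_trans (ler_normD _ _) _.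
by rewrite -addrA lerD2l addrC; exact: ler_normB.
Qed.

(** The mean of the second-order Taylor polynomial is computed exactly: the drift contributes - mu
    q' and the variance q'' / 2, both times s^2. The cubic remainder is integrated by
    [normal_drift_cubic_le]. *)
Lemma clipped_expectation (q : {poly R}) eps : 0 < eps -> exists2 C, 0 <= C &
  forall s x, 0 < s -> s <= 1 -> eps <= x ->
  `|\int[normal_prob 0 s]_z q.[pos_part (x + (z - mu * s ^+ 2))] - q.[x]
     - s ^+ 2 * (2^-1 * q^`()^`().[x] - mu * q^`().[x])| <= C * s ^+ 3 * expR x.
Proof.
move=> e0; have [C1 C10 qC1] := clipped_taylor q e0.
have [C2 C20 qC2] := poly_le_expR q^`()^`().
have [K K0 hK] := normal_drift_cubic_le.
exists (C1 * K + 2^-1 * mu ^+ 2 * C2).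
  by rewrite addr_ge0 ?mulr_ge0 ?exprn_ge0 ?invr_ge0.
move=> s x s0 s1 ex; have x0 : 0 < x by exact: lt_le_trans ex.
have [h [hi hle] hz] := hK s s0 s1.
set g := normal_prob 0 s; set m := mu * s ^+ 2.
set q0 := q.[x]; set q1 := q^`().[x]; set q2 := q^`()^`().[x].
(* Coefficients in z of the Taylor polynomial at u = z - m. *)
pose c0 := q0 - q1 * m + 2^-1 * q2 * m ^+ 2; pose c1 := q1 - q2 * m.
have j0 : g.-integrable setT (EFin \o (cst c0 : R -> R)).
  exact: finite_measure_integrable_cst.
have j1 : g.-integrable setT (EFin \o (fun z : R => c1 * z)).
  exact: (@integrableZl _ _ _ g _ measurableT c1 _ (normal_integrable_id s0)).
have j2 : g.-integrable setT (EFin \o (fun z : R => 2^-1 * q2 * z ^+ 2)).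
  exact: (@integrableZl _ _ _ g _ measurableT (2^-1 * q2) _ (normal_integrable_sqr s0)).
have j01 : g.-integrable setT (EFin \o (fun z : R => c0 + c1 * z)).
  exact: (integrableD measurableT j0 j1).
have j012 : g.-integrable setT (EFin \o (fun z : R => c0 + c1 * z + 2^-1 * q2 * z ^+ 2)).
  exact: (integrableD measurableT j01 j2).
have jE : \int[g]_z (c0 + c1 * z + 2^-1 * q2 * z ^+ 2) = c0 + 2^-1 * q2 * s ^+ 2.
  rewrite RintegralD// RintegralD// RintegralZl//; last exact: normal_integrable_id.
  rewrite RintegralZl//; last exact: normal_integrable_sqr.
  rewrite normal_mean// normal_variance// mulr0 addr0.
  by rewrite Rintegral_cst// [X in fine X]probability_setT mulr1.
have j3 : g.-integrable setT (EFin \o (fun z => C1 * expR x * h z)).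
  exact: (@integrableZl _ _ _ g _ measurableT (C1 * expR x) _ hi).
have := @Rintegral_dist_le _ _ _ g _ _ _ (clipped_integrable q x m s0 s1) j012 j3.
rewrite jE RintegralZl// => hd.
have {hd} : `|\int[g]_z q.[pos_part (x + (z - m))] - (c0 + 2^-1 * q2 * s ^+ 2)| <=
    C1 * expR x * \int[g]_z h z.
  apply: hd => z; apply: le_trans (ler_wpM2l _ (hz z)); last by rewrite mulr_ge0 ?expR_ge0.
  apply: le_trans (qC1 x (z - m) ex); rewrite le_eqVlt; apply/orP; left; apply/eqP.
  by congr Num.norm; rewrite /c0 /c1 -/q0 -/q1 -/q2; field.
set I := Rintegral _ _ _ => hd.
(* The squared drift displacement, of order s^4, is the only discrepancy between the mean of the
   Taylor polynomial and the generator. *)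
have -> : I - q0 - s ^+ 2 * (2^-1 * q2 - mu * q1) =
    (I - (c0 + 2^-1 * q2 * s ^+ 2)) + 2^-1 * mu ^+ 2 * s ^+ 4 * q2.
  by rewrite /c0 /m; ring.
apply: le_trans (ler_normD _ _) _; rewrite !mulrDl; apply: lerD.
  apply: le_trans hd _.
  have -> : C1 * K * s ^+ 3 * expR x = C1 * expR x * (K * s ^+ 3) by ring.
  by rewrite ler_wpM2l ?mulr_ge0 ?expR_ge0.
rewrite normrM ger0_norm ?mulr_ge0 ?exprn_ge0 ?invr_ge0 ?(ltW s0)//.
have -> : 2^-1 * mu ^+ 2 * C2 * s ^+ 3 * expR x =
    2^-1 * mu ^+ 2 * s ^+ 3 * (C2 * expR x) by ring.
apply: ler_pM; rewrite ?mulr_ge0 ?exprn_ge0 ?invr_ge0 ?(ltW s0)//.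
  rewrite ler_wpM2l ?mulr_ge0 ?exprn_ge0 ?invr_ge0//.
  by rewrite (exprS s 3) ler_piMl ?exprn_ge0// ltW.
by apply: le_trans (qC2 _) _; rewrite ger0_norm// ltW.
Qed.

End clipped_expectation.


Section shift_polynomial.
Context {R : realType} (t a x T : R).
Hypotheses (t0 : 0 <= t) (tT : t <= T) (a0 : 0 <= a) (x0 : 0 <= x).

(** A polynomial in the elapsed time v. The factor [x ^+ p] collects what differentiating (a + x
    v)^l produces, so that the family is closed under derivation. *)
Definition shift_poly (k l p : nat) : {poly R} :=
  x ^+ p *: (('X + t%:P) ^+ k * (x *: 'X + a%:P) ^+ l).

(** The factorial comes from (a + x)^(l + p) <= (l + p)! [expR (a + x)]. *)
Definition shift_bound (k l p : nat) : R := (T + 1) ^+ k * (l + p)`!%:R.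

Lemma shift_poly_horner k l p v :
  (shift_poly k l p).[v] = x ^+ p * ((t + v) ^+ k * (a + x * v) ^+ l).
Proof.
by rewrite /shift_poly hornerZ hornerM !horner_exp !hornerE (addrC v) (addrC (x * v)).
Qed.

Lemma shift_poly_deriv k l p : (shift_poly k l p)^`() =
  k%:R *: shift_poly k.-1 l p + l%:R *: shift_poly k l.-1 p.+1.
Proof.
rewrite /shift_poly derivZ derivM !deriv_exp !derivD !derivC !addr0 derivZ !derivX.
rewrite mul1r mulr_algl !scaler_nat mulrnAl mulrnAr -scalerAr scalerDr !scalerMnr.
by rewrite scalerA -exprSr.
Qed.

Lemma shift_poly_le k l p v : `|v| <= 1 ->
  `|(shift_poly k l p).[v]| <= shift_bound k l p * expR (a + x).
Proof.
move=> v1; rewrite shift_poly_horner mulrCA normrM -mulrA.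
have tv : `|t + v| <= T + 1.
  by apply: le_trans (ler_normD _ _) _; rewrite lerD// ger0_norm.
have av : `|a + x * v| <= a + x.
  apply: le_trans (ler_normD _ _) _; rewrite ger0_norm// lerD2l normrM ger0_norm//.
  by rewrite ler_piMr.
apply: ler_pM => //; first by rewrite normrX lerXn2r ?nnegrE// (le_trans _ tv).
rewrite normrM !normrX (ger0_norm x0).
apply: (@le_trans _ _ ((a + x) ^+ (l + p))); last by rewrite exprn_le_expR// addr_ge0.
rewrite addnC exprD; apply: ler_pM; rewrite ?exprn_ge0//.
  by rewrite lerXn2r ?nnegrE ?addr_ge0// lerDr.
by rewrite lerXn2r ?nnegrE ?addr_ge0.
Qed.

Definition shift_bound1 (k l p : nat) : R :=
  k%:R * shift_bound k.-1 l p + l%:R * shift_bound k l.-1 p.+1.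

Definition shift_bound2 (k l p : nat) : R :=
  k%:R * shift_bound1 k.-1 l p + l%:R * shift_bound1 k l.-1 p.+1.

Lemma shift_poly_deriv_le k l p v : `|v| <= 1 ->
  `|(shift_poly k l p)^`().[v]| <= shift_bound1 k l p * expR (a + x).
Proof.
move=> v1; rewrite shift_poly_deriv hornerD (hornerZ k%:R) (hornerZ l%:R).
apply: le_trans (ler_normD _ _) _; rewrite !normrM !normr_nat mulrDl.
by apply: lerD; rewrite -[leRHS]mulrA ler_wpM2l//; exact: shift_poly_le.
Qed.

Lemma shift_poly_deriv2_le k l p v : `|v| <= 1 ->
  `|(shift_poly k l p)^`()^`().[v]| <= shift_bound2 k l p * expR (a + x).
Proof.
move=> v1; rewrite shift_poly_deriv derivD (derivZ k%:R) (derivZ l%:R).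
rewrite hornerD (hornerZ k%:R) (hornerZ l%:R).
apply: le_trans (ler_normD _ _) _; rewrite !normrM !normr_nat mulrDl.
by apply: lerD; rewrite -[leRHS]mulrA ler_wpM2l//; exact: shift_poly_deriv_le.
Qed.

End shift_polynomial.

(** Time and area move deterministically during a step, so their monomial is expanded as a
    polynomial in the step length v, to orders 0, 1 and 2. *)
Lemma shift_taylor (R : realType) (T : R) (i j : nat) : 0 <= T ->
  exists2 C, 0 <= C & forall t a x v, 0 <= t -> t <= T -> 0 <= a -> 0 <= x ->
    0 <= v -> v <= 1 ->
  [/\ `|(t + v) ^+ i * (a + x * v) ^+ j| <= C * expR (a + x),
    `|(t + v) ^+ i * (a + x * v) ^+ j - t ^+ i * a ^+ j| <= C * v * expR (a + x) &
    `|(t + v) ^+ i * (a + x * v) ^+ j - t ^+ i * a ^+ j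
      - v * (i%:R * t ^+ i.-1 * a ^+ j + x * (t ^+ i * (j%:R * a ^+ j.-1)))|
      <= C * v ^+ 2 * expR (a + x)].
Proof.
move=> T0.
have b0 k l p : 0 <= shift_bound T k l p.
  by rewrite mulr_ge0// exprn_ge0// addr_ge0.
have b10 k l p : 0 <= shift_bound1 T k l p by rewrite addr_ge0// mulr_ge0.
have b20 k l p : 0 <= shift_bound2 T k l p by rewrite addr_ge0// mulr_ge0.
set C0 := shift_bound T i j 0; set C1 := shift_bound1 T i j 0.
set C2 := shift_bound2 T i j 0.
have C00 : 0 <= C0 by exact: b0.
have C10 : 0 <= C1 by exact: b10.
have C20 : 0 <= C2 by exact: b20.
have le3 (u v w : R) : 0 <= u -> 0 <= v -> 0 <= w ->
    [/\ u <= u + v + w, v <= u + v + w & w <= u + v + w] by move=> *; split; lra.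
have [l0 l1 l2] := le3 _ _ _ C00 C10 C20.
exists (C0 + C1 + C2); first exact: le_trans l0.
move=> t a x v t0 tT a0 x0 v0 v1.
pose P := shift_poly t a x i j 0.
have PE u : P.[u] = (t + u) ^+ i * (a + x * u) ^+ j.
  by rewrite /P shift_poly_horner expr0 mul1r.
have P0 : P.[0] = t ^+ i * a ^+ j by rewrite PE mulr0 !addr0.
have P1 : P^`().[0] = i%:R * t ^+ i.-1 * a ^+ j + x * (t ^+ i * (j%:R * a ^+ j.-1)).
  rewrite /P shift_poly_deriv hornerD (hornerZ i%:R) (hornerZ j%:R).
  rewrite !shift_poly_horner mulr0 !addr0.
  by rewrite expr0 expr1; ring.
have vn : `|v| = v by rewrite ger0_norm.
have v1' : `|v| <= 1 by rewrite vn.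
have e0 : 0 <= expR (a + x) by exact: expR_ge0.
rewrite -PE -P0 -P1; split.
- apply: le_trans (shift_poly_le t0 tT a0 x0 _ _ _ v1') _.
  exact: ler_wpM2r.
- apply: (@le_trans _ _ (v * (C1 * expR (a + x)))).
    rewrite -[v in leRHS]vn; apply: poly_taylor1 => w wv.
    by apply: shift_poly_deriv_le => //; exact: le_trans v1'.
  by rewrite mulrA (mulrC v) ler_wpM2r// ler_wpM2r.
- apply: (@le_trans _ _ (v ^+ 2 * (C2 * expR (a + x)))).
    rewrite -[v in leRHS]vn (mulrC v); apply: poly_taylor2 => w wv.
    by apply: shift_poly_deriv2_le => //; exact: le_trans v1'.
  by rewrite mulrA (mulrC (v ^+ 2)) ler_wpM2r// ler_wpM2r ?sqr_ge0.
Qed.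

Section one_step.
Context {R : realType} (mu eps T : R).
Hypotheses (mu0 : 0 < mu) (eps0 : 0 < eps) (T0 : 0 <= T).
Implicit Types f G : R -> R -> R -> R.

(* With [h = s^2]: the expected change of [f] over a time step [h] is
   [h * G] up to [O(h^(3/2))]. *)
Definition one_step f G := exists2 C, 0 <= C & forall s t a x,
  0 < s -> s <= 1 -> 0 <= t -> t <= T -> 0 <= a -> eps <= x ->
  let g z := f (t + s ^+ 2) (a + x * s ^+ 2)
               (pos_part (x + (z - mu * s ^+ 2))) in
  (normal_prob 0 s).-integrable setT (EFin \o g) /\
  `|\int[normal_prob 0 s]_z g z - f t a x - s ^+ 2 * G t a x| <=
    C * s ^+ 3 * expR (a + 2 * x).

Lemma one_step0 : one_step (fun _ _ _ => 0) (fun _ _ _ => 0).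
Proof.
exists 0 => // s t a x *; split; first exact: integrable0.
by rewrite Rintegral_cst// mul0r mulr0 !subr0 normr0 !mul0r.
Qed.

Lemma one_stepD f1 G1 f2 G2 : one_step f1 G1 -> one_step f2 G2 ->
  one_step (fun t a x => f1 t a x + f2 t a x) (fun t a x => G1 t a x + G2 t a x).
Proof.
move=> [C1 C10 h1] [C2 C20 h2]; exists (C1 + C2); first by rewrite addr_ge0.
move=> s t a x s0 s1 t0 tT a0 ex g.
have [i1 b1] := h1 s t a x s0 s1 t0 tT a0 ex.
have [i2 b2] := h2 s t a x s0 s1 t0 tT a0 ex.
split; first exact: (integrableD measurableT i1 i2).
rewrite RintegralD//; set I1 := Rintegral _ _ _; set I2 := Rintegral _ _ _.
have -> : I1 + I2 - (f1 t a x + f2 t a x) - s ^+ 2 * (G1 t a x + G2 t a x) =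
  (I1 - f1 t a x - s ^+ 2 * G1 t a x) + (I2 - f2 t a x - s ^+ 2 * G2 t a x) by ring.
apply: le_trans (ler_normD _ _) _.
rewrite [leRHS](_ : _ =
  C1 * s ^+ 3 * expR (a + 2 * x) + C2 * s ^+ 3 * expR (a + 2 * x)); last by ring.
exact: lerD.
Qed.

Lemma one_stepZ c f G : one_step f G ->
  one_step (fun t a x => c * f t a x) (fun t a x => c * G t a x).
Proof.
move=> [C C0 h]; exists (`|c| * C); first by rewrite mulr_ge0.
move=> s t a x s0 s1 t0 tT a0 ex g.
have [i1 b1] := h s t a x s0 s1 t0 tT a0 ex.
split; first exact: (@integrableZl _ _ _ (normal_prob 0 s) _ measurableT c _ i1).
rewrite RintegralZl//; set I := Rintegral _ _ _.
have -> : c * I - c * f t a x - s ^+ 2 * (c * G t a x) =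
  c * (I - f t a x - s ^+ 2 * G t a x) by ring.
by rewrite normrM -!(mulrA `|c|) ler_wpM2l.
Qed.

Lemma one_step_sum (I : Type) (r : seq I) (f G : I -> R -> R -> R -> R) :
  (forall i, one_step (f i) (G i)) ->
  one_step (fun t a x => \sum_(i <- r) f i t a x)
           (fun t a x => \sum_(i <- r) G i t a x).
Proof.
move=> h; elim: r => [|i r IH].
  rewrite [X in one_step X](_ : _ = (fun _ _ _ => 0)).
    rewrite [X in one_step _ X](_ : _ = (fun _ _ _ => 0)); first exact: one_step0.
    by apply/funext => t; apply/funext => a; apply/funext => x; rewrite big_nil.
  by apply/funext => t; apply/funext => a; apply/funext => x; rewrite big_nil.
have := one_stepD (h i) IH; congr (one_step _ _);
  by apply/funext => t; apply/funext => a; apply/funext => x; rewrite big_cons.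
Qed.

(** The mean factors into the deterministic time-area monomial and a Gaussian mean. Errors of the
    first carry [expR (a + x)] and those of the second [expR x], whence the weight
    [expR (a + 2 * x)]. *)
Lemma one_step_monomial i j (q : {poly R}) :
  one_step (fun t a x => t ^+ i * a ^+ j * q.[x]) (generator mu i j q).
Proof.
have [C1 C10 h1] := clipped_expectation (ltW mu0) q eps0.
have [C2 C20 h2] := @shift_taylor _ T i j T0.
have [C3 C30 h3] := poly_le_expR (2^-1 *: q^`()^`() - mu *: q^`()).
have [C4 C40 h4] := poly_le_expR q.
exists (C2 * C1 + C2 * C3 + C2 * C4); first by rewrite !addr_ge0 ?mulr_ge0.
move=> s t a x s0 s1 t0 tT a0 ex g; have x0 : 0 < x by exact: lt_le_trans ex.
have e0 := expR_ge0 x.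
set A := (t + s ^+ 2) ^+ i * (a + x * s ^+ 2) ^+ j.
have iq := clipped_integrable q x (mu * s ^+ 2) s0 s1.
split; first exact: (@integrableZl _ _ _ (normal_prob 0 s) _ measurableT A _ iq).
rewrite /g RintegralZl// -/A; set Iq := Rintegral _ _ _.
have h0 : 0 <= s ^+ 2 by exact: sqr_ge0.
have hl1 : s ^+ 2 <= 1 by rewrite exprn_ile1// ltW.
have [a1 a2 a3] := h2 t a x (s ^+ 2) t0 tT a0 (ltW x0) h0 hl1.
have b1 := h1 s x s0 s1 ex; rewrite -/Iq in b1.
pose L := 2^-1 * q^`()^`().[x] - mu * q^`().[x]; rewrite -/L in b1.
have b3 : `|L| <= C3 * expR x.
  by have := h3 x; rewrite !hornerE (ger0_norm (ltW x0)).
have b4 : `|q.[x]| <= C4 * expR x by have := h4 x; rewrite (ger0_norm (ltW x0)).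
pose P0 := t ^+ i * a ^+ j.
pose P1 := i%:R * t ^+ i.-1 * a ^+ j + x * (t ^+ i * (j%:R * a ^+ j.-1)).
rewrite -/A -/P0 -/P1 in a1 a2 a3.
(* Product rule with remainders: the three summands are of order s^3, s^4 and s^4, and s^4 <=
   s^3. *)
have -> : A * Iq - P0 * q.[x] - s ^+ 2 * generator mu i j q t a x =
    A * (Iq - q.[x] - s ^+ 2 * L) + (A - P0) * (s ^+ 2 * L)
    + (A - P0 - s ^+ 2 * P1) * q.[x].
  rewrite /generator [q^`(2)](_ : _ = q^`()^`())// -/L.
  have -> : i%:R * t ^+ i.-1 * a ^+ j * q.[x] +
     x * (t ^+ i * (j%:R * a ^+ j.-1)) * q.[x] + t ^+ i * a ^+ j * L =
     P1 * q.[x] + P0 * L by rewrite /P1 /P0; ring.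
  by ring.
have -> : expR (a + 2 * x) = expR (a + x) * expR x by rewrite -expRD; congr expR; ring.
have s43 : s ^+ 2 * s ^+ 2 <= s ^+ 3.
  by rewrite -exprD (exprS s 3) ler_piMl ?exprn_ge0// ltW.
have eax := expR_ge0 (a + x).
set e2 := expR (a + x) * expR x; have e20 : 0 <= e2 by exact: mulr_ge0.
rewrite [leRHS](_ : _ = C2 * C1 * s ^+ 3 * e2 + C2 * C3 * s ^+ 3 * e2
  + C2 * C4 * s ^+ 3 * e2); last by ring.
rewrite /e2; apply: le_trans (ler_normD _ _) _; apply: lerD.
  apply: le_trans (ler_normD _ _) _; apply: lerD; rewrite normrM.
    apply: le_trans (ler_pM _ _ a1 b1) _ => //.
    by rewrite le_eqVlt; apply/orP; left; apply/eqP; ring.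
  rewrite normrM (ger0_norm h0).
  apply: le_trans (ler_pM _ _ a2 (ler_wpM2l h0 b3)) _; rewrite ?mulr_ge0 ?(ltW s0)//.
  rewrite [leLHS](_ : _ = C2 * C3 * (expR (a + x) * expR x) * (s ^+ 2 * s ^+ 2)); last by ring.
  rewrite [leRHS](_ : _ = C2 * C3 * (expR (a + x) * expR x) * s ^+ 3); last by ring.
  by rewrite ler_wpM2l ?mulr_ge0.
rewrite normrM; apply: le_trans (ler_pM _ _ a3 b4) _ => //.
rewrite [leLHS](_ : _ = C2 * C4 * (expR (a + x) * expR x) * (s ^+ 2 * s ^+ 2)); last by ring.
rewrite [leRHS](_ : _ = C2 * C4 * (expR (a + x) * expR x) * s ^+ 3); last by ring.
by rewrite ler_wpM2l ?mulr_ge0.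
Qed.

Lemma one_step_mart_poly m n : one_step (mart_poly mu m n) (fun _ _ _ => 0).
Proof.
pose c (i j : nat) : R := 'C(m, i)%:R * 'C(n, j)%:R.
have := @one_step_sum _ (index_enum 'I_m.+1) _ _ (fun i =>
  @one_step_sum _ (index_enum 'I_n.+1) _ _ (fun j =>
    @one_stepZ (c i j) _ _ (one_step_monomial (m - i) (n - j) (moment_poly mu i j)))).
congr (one_step _ _).
apply/funext => t; apply/funext => a; apply/funext => x.
exact: generator_mart_poly.
Qed.

End one_step.

(** * The stopped chain driven by independent increments *)

Section freezing.
Context {R : realType} d (T : measurableType d) (P : probability T R).
Variables (xi : nat -> T -> measurableTypeR R) (g : probability (measurableTypeR R) R).
Hypothesis xi_measurable : forall i, measurable_fun setT (xi i).
Hypothesis xi_law : forall i A, measurable A -> P (xi i @^-1` A) = g A.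
Hypothesis xi_indep : forall n (A : nat -> set (measurableTypeR R)),
  (forall i, measurable (A i)) ->
  P [set w | forall i, (i < n)%N -> A i (xi i w)] =
  (\prod_(i < n) P (xi i @^-1` A i))%E.

(** A family stable under intersection that generates the past, in the product form of
    [xi_indep]. *)
Definition past_cylinder k : set (set T) :=
  [set E | exists2 A : nat -> set (measurableTypeR R), (forall i, measurable (A i)) &
     E = [set w | forall i, (i < k)%N -> A i (xi i w)]].

Definition past k : set (set T) := <<s past_cylinder k>>.

Let xi_preimage i A : measurable A -> measurable (xi i @^-1` A).
Proof. by move=> mA; rewrite -[_ @^-1` _]setTI; exact: xi_measurable. Qed.

Lemma past_cylinder_measurable k : past_cylinder k `<=` measurable.
Proof.
move=> _ [A mA ->].
rewrite (_ : [set w | _] = \bigcap_(i in [set i | (i < k)%N]) (xi i @^-1` A i)).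
  by apply: bigcap_measurableType => i _; exact: xi_preimage.
by apply/seteqP; split => w /= h i; exact: h.
Qed.

Lemma past_measurable k : past k `<=` measurable.
Proof.
apply: smallest_sub; first exact: sigma_algebra_measurable.
exact: past_cylinder_measurable.
Qed.

Lemma past_xi k i A : (i < k)%N -> measurable A -> past k (xi i @^-1` A).
Proof.
move=> ik mA; apply: sub_sigma_algebra.
exists (fun j => if j == i then A else setT).
  by move=> j; case: ifP.
apply/seteqP; split => w /=.
  by move=> Aw j _; case: eqP => [->|].
by move=> /(_ _ ik); rewrite eqxx.
Qed.

(** For fixed A both sides are finite measures of E, and they agree on the generating cylinders. *)
Lemma past_indep k E A : past k E -> measurable A ->
  P (E `&` xi k @^-1` A) = (P E * g A)%E.
Proof.
move=> kE mA.
have mXA := xi_preimage k mA.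
pose m1 := mrestr P mXA.
have pA0 : 0 <= fine (P (xi k @^-1` A)) by rewrite fine_ge0.
pose m2 := mscale (NngNum pA0) P.
have m1E C : m1 C = P (C `&` xi k @^-1` A) by [].
have m2E C : m2 C = (P (xi k @^-1` A) * P C)%E.
  rewrite -[X in (X * _)%E]fineK; last exact: fin_num_measure.
  by [].
have -> : (P E * g A)%E = m2 E by rewrite m2E xi_law// muleC.
rewrite -[LHS]/(m1 E).
apply: (g_sigma_algebra_measure_unique (past_cylinder k) _ (fun=> setT)) kE.
- exact: past_cylinder_measurable.
- by move=> _; exists (fun=> setT) => //; apply/seteqP; split.
- by rewrite bigcup_const.
- move=> _ _ [A1 mA1 ->] [A2 mA2 ->].
  exists (fun i => A1 i `&` A2 i); first by move=> i; exact: measurableI.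
  apply/seteqP; split => w /= => [[h1 h2] i ik|h].
    by split; [exact: h1|exact: h2].
  by split => i ik; have [] := h i ik.
- move=> _ [A1 mA1 ->].
  rewrite [RHS]m2E [LHS]m1E.
  (* Appending A as the set of index k makes the intersection a cylinder of length k + 1. *)
  pose A' i := if i == k then A else A1 i.
  have mA' i : measurable (A' i) by rewrite /A'; case: ifP.
  rewrite (_ : _ `&` _ = [set w | forall i, (i < k.+1)%N -> A' i (xi i w)]).
    rewrite xi_indep// big_ord_recr/= /A' eqxx muleC; congr (_ * _)%E.
    rewrite xi_indep//; apply: eq_bigr => i _.
    by rewrite ltn_eqF.
  apply/seteqP; split => w /=.
    move=> [h hk] i; rewrite /A' ltnS leq_eqVlt => /orP[/eqP ->|ik].
      by rewrite eqxx.
    by rewrite ltn_eqF//; exact: h.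
  move=> h; split.
    by move=> i ik; have := h i (ltnW ik); rewrite /A' ltn_eqF.
  by have := h k (ltnSn k); rewrite /A' eqxx.
- by move=> _; rewrite [X in (X < _)%E]m1E -ge0_fin_numE// fin_num_measure// setTI.
Qed.

(** As S depends only on the first k increments, (S, xi k) has a product law, and Tonelli takes the
    place of conditional expectation. *)
Lemma freezing d' (U : measurableType d') (S : T -> U) k
    (F : U * measurableTypeR R -> \bar R) :
  (forall A, measurable A -> past k (S @^-1` A)) ->
  measurable_fun setT F -> (forall x, 0 <= F x)%E ->
  (\int[P]_w F (S w, xi k w) = \int[P]_w \int[g]_z F (S w, z))%E.
Proof.
move=> kS mF F0.
have mS : measurable_fun setT S.
  by move=> _ A mA; rewrite setTI; exact: past_measurable (kS A mA).
have mW : measurable_fun setT (fun w => (S w, xi k w)) by exact: measurable_fun_pair.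
pose mS' := isMeasurableFun.Build _ _ _ _ _ mS.
pose Sp : {mfun T >-> U} := HB.pack S mS'.
pose mW' := isMeasurableFun.Build _ _ _ _ _ mW.
pose Wp : {mfun T >-> (U * measurableTypeR R)%type} := HB.pack (fun w => (S w, xi k w)) mW'.
have prodE : forall X, measurable X -> (distribution P Sp \x g)%E X = distribution P Wp X.
  apply: (@product_measure_unique _ _ U (measurableTypeR R) R
    (distribution P Sp) g (distribution P Wp)) => A C mA mC.
  rewrite /distribution /pushforward/= -(@past_indep k)//; last exact: kS.
rewrite -(@ge0_integral_distribution _ _ _ _ _ P Wp)//.
rewrite (@eq_measure_integral _ _ _ _ (distribution P Sp \x g)%E); last first.
  by move=> A mA _; apply/esym; exact: prodE.
rewrite fubini_tonelli1//=.
rewrite ge0_integral_distribution//.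
- exact: measurable_fun_fubini_tonelli_F.
- by move=> y; exact: integral_ge0.
Qed.

End freezing.


Section stopped_chain.
Context {R : realType} (mu eps s x : R).
Implicit Types st : R * R * R.

(* A state holds the elapsed time, the area so far and the position. *)
Definition chain_step st (z : R) : R * R * R :=
  if st.2 <= eps then st
  else (st.1.1 + s ^+ 2, st.1.2 + st.2 * s ^+ 2, st.2 + (z - mu * s ^+ 2)).

Fixpoint chain (z : nat -> R) (k : nat) : R * R * R :=
  if k is k'.+1 then chain_step (chain z k') (z k') else (0, 0, x).

Hypothesis eps0 : 0 <= eps.

(** The area grows by the position before the step, and only when that exceeds eps; so it stays
    nonnegative even if the last position is negative. *)
Lemma chain_ge0 z k : [/\ 0 <= (chain z k).1.1, (chain z k).1.1 <= k%:R * s ^+ 2 &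
  0 <= (chain z k).1.2].
Proof.
elim: k => [|k [t0 tk a0]] /=; first by rewrite mul0r.
rewrite /chain_step; case: (leP (chain z k).2 eps) => [_|y] /=.
  split => //; apply: le_trans tk _.
  by rewrite ler_wpM2r ?sqr_ge0// ler_nat.
split.
- by rewrite addr_ge0 ?sqr_ge0.
- by rewrite -natr1 mulrDl mul1r lerD2r.
- by rewrite addr_ge0// mulr_ge0 ?sqr_ge0// (le_trans eps0)// ltW.
Qed.

Lemma measurable_chain_step :
  measurable_fun [set: (R * R * R) * measurableTypeR R]
    (fun u => chain_step u.1 u.2).
Proof.
have m1 : measurable_fun [set: (R * R * R) * measurableTypeR R]
  (fun u => u.1.1.1) by do 2 apply: measurableT_comp => //.
have m2 : measurable_fun [set: (R * R * R) * measurableTypeR R]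
  (fun u => u.1.1.2) by do 2 apply: measurableT_comp => //.
have m3 : measurable_fun [set: (R * R * R) * measurableTypeR R]
  (fun u => u.1.2) by apply: measurableT_comp.
have m4 : measurable_fun [set: (R * R * R) * measurableTypeR R]
  (fun u => u.2 : measurableTypeR R) by exact: measurable_snd.
apply: measurable_fun_ifT => //=.
  exact: measurable_fun_ler.
apply: measurable_fun_pair; last first.
  by apply: measurable_funD => //; exact: measurable_funB.
apply: measurable_fun_pair.
  exact: measurable_funD.
by apply: measurable_funD => //; exact: measurable_funM.
Qed.

End stopped_chain.

Section mart_function.
Context {R : realType} (mu : R).

(** Clipping all three coordinates makes the function nonnegative on every state, so its integrals
    make sense without integrability. Along the chain only the position is affected. *)
Definition mart_fun (m n : nat) (st : R * R * R) : R :=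
  mart_poly mu m n (pos_part st.1.1) (pos_part st.1.2) (pos_part st.2).

Lemma pos_part_ge0 (y : R) : 0 <= pos_part y.
Proof. by rewrite /pos_part le_max lexx orbT. Qed.

Lemma pos_part_id (y : R) : 0 <= y -> pos_part y = y.
Proof. by move=> y0; rewrite /pos_part max_l. Qed.

Lemma measurable_mart_fun m n :
  measurable_fun [set: R * R * R] (mart_fun m n).
Proof.
have m1 : measurable_fun [set: R * R * R] (fun u => u.1.1).
  by apply: measurableT_comp.
have m2 : measurable_fun [set: R * R * R] (fun u => u.1.2).
  by apply: measurableT_comp.
have m3 : measurable_fun [set: R * R * R] (fun u => u.2) by exact: measurable_snd.
apply: measurable_sum => i; apply: measurable_sum => j.
apply: measurable_funM => //; apply: measurable_funM.
  by apply: measurable_funM; apply: measurable_funX;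
    exact: (measurableT_comp (@measurable_pos_part R)).
have mq : measurable_fun [set: R] (horner (moment_poly mu i j)).
  exact: measurable_poly.
exact: (measurableT_comp mq (measurableT_comp (@measurable_pos_part R) m3)).
Qed.

End mart_function.

(** * Mean of the martingale polynomial along the stopped chain *)

Section chain_expectation.
Context {R : realType} (mu eps T : R).
Hypotheses (mu0 : 0 < mu) (eps0 : 0 < eps) (T0 : 0 <= T).

(* An exact supermartingale for the chain up to time [T], dominating the
   [expR (a + 2 * y)] of the one-step errors. *)
Definition exp_weight (st : R * R * R) : R :=
  expR (st.1.2 + (T + 2 - st.1.1) * st.2).

Lemma measurable_exp_weight : measurable_fun [set: R * R * R] exp_weight.
Proof.
have m1 : measurable_fun [set: R * R * R] (fun u => u.1.1).
  by apply: measurableT_comp.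
have m2 : measurable_fun [set: R * R * R] (fun u => u.1.2).
  by apply: measurableT_comp.
have m3 : measurable_fun [set: R * R * R] (fun u => u.2) by exact: measurable_snd.
apply: measurableT_comp => //; apply: measurable_funD => //.
by apply: measurable_funM => //; exact: measurable_funB.
Qed.

(** The rate in front of y drops by s^2 as the clock advances, which cancels the gain y s^2 of the
    area. What remains is the Gaussian factor, at most [expR ((T + 2) ^+ 2 * s ^+ 2)], and a drift
    factor at most 1. *)
Lemma exp_weight_step s st : 0 < s -> s <= 1 -> 0 <= st.1.1 -> st.1.1 <= T ->
  (\int[normal_prob 0 s]_z (exp_weight (chain_step mu eps s st z))%:E <=
   (expR ((T + 2) ^+ 2 * s ^+ 2) * exp_weight st)%:E)%E.
Proof.
case: st => [[t a] y] s0 s1 /= t0 tT.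
have e1 : 1 <= expR ((T + 2) ^+ 2 * s ^+ 2).
  by rewrite -expR0 ler_expR mulr_ge0 ?sqr_ge0.
rewrite /chain_step/=; case: (leP y eps) => [_|ye].
  rewrite integral_cst//= [normal_prob _ _ _]probability_setT mule1 lee_fin.
  by rewrite ler_peMl// expR_ge0.
have y0 : 0 < y by exact: lt_trans ye.
have s21 : s ^+ 2 <= 1 by rewrite exprn_ile1// ltW.
have s20 : 0 <= s ^+ 2 by exact: sqr_ge0.
pose b := T + 2 - (t + s ^+ 2).
have b0 : 0 <= b by rewrite /b; lra.
have bT : b <= T + 2 by rewrite /b; lra.
pose K := expR (a + (T + 2 - t) * y - b * (mu * s ^+ 2)).
have KE z : exp_weight (t + s ^+ 2, a + y * s ^+ 2, y + (z - mu * s ^+ 2)) =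
    K * expR (b * z).
  by rewrite /exp_weight/= /K -expRD; congr expR; rewrite /b; ring.
under eq_integral do rewrite KE EFinM.
rewrite ge0_integralZl//; last 2 first.
- apply/measurable_EFinP.
  have mb : measurable_fun [set: R] (fun z => expR (b * z)).
    by apply: measurableT_comp => //; exact: measurable_funM.
  exact: mb.
- by rewrite lee_fin expR_ge0.
rewrite normal_mgf ?gt_eqF// -EFinM lee_fin mulrC /exp_weight/=.
apply: ler_pM; rewrite ?expR_ge0// ler_expR.
  have h1 : b ^+ 2 * s ^+ 2 <= (T + 2) ^+ 2 * s ^+ 2.
    by rewrite ler_wpM2r// lerXn2r// nnegrE (le_trans b0).
  have h2 : 0 <= b ^+ 2 * s ^+ 2 by rewrite mulr_ge0 ?sqr_ge0.
  by move: h1 h2; set u := _ * _; set v := _ * _ => h1 h2; lra.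
by rewrite gerDl oppr_le0 !mulr_ge0// ltW.
Qed.

Lemma mart_fun_step m n : exists2 C, 0 <= C & forall s st,
  0 < s -> s <= 1 -> 0 <= st.1.1 -> st.1.1 <= T -> 0 <= st.1.2 ->
  (\int[normal_prob 0 s]_z (mart_fun mu m n (chain_step mu eps s st z))%:E <=
     (mart_fun mu m n st + C * s ^+ 3 * exp_weight st)%:E)%E /\
  ((mart_fun mu m n st)%:E <=
   \int[normal_prob 0 s]_z (mart_fun mu m n (chain_step mu eps s st z))%:E
     + (C * s ^+ 3 * exp_weight st)%:E)%E.
Proof.
have [C C0 hC] := one_step_mart_poly mu0 eps0 T0 m n.
exists C => // s [[t a] y] s0 s1 /= t0 tT a0.
have err0 u : 0 <= C * s ^+ 3 * exp_weight u.
  by rewrite !mulr_ge0 ?expR_ge0 ?exprn_ge0 ?(ltW s0).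
rewrite /chain_step/=; case: (leP y eps) => [_|ye].
  rewrite integral_cst//= [normal_prob _ _ _]probability_setT mule1 -EFinD !lee_fin.
  by rewrite lerDl err0.
have y0 : 0 < y by exact: lt_trans ye.
have [gi] := hC s t a y s0 s1 t0 tT a0 (ltW ye).
have a'0 : 0 <= a + y * s ^+ 2 by rewrite addr_ge0// mulr_ge0 ?sqr_ge0 ?(ltW y0).
have t'0 : 0 <= t + s ^+ 2 by rewrite addr_ge0// sqr_ge0.
rewrite mulr0 subr0 /mart_fun/= (pos_part_id (ltW y0)) (pos_part_id t0) (pos_part_id a0).
rewrite (pos_part_id t'0) (pos_part_id a'0).
set I := Rintegral _ _ _ => hI.
have -> : (\int[normal_prob 0 s]_z (mart_poly mu m n (t + s ^+ 2) (a + y * s ^+ 2)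
    (pos_part (y + (z - mu * s ^+ 2))))%:E = I%:E)%E.
  by rewrite /I /Rintegral fineK//; exact: integrable_fin_num gi.
have {}hI : `|I - mart_poly mu m n t a y| <= C * s ^+ 3 * exp_weight (t, a, y).
  apply: le_trans hI _; rewrite ler_wpM2l ?mulr_ge0 ?exprn_ge0 ?(ltW s0)//.
  (* While t <= T the rate T + 2 - t is at least 2, so the weight dominates [expR (a + 2 * y)]. *)
  by rewrite ler_expR/= lerD2l ler_wpM2r ?(ltW y0)//; lra.
move: hI; rewrite ler_norml => /andP[h1 h2].
by rewrite -EFinD !lee_fin; split; lra.
Qed.

End chain_expectation.

Section chain_estimate.
Context {R : realType} (mu eps T : R).
Hypotheses (mu0 : 0 < mu) (eps0 : 0 < eps) (T0 : 0 <= T).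

(** The constant precedes the probability space, the step s and the increments, hence is uniform as
    s tends to 0. Each of the N steps costs C s^3 times a mean weight at most K, and N s^2 <= T
    makes the total O(s). *)
Lemma chain_estimate m n x : exists2 C, 0 <= C &
  forall d (W : measurableType d) (P : probability W R)
    (s : R) (xi : nat -> W -> measurableTypeR R) (N : nat),
    0 < s -> s <= 1 -> N%:R * s ^+ 2 <= T ->
    (forall i, measurable_fun setT (xi i)) ->
    (forall i A, measurable A -> P (xi i @^-1` A) = normal_prob 0 s A) ->
    (forall n (A : nat -> set R), (forall i, measurable (A i)) ->
      P [set w | forall i, (i < n)%N -> A i (xi i w)] =
      (\prod_(i < n) P (xi i @^-1` A i))%E) ->
  let Z w := chain mu eps s x (fun i => xi i w) N in
  (\int[P]_w (mart_fun mu m n (Z w))%:E <=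
     ((moment_poly mu m n).[pos_part x] + C * s)%:E)%E /\
  (((moment_poly mu m n).[pos_part x])%:E <=
   \int[P]_w (mart_fun mu m n (Z w))%:E + (C * s)%:E)%E.
Proof.
have [C C0 hC] := mart_fun_step mu0 eps0 T0 m n.
pose c := (T + 2) ^+ 2.
pose K := expR (c * T + (T + 2) * x).
exists (T * C * K); first by rewrite !mulr_ge0 ?expR_ge0.
move=> d W P s xi N s0 s1 NT mxi lawxi indxi Z.
have s20 : 0 <= s ^+ 2 by exact: sqr_ge0.
pose X k w := chain mu eps s x (fun i => xi i w) k.
have tX k w : (k <= N)%N -> [/\ 0 <= (X k w).1.1, (X k w).1.1 <= T & 0 <= (X k w).1.2].
  move=> kN; have [t0 tk a0] := chain_ge0 mu s x (ltW eps0) (fun i => xi i w) k.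
  split => //; apply: le_trans tk _; apply: le_trans NT.
  by rewrite ler_wpM2r// ler_nat.
(* The state after k steps is measurable for the past of every later index, as [freezing]
   requires. *)
have mXpast k j : (k <= j)%N ->
    measurable_fun [set: g_sigma_algebraType (past_cylinder xi j)] (X k).
  elim: k => [|k IH] kj; first exact: measurable_cst.
  have mk : measurable_fun [set: g_sigma_algebraType (past_cylinder xi j)] (xi k).
    by move=> _ A mA; rewrite setTI; exact: past_xi.
  exact: (measurableT_comp (measurable_chain_step mu eps s)
    (measurable_fun_pair (IH (ltnW kj)) mk)).
have Xpast k j : (k <= j)%N -> forall A, measurable A -> past xi j (X k @^-1` A).
  by move=> kj A mA; rewrite -[_ @^-1` _]setTI; exact: mXpast.
have mX k : measurable_fun setT (X k).
  move=> _ A mA; rewrite setTI.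
  exact: past_measurable (Xpast k k (leqnn k) A mA).
(* The current state is frozen and the fresh increment integrated out. *)
have stepE k (h : R * R * R -> R) : measurable_fun setT h -> (forall u, 0 <= h u) ->
    (\int[P]_w (h (X k.+1 w))%:E =
     \int[P]_w \int[normal_prob 0 s]_z (h (chain_step mu eps s (X k w) z))%:E)%E.
  move=> mh h0.
  apply: (freezing mxi lawxi indxi (F := fun u => (h (chain_step mu eps s u.1 u.2))%:E)).
  - by move=> A mA; exact: Xpast.
  - apply/measurable_EFinP; apply: (measurableT_comp mh).
    exact: measurable_chain_step.
  - by move=> u; rewrite lee_fin.
have mQ k (h : R * R * R -> R) : measurable_fun setT h -> (forall u, 0 <= h u) ->
    measurable_fun setT (fun w => \int[normal_prob 0 s]_z
      (h (chain_step mu eps s (X k w) z))%:E)%E.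
  move=> mh h0.
  have mH : measurable_fun [set: (R * R * R) * measurableTypeR R]
      (fun u => (h (chain_step mu eps s u.1 u.2))%:E).
    apply/measurable_EFinP; apply: (measurableT_comp mh).
    exact: measurable_chain_step.
  have := @measurable_fun_fubini_tonelli_F _ _ _ _ R (normal_prob 0 s) _ mH.
  move=> /(_ (fun u => h0 _)) mG.
  exact: (measurableT_comp mG (mX k)).
have mF : measurable_fun [set: R * R * R] (mart_fun mu m n).
  exact: measurable_mart_fun.
have mD : measurable_fun [set: R * R * R] (exp_weight T).
  exact: measurable_exp_weight.
have mFX k : measurable_fun setT (fun w => (mart_fun mu m n (X k w))%:E).
  by apply/measurable_EFinP; exact: (measurableT_comp mF (mX k)).
have mDX k : measurable_fun setT (fun w => (exp_weight T (X k w))%:E).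
  by apply/measurable_EFinP; exact: (measurableT_comp mD (mX k)).
have D0 u : 0 <= exp_weight T u by exact: expR_ge0.
(* Discrete Gronwall: every step multiplies the mean weight by at most [expR (c * s ^+ 2)]. *)
have Dle k : (k <= N)%N ->
    (\int[P]_w (exp_weight T (X k w))%:E <= (expR (c * (k%:R * s ^+ 2) + (T + 2) * x))%:E)%E.
  elim: k => [|k IH] kN.
    rewrite /X/= integral_cst//= probability_setT mule1 lee_fin /exp_weight/=.
    by rewrite mul0r mulr0 subr0 !add0r.
  rewrite stepE//.
  apply: (@le_trans _ _ (\int[P]_w ((expR (c * s ^+ 2))%:E * (exp_weight T (X k w))%:E))%E).
    apply: ge0_le_integral => //.
    - by move=> w _; apply: integral_ge0 => z _; rewrite lee_fin.
    - exact: mQ.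
    - by apply: emeasurable_funM.
    - move=> w _; have [t0 tT _] := tX k w (ltnW kN).
      by have := exp_weight_step mu0 eps0 s0 s1 t0 tT; rewrite EFinM.
  rewrite ge0_integralZl//; last by move=> w _; rewrite lee_fin.
  apply: le_trans (lee_wpmul2l _ (IH (ltnW kN))) _; first by rewrite lee_fin expR_ge0.
  rewrite -EFinM lee_fin -expRD ler_expR -natr1.
  by rewrite le_eqVlt; apply/orP; left; apply/eqP; ring.
have DK k : (k <= N)%N -> (\int[P]_w (exp_weight T (X k w))%:E <= K%:E)%E.
  move=> kN; apply: le_trans (Dle k kN) _; rewrite lee_fin ler_expR lerD2r.
  rewrite ler_wpM2l ?sqr_ge0//; apply: le_trans NT.
  by rewrite ler_wpM2r// ler_nat.
have F0 u : 0 <= mart_fun mu m n u.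
  by rewrite mart_poly_ge0 ?pos_part_ge0.
have sC : 0 <= C * s ^+ 3 by rewrite mulr_ge0 ?exprn_ge0 ?(ltW s0).
have splitI k : (\int[P]_w (mart_fun mu m n (X k w) +
      C * s ^+ 3 * exp_weight T (X k w))%:E =
    \int[P]_w (mart_fun mu m n (X k w))%:E +
    (C * s ^+ 3)%:E * \int[P]_w (exp_weight T (X k w))%:E)%E.
  under eq_integral do rewrite EFinD EFinM.
  rewrite ge0_integralD//.
  - by rewrite ge0_integralZl// => w _; rewrite lee_fin.
  - by move=> w _; rewrite lee_fin.
  - by move=> w _; rewrite -EFinM lee_fin mulr_ge0.
  - by apply: emeasurable_funM.
have mFDX k : measurable_fun setT (fun w => (mart_fun mu m n (X k w) +
      C * s ^+ 3 * exp_weight T (X k w))%:E).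
  under eq_fun do rewrite EFinD EFinM.
  by apply: emeasurable_funD => //; apply: emeasurable_funM.
have start : mart_fun mu m n (0, 0, x) = (moment_poly mu m n).[pos_part x].
  by rewrite /mart_fun/= pos_part_id// mart_poly_at0.
pose J k := (\int[P]_w (mart_fun mu m n (X k w))%:E)%E.
pose err k := C * s ^+ 3 * K * k%:R.
have errS k : err k.+1 = err k + C * s ^+ 3 * K.
  by rewrite /err -natr1 mulrDr mulr1.
have up k : (k <= N)%N -> (J k <= ((moment_poly mu m n).[pos_part x] + err k)%:E)%E.
  elim: k => [|k IH] kN.
    by rewrite /J /err mulr0 addr0 /X/= integral_cst//= probability_setT mule1 start.
  rewrite /J stepE//.
  apply: (@le_trans _ _ (J k + (C * s ^+ 3)%:E * \int[P]_w (exp_weight T (X k w))%:E)%E).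
    rewrite -splitI; apply: ge0_le_integral => //.
    - by move=> w _; apply: integral_ge0 => z _; rewrite lee_fin.
    - exact: mQ.
    - move=> w _; have [t0 tT a0] := tX k w (ltnW kN).
      by have [] := hC s (X k w) s0 s1 t0 tT a0.
  rewrite errS addrA EFinD; apply: leeD; first exact: IH (ltnW kN).
  by rewrite [leRHS]EFinM; apply: lee_wpmul2l; [rewrite lee_fin|exact: DK (ltnW kN)].
have low k : (k <= N)%N -> (((moment_poly mu m n).[pos_part x])%:E <= J k + (err k)%:E)%E.
  elim: k => [|k IH] kN.
    by rewrite /J /err mulr0 adde0 /X/= integral_cst//= probability_setT mule1 start.
  apply: le_trans (IH (ltnW kN)) _.
  rewrite errS (_ : J k.+1 + _ = (J k.+1 + (C * s ^+ 3 * K)%:E) + (err k)%:E)%E; last first.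
    by rewrite [err k + _]addrC EFinD addeA.
  apply: leeD2r.
  apply: (@le_trans _ _ (J k.+1 + (C * s ^+ 3)%:E * \int[P]_w (exp_weight T (X k w))%:E)%E).
    rewrite /J stepE// -ge0_integralZl//; last by move=> w _; rewrite lee_fin.
    rewrite -ge0_integralD//; first last.
    - by apply: emeasurable_funM.
    - by move=> w _; rewrite -EFinM lee_fin mulr_ge0.
    - exact: mQ.
    - by move=> w _; apply: integral_ge0 => z _; rewrite lee_fin.
    apply: ge0_le_integral => //.
    - by move=> w _; rewrite lee_fin.
    - apply: emeasurable_funD; first exact: mQ.
      by apply: emeasurable_funM.
    - move=> w _; have [t0 tT a0] := tX k w (ltnW kN).
      by have [_] := hC s (X k w) s0 s1 t0 tT a0; rewrite -EFinM.
  apply: leeD2l.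
  by rewrite [leRHS]EFinM; apply: lee_wpmul2l; [rewrite lee_fin|exact: DK (ltnW kN)].
have errN : err N <= T * C * K * s.
  rewrite /err (_ : _ * _ = C * K * s * (N%:R * s ^+ 2)); last by ring.
  rewrite (_ : T * C * K * s = C * K * s * T); last by ring.
  by rewrite ler_wpM2l ?mulr_ge0 ?expR_ge0 ?(ltW s0).
split.
- by apply: le_trans (up N (leqnn N)) _; rewrite lee_fin lerD2l.
- by apply: le_trans (low N (leqnn N)) _; rewrite leeD2l// lee_fin.
Qed.

End chain_estimate.


(** * Riemann sums and first passage of a continuous path *)

Section riemann_sums.
Context {R : realType}.
Local Notation leb := (@lebesgue_measure R).

Definition grid_index (r : nat) (s : R) : nat := Num.truncn (s * r.+1%:R).

Lemma grid_indexE r s k : 0 <= s ->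
  (grid_index r s == k) = (k%:R / r.+1%:R <= s < k.+1%:R / r.+1%:R).
Proof.
move=> s0; rewrite /grid_index truncn_eq ?mulr_ge0//.
by rewrite ler_pdivrMr// ltr_pdivlMr.
Qed.

Lemma grid_index_le r s : 0 <= s -> (grid_index r s)%:R / r.+1%:R <= s.
Proof.
by move=> s0; have := grid_indexE r (grid_index r s) s0; rewrite eqxx => /esym/andP[].
Qed.

Lemma grid_index_lt r s : 0 <= s -> s < (grid_index r s)%:R / r.+1%:R + r.+1%:R^-1.
Proof.
move=> s0; have := grid_indexE r (grid_index r s) s0; rewrite eqxx => /esym/andP[_].
by rewrite -natr1 mulrDl mul1r.
Qed.

Lemma measurable_grid (u : nat -> R) r :
  measurable_fun (`[(0 : R), +oo[%classic : set R) (fun s => u (grid_index r s)).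
Proof.
move=> _ Y mY.
rewrite (_ : _ `&` _ = \bigcup_(k in [set k | Y (u k)])
    `[k%:R / r.+1%:R, k.+1%:R / r.+1%:R[%classic).
  by apply: bigcup_measurable => k _; exact: measurable_itv.
apply/seteqP; split => s /=.
  rewrite in_itv/= andbT => -[s0 Ys]; exists (grid_index r s) => //=.
  by rewrite in_itv/= -grid_indexE.
move=> [k /= Yk]; rewrite in_itv/= => ks.
have s0 : 0 <= s by move: ks => /andP[+ _]; apply: le_trans; rewrite divr_ge0.
split; first by rewrite in_itv/= s0.
by move: ks; rewrite -grid_indexE// => /eqP ->.
Qed.

(** Presents a Riemann sum as the integral of a step function, so that its limit is a matter of
    dominated convergence. *)
Lemma integral_grid (u : nat -> R) r n :
  (\int[leb]_(s in `[0%R, (n%:R / r.+1%:R)%R[) (u (grid_index r s))%:E =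
   (r.+1%:R^-1 * \sum_(k < n) u k)%:E)%E.
Proof.
elim: n => [|n IH].
  by rewrite mul0r set_itv_ge -?leNgt ?bnd_simp// integral_set0 big_ord0 mulr0.
have n0 : 0 <= n%:R / r.+1%:R :> R by rewrite divr_ge0.
have nn : n%:R / r.+1%:R <= n.+1%:R / r.+1%:R :> R by rewrite ler_pM2r ?invr_gt0// ler_nat.
rewrite (@itv_bndbnd_setU _ _ (BLeft 0) (BLeft (n%:R / r.+1%:R))) ?bnd_simp//.
have sub0 a b : 0 <= a -> [set` Interval (BLeft a) (BLeft b)] `<=` `[(0 : R), +oo[%classic.
  move=> a0 s /=; rewrite !in_itv/= andbT => /andP[+ _]; exact: le_trans.
have mg : measurable_fun (`[(0 : R), +oo[%classic : set R) (fun s => (u (grid_index r s))%:E).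
  by apply/measurable_EFinP; exact: measurable_grid.
rewrite integral_setU//=; last 2 first.
- apply: measurable_funS mg => //.
  by rewrite subUset; split; exact: sub0.
- apply/disj_setPRL => s /=; rewrite !in_itv/= => /andP[ns _] /andP[_].
  by rewrite ltNge ns.
rewrite IH (@eq_integral _ _ _ leb _ (fun=> (u n)%:E)); last first.
  move=> s; rewrite inE/= in_itv/= => sn.
  have s0 : 0 <= s by case/andP : sn => + _; exact: le_trans.
  by move: sn; rewrite -grid_indexE// => /eqP ->.
rewrite integral_cst//= lebesgue_measure_itv/= lte_fin.
have nn' : n%:R / r.+1%:R < n.+1%:R / r.+1%:R :> R.
  by rewrite ltr_pM2r ?invr_gt0// ltr_nat.
rewrite nn' -EFinB -EFinM -EFinD big_ord_recr/= [in RHS]mulrDr; congr EFin; congr (_ + _).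
by rewrite -mulrBl -natrB// subSnn mul1r mulrC.
Qed.

Lemma continuous_segment_bounded (g : R -> R) b : continuous g -> 0 <= b ->
  exists2 M, 0 <= M & forall s, 0 <= s -> s <= b -> `|g s| <= M.
Proof.
move=> cg b0; have [|c _ hc] := @EVT_max R (fun t => `|g t|) 0 b b0.
  apply: continuous_subspaceT => t; apply: continuous_comp; first exact: cg.
  exact: norm_continuous.
by exists `|g c| => // s s0 sb; apply: hc; rewrite in_itv/= s0 sb.
Qed.

Lemma cvg_grid (s : R) : 0 <= s ->
  (grid_index r s)%:R / r.+1%:R @[r --> \oo] --> s.
Proof.
move=> s0; apply/cvgrPdist_lt => e e0; near=> r.
have h1 := grid_index_le r s0; have h2 := grid_index_lt r s0.
rewrite ger0_norm ?subr_ge0// ltrBlDr addrC (lt_le_trans h2)// lerD2l ltW//.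
near: r; exact: near_infty_natSinv_lt (PosNum e0).
Unshelve. all: by end_near. Qed.

(** The selector [c] is prescribed only strictly before and strictly after [tau], and only
    eventually in r, so that different stopping rules can be treated alike. *)
Lemma riemann_sum_cvg (g : R -> R) (c : nat -> nat -> bool) (tau : \bar R) (T : nat) :
  continuous g ->
  (forall s, 0 <= s -> (s%:E < tau)%E -> \forall r \near \oo, c r (grid_index r s)) ->
  (forall s, 0 <= s -> s < T%:R -> (tau < s%:E)%E ->
     \forall r \near \oo, ~~ c r (grid_index r s)) ->
  r.+1%:R^-1 * (\sum_(k < T * r.+1) (c r k)%:R * g (k%:R / r.+1%:R)) @[r --> \oo] -->
  \int[leb]_(s in `[0%R, T%:R[) (if (s%:E < tau)%E then g s else 0).
Proof.
move=> cg alive dead.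
have [M M0 gM] := @continuous_segment_bounded g T%:R cg (ler0n _ _).
pose F (r : nat) (s : R) := (c r (grid_index r s))%:R * g ((grid_index r s)%:R / r.+1%:R).
pose F' (s : R) := if (s%:E < tau)%E then g s else 0.
have sumE r : (\int[leb]_(s in `[0%R, T%:R[) (F r s)%:E =
   (r.+1%:R^-1 * (\sum_(k < T * r.+1) (c r k)%:R * g (k%:R / r.+1%:R)))%:E)%E.
  rewrite -(integral_grid (fun k => (c r k)%:R * g (k%:R / r.+1%:R))).
  by rewrite natrM mulfK// pnatr_eq0.
have [] := @dominated_convergence _ _ R leb `[0%R, T%:R[%classic (measurable_itv _)
  (fun r s => (F r s)%:E) (fun s => (F' s)%:E) (cst M%:E).
- move=> r; apply: measurable_funS (_ : measurable_fun (`[(0 : R), +oo[%classic : set R) _) => //.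
    by move=> s /=; rewrite !in_itv/= andbT => /andP[].
  apply/measurable_EFinP.
  exact: (measurable_grid (fun k => (c r k)%:R * g (k%:R / r.+1%:R)) r).
- apply/measurable_EFinP; apply: measurable_funTS.
  have mg : measurable_fun [set: R] g by exact: continuous_measurable_fun.
  apply: measurable_fun_ifT => //=.
  exact: measurable_fun_lte.
(* Nothing is assumed at s = tau, a null set. For infinite tau, [fine tau] is 0 and one harmless
   point is discarded. *)
- exists [set fine tau]; split; [exact: measurable_set1|exact: lebesgue_measure_set1|].
  move=> s /= nP; apply: contrapT => stau; apply: nP; rewrite in_itv/= => /andP[s0 sT].
  suff cFs : F r s @[r --> \oo] --> F' s by apply: cvg_EFin => //; exact: nearW.
  have [st|ts|st] := ltgtP s%:E tau.
  + have gr : g ((grid_index r s)%:R / r.+1%:R) @[r --> \oo] --> g s.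
      exact: (cvg_comp _ _ (cvg_grid s0) (cg s)).
    rewrite /F' st; apply: cvg_trans gr; apply: near_eq_cvg; near=> r; rewrite /F.
    have -> : c r (grid_index r s) by near: r; exact: alive.
    by rewrite mul1r.
  + rewrite /F' ltNge (ltW ts)/=; apply: cvg_near_cst; near=> r; rewrite /F.
    have /negbTE -> : ~~ c r (grid_index r s) by near: r; exact: dead.
    by rewrite mul0r.
  + by exfalso; apply: stau; rewrite -st.
- apply/integrableP; split=> //.
  rewrite (@integral_cst _ _ _ leb _ _ `|M|%:E)//=.
  rewrite lebesgue_measure_itv/=; case: ifP => _; last by rewrite mule0.
  by rewrite -EFinB -EFinM ltry.
- apply: aeW => s r /=; rewrite in_itv/= => /andP[s0 sT].
  rewrite lee_fin normrM normr_nat; apply: (@le_trans _ _ (1 * M)); last by rewrite mul1r.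
  apply: ler_pM => //; first by case: (c r _); rewrite ?lexx ?ler01.
  apply: gM; first by rewrite divr_ge0.
  by apply: le_trans (ltW sT); exact: grid_index_le.
move=> iF _ cF.
have finF : (\int[leb]_(s in `[0%R, T%:R[) (F' s)%:E)%E \is a fin_num.
  exact: integrable_fin_num iF.
have cS : (r.+1%:R^-1 * (\sum_(k < T * r.+1) (c r k)%:R * g (k%:R / r.+1%:R)))%:E
    @[r --> \oo] --> (fine (\int[leb]_(s in `[0%R, T%:R[) (F' s)%:E)%E)%:E.
  rewrite fineK//; apply: cvg_trans cF; apply: near_eq_cvg; apply: nearW => r.
  by rewrite /= -sumE.
exact: (fine_cvg cS).
Unshelve. all: by end_near. Qed.

End riemann_sums.


(** * Integrals up to the smaller of T and the passage time *)

Section capped_integrals.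
Context {R : realType}.
Local Notation leb := (@lebesgue_measure R).
Variables (g : R -> R) (tau : \bar R).
Hypothesis cg : continuous g.
Hypothesis tau0 : (0 <= tau)%E.

Definition capped (s : R) : R := if (s%:E < tau)%E then g s else 0.

Definition capped_integral (T : nat) : R := \int[leb]_(s in `[0%R, T%:R[) capped s.

Lemma measurable_capped : measurable_fun [set: R] capped.
Proof.
have mg : measurable_fun [set: R] g by exact: continuous_measurable_fun.
apply: measurable_fun_ifT => //=.
exact: measurable_fun_lte.
Qed.

Lemma capped_integrable (T : nat) :
  leb.-integrable `[0%R, T%:R[ (EFin \o capped).
Proof.
have [M M0 gM] := @continuous_segment_bounded R g T%:R cg (ler0n _ _).
apply: measurable_bounded_integrable => //.
- by rewrite /= lebesgue_measure_itv/=; case: ifP => _; rewrite ?ltry// -EFinB ltry.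
- by apply: measurable_funTS; exact: measurable_capped.
- exists M; split; first exact: num_real.
  move=> N MN s /=; rewrite in_itv/= => /andP[s0 sT]; apply: le_trans (ltW MN).
  rewrite /capped; case: ifP => _; last by rewrite normr0.
  by apply: gM => //; exact: ltW.
Qed.

Lemma capped_integralE T :
  ((capped_integral T)%:E = \int[leb]_(s in `[0%R, T%:R[) (capped s)%:E)%E.
Proof. by rewrite fineK//; apply: integrable_fin_num => //; exact: capped_integrable. Qed.

(** The left domain is closed at [tau] while [capped] vanishes there; for finite tau they differ by
    one point. *)
Lemma integral_capped :
  (\int[leb]_(s in [set s : R | (0 <= s)%R /\ s%:E <= tau]) (g s)%:E =
   \int[leb]_(s in `[0%R, +oo[) (capped s)%:E)%E.
Proof.
have mg : measurable_fun [set: R] (EFin \o g).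
  by apply/measurable_EFinP; exact: continuous_measurable_fun.
have mk D : (\int[leb]_(s in D) (capped s)%:E =
    \int[leb]_(s in D `&` [set s | s%:E < tau]) (g s)%:E)%E.
  rewrite integral_mkcondr; apply: eq_integral => s _.
  rewrite /capped patchE; case: ifPn => st.
    by rewrite mem_set.
  by rewrite memNset//=; apply/negP.
rewrite mk; case: tau tau0 => [t| |]//= t0.
- rewrite (_ : [set s | _] = `[0%R, t]%classic); last first.
    by apply/seteqP; split => s /=; rewrite in_itv/= lee_fin => /andP.
  rewrite (_ : _ `&` _ = `[0%R, t[%classic); last first.
    apply/seteqP; split => s /=; rewrite !in_itv/= lte_fin.
      by move=> [/andP[-> _] ->].
    by move=> /andP[-> ->].
  rewrite -integral_itv_bndo_bndc//.
  by apply: measurable_funTS.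
- congr (integral _ _ _); apply/seteqP; split => s /=; rewrite in_itv/= andbT.
    by move=> [-> _]; rewrite ltry.
  by move=> [-> _]; rewrite leey.
Qed.

Hypothesis g0 : forall s, 0 <= s -> (s%:E < tau)%E -> 0 <= g s.

Lemma capped_ge0 s : 0 <= s -> 0 <= capped s.
Proof. by move=> s0; rewrite /capped; case: ifP => // st; exact: g0. Qed.

Lemma capped_integral_le T : ((capped_integral T)%:E <=
  \int[leb]_(s in [set s : R | (0 <= s)%R /\ s%:E <= tau]) (g s)%:E)%E.
Proof.
rewrite integral_capped capped_integralE; apply: ge0_subset_integral => //=.
- by apply: measurable_funTS; apply/measurable_EFinP; exact: measurable_capped.
- by move=> s; rewrite in_itv/= andbT lee_fin; exact: capped_ge0.
- by move=> s /=; rewrite !in_itv/= andbT => /andP[].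
Qed.

Lemma capped_integral_eq T : (tau <= T%:R%:E)%E -> ((capped_integral T)%:E =
  \int[leb]_(s in [set s : R | (0 <= s)%R /\ s%:E <= tau]) (g s)%:E)%E.
Proof.
move=> tauT; rewrite integral_capped capped_integralE.
rewrite integral_mkcond [RHS]integral_mkcond; apply: eq_integral => s _.
rewrite !patchE; case: ifPn => [|sT]; last case: ifPn => //.
  rewrite inE/= in_itv/= => /andP[s0 _].
  by rewrite mem_set//= in_itv/= s0.
rewrite inE/= in_itv/= andbT => s0; rewrite /capped ifF//.
apply/negbTE; rewrite -leNgt; apply: le_trans tauT _; rewrite lee_fin leNgt.
by apply: contra sT => sT; rewrite mem_set//= in_itv/= s0.
Qed.

Lemma capped_integral_cvg : (capped_integral T)%:E @[T --> \oo] -->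
  (\int[leb]_(s in [set s : R | (0 <= s)%R /\ s%:E <= tau]) (g s)%:E)%E.
Proof.
rewrite integral_capped; under eq_fun do rewrite capped_integralE.
rewrite (_ : `[0%R, +oo[%classic = \bigcup_T `[0%R, T%:R[%classic); last first.
  apply/seteqP; split => s /=.
    rewrite in_itv/= andbT => s0; exists (Num.truncn s).+1 => //=.
    by rewrite in_itv/= s0 truncnS_gt.
  by move=> [T _ /=]; rewrite !in_itv/= andbT => /andP[].
apply: (@ge0_nondecreasing_set_cvg_integral _ (measurableTypeR R) R
  (fun T : nat => `[0%R, T%:R[%classic) (EFin \o capped) leb).
- apply/nondecreasing_seqP => T; rewrite subsetEset => s /=; rewrite !in_itv/=.
  by move=> /andP[-> sT]; rewrite (lt_le_trans sT)// ler_nat.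
- by move=> T; exact: measurable_itv.
- by move=> T; apply: measurable_funTS; apply/measurable_EFinP; exact: measurable_capped.
- by move=> T s /=; rewrite in_itv/= lee_fin => /andP[s0 _]; exact: capped_ge0.
Qed.

End capped_integrals.


(** * First passage and the chain sampled along a path *)

Section first_passage.
Context {R : realType}.
Variable f : R -> R.
Hypotheses (cf : continuous f) (f0 : 0 <= f 0).
Local Notation tau := (first_passage_time f).

Lemma first_passage_time_ge0 : (0 <= tau)%E.
Proof. by apply: le_ereal_inf_tmp => _ [t [t0 _] <-]; rewrite lee_fin ltW. Qed.

Lemma first_passage_before s : 0 < s -> (s%:E < tau)%E -> 0 < f s.
Proof.
move=> s0; apply: contraTT; rewrite -!leNgt => fs.
by apply: ereal_inf_lbound; exists s.
Qed.

(** Time 0 is left out of the infimum, so positivity there comes from the assumption on f 0. *)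
Lemma first_passage_before_ge0 s : 0 <= s -> (s%:E < tau)%E -> 0 <= f s.
Proof.
rewrite le_eqVlt => /predU1P[<-//|s0] st.
exact: ltW (first_passage_before s0 st).
Qed.

Lemma first_passage_after s : (tau < s%:E)%E -> exists2 u, 0 < u < s & f u <= 0.
Proof.
move=> /ereal_inf_lt[_ [u [u0 fu] <-]]; rewrite lte_fin => us.
by exists u => //; rewrite u0.
Qed.

End first_passage.

Section chain_path.
Context {R : realType} (mu eps s : R) (f : R -> R) (z : nat -> R).
Hypothesis zE : forall k,
  z k - mu * s ^+ 2 = f (k.+1%:R * s ^+ 2) - f (k%:R * s ^+ 2).

(** Tests the samples 0, ..., k - 1, that is, whether the first k steps are all taken; the state
    reached after k steps is tested by [alive k.+1]. *)
Definition alive (k : nat) : bool := all (fun i => eps < f (i%:R * s ^+ 2)) (iota 0 k).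

Lemma aliveS k : alive k.+1 = alive k && (eps < f (k%:R * s ^+ 2)).
Proof.
rewrite /alive (_ : iota 0 k.+1 = rcons (iota 0 k) k) ?all_rcons 1?andbC//.
by rewrite -cats1 -(iotaD 0 k 1) addn1.
Qed.

Lemma alive_le j k : (j <= k)%N -> alive k -> alive j.
Proof.
move=> /subnK <-; elim: (k - j)%N => // n IH.
by rewrite addSn aliveS => /andP[/IH].
Qed.

Lemma aliveP k : reflect (forall i, (i < k)%N -> eps < f (i%:R * s ^+ 2)) (alive k).
Proof.
apply: (iffP allP) => [h i ik|h i]; first by apply: h; rewrite mem_iota.
by rewrite mem_iota add0n => /h.
Qed.

Let Z k := chain mu eps s (f 0) z k.

Let chain_inv k : if alive k then (Z k).2 = f (k%:R * s ^+ 2) else (Z k).2 <= eps.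
Proof.
elim: k => [|k]; first by rewrite /= mul0r.
rewrite aliveS /Z/= /chain_step; case: (alive k) => /= [yE|yk]; last by rewrite yk.
rewrite yE; case: ltP => [_|fe] /=; first by rewrite zE [LHS]addrC subrK.
by rewrite yE.
Qed.

Lemma chain_gt k : (eps < (Z k).2) = alive k.+1.
Proof.
have := chain_inv k; rewrite aliveS; case: (alive k) => /= [->//|].
by rewrite ltNge => ->.
Qed.

Lemma chain_time k : (Z k).1.1 = s ^+ 2 * \sum_(i < k) (alive i.+1)%:R.
Proof.
elim: k => [|k IH]; first by rewrite big_ord0 mulr0.
rewrite big_ord_recr/= mulrDr -IH -(chain_gt k) ltNge /Z/= /chain_step -/(Z k).
by case: ifP => _ /=; rewrite ?mulr0 ?addr0 ?mulr1.
Qed.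

Lemma chain_area k :
  (Z k).1.2 = s ^+ 2 * \sum_(i < k) (alive i.+1)%:R * f (i%:R * s ^+ 2).
Proof.
elim: k => [|k IH]; first by rewrite big_ord0 mulr0.
rewrite big_ord_recr/= mulrDr -IH -(chain_gt k) ltNge /Z/= /chain_step -/(Z k).
case: ifP => yk /=; first by rewrite mul0r mulr0 addr0.
have := chain_inv k; case: ifP => [_ ->|_]; last by rewrite yk.
by rewrite mul1r mulrC.
Qed.

Lemma chain_survives k : eps < (Z k).2 -> (Z k).1.1 = k%:R * s ^+ 2.
Proof.
rewrite chain_gt chain_time => ak; rewrite mulrC; congr (_ * _).
rewrite (eq_bigr (fun=> 1)) ?sumr_const ?card_ord// => i _.
have -> // : alive i.+1.
exact: alive_le (leqW (ltn_ord i)) ak.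
Qed.

End chain_path.

Section path_limits.
Context {R : realType} (mu eps : R).
Hypothesis eps0 : 0 < eps.

Let s (r : nat) : R := Num.sqrt r.+1%:R^-1.

Let s2 r : s r ^+ 2 = r.+1%:R^-1.
Proof. by rewrite sqr_sqrtr. Qed.

(** Cut off exactly at [tau], unlike the sums computed by the chain, which stop on a different
    event. *)
Definition low_sum (g : R -> R) (tau : \bar R) (T r : nat) : R :=
  r.+1%:R^-1 * (\sum_(k < T * r.+1)
    ((k%:R / r.+1%:R)%:E < tau)%E%:R * g (k%:R / r.+1%:R)).

Lemma low_sum_cvg g tau T : continuous g -> (0 <= tau)%E ->
  low_sum g tau T r @[r --> \oo] --> capped_integral g tau T.
Proof.
move=> cg tau0.
apply: (@riemann_sum_cvg _ g (fun r k => (k%:R / r.+1%:R)%:E < tau)%E) => // u u0.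
  by move=> ut; apply: nearW => r; apply: le_lt_trans ut; rewrite lee_fin grid_index_le.
move=> uT ut; have tfin : tau \is a fin_num.
  by rewrite ge0_fin_numE// (lt_trans ut) ?ltry.
have : fine tau < u by rewrite -lte_fin fineK.
have := cvg_grid u0 => /cvgr_gt /[apply]; apply: filterS => r.
by rewrite -[tau]fineK// lte_fin -leNgt => /ltW.
Qed.

Lemma low_sum_ge0 g tau T r :
  (forall t, 0 <= t -> (t%:E < tau)%E -> 0 <= g t) -> 0 <= low_sum g tau T r.
Proof.
move=> g0; rewrite mulr_ge0// sumr_ge0// => k _.
by case: ltP => [kt|_]; rewrite ?mul0r// mul1r g0 ?divr_ge0.
Qed.

(* [f] is the path under study; the chain watches the path [h], which lies
   [2 * eps] higher, so that the chain outlives [f]. *)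
Lemma chain_lower (f h : R -> R) (z : nat -> R) (T r : nat) :
  0 <= f 0 -> (forall t, 0 <= t -> h t = f t + 2 * eps) ->
  (forall k, z k - mu * s r ^+ 2 = h (k.+1%:R * s r ^+ 2) - h (k%:R * s r ^+ 2)) ->
  let tau := first_passage_time f in
  let Z := chain mu eps (s r) (h 0) z (T * r.+1) in
  low_sum (fun=> 1) tau T r <= Z.1.1 /\ low_sum f tau T r <= Z.1.2.
Proof.
move=> f0 hf zE tau Z.
(* Up to [tau] the path f is nonnegative at the samples, so h is at least 2 eps there. *)
have calive k : ((k%:R / r.+1%:R)%:E < tau)%E -> alive eps (s r) h k.+1.
  move=> ck; apply/aliveP => i; rewrite ltnS => ik.
  rewrite s2 hf ?mulr_ge0//.
  suff : 0 <= f (i%:R / r.+1%:R) by have := eps0; lra.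
  apply: first_passage_before_ge0; rewrite ?divr_ge0//.
  by apply: le_lt_trans ck; rewrite lee_fin ler_pM2r ?invr_gt0// ler_nat.
have aliveh k : alive eps (s r) h k.+1 -> eps < h (k%:R / r.+1%:R).
  by move=> /aliveP/(_ _ (ltnSn k)); rewrite s2.
split.
  rewrite /Z chain_time// s2 ler_wpM2l// ler_sum// => k _; rewrite mulr1.
  by case: ltP => // ck; rewrite calive.
rewrite /Z chain_area// s2 ler_wpM2l// ler_sum// => k _.
case: ltP => [ck|_]; first by rewrite calive// !mul1r hf ?divr_ge0// lerDl mulr_ge0// ltW.
(* Past [tau] the chain may still run, but only at heights above eps, so the additional area is
   nonnegative. *)
rewrite mul0r; case ak : (alive _ _ _ _); rewrite ?mul0r// mul1r.
exact/ltW/(lt_trans eps0)/aliveh.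
Qed.

(** The chain may stop before [tau], at a sample in ]0, eps], so its sums need not converge to the
    capped integrals. They are bounded by sums that do. *)
Lemma chain_upper (f : R -> R) (z : nat -> nat -> R) (T : nat) :
  continuous f -> 0 <= f 0 ->
  (forall r k, z r k - mu * s r ^+ 2 = f (k.+1%:R * s r ^+ 2) - f (k%:R * s r ^+ 2)) ->
  let tau := first_passage_time f in
  let Z r := chain mu eps (s r) (f 0) (z r) (T * r.+1) in
  exists l1 l2 : nat -> R,
  [/\ l1 r @[r --> \oo] --> capped_integral (fun=> 1) tau T,
      l2 r @[r --> \oo] --> capped_integral f tau T,
      forall r, (Z r).1.1 <= l1 r &
      forall r, (Z r).1.2 <= l2 r].
Proof.
move=> cf f0 zE tau Z.
(* Adding all grid points before [tau] makes the selector true there, as [riemann_sum_cvg] demands;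
   the added terms are nonnegative. *)
pose c (r k : nat) := alive eps (s r) f k.+1 || ((k%:R / r.+1%:R)%:E < tau)%E.
pose l (g : R -> R) (r : nat) :=
  r.+1%:R^-1 * (\sum_(k < T * r.+1) (c r k)%:R * g (k%:R / r.+1%:R)).
have cvgl (g : R -> R) : continuous g -> l g r @[r --> \oo] --> capped_integral g tau T.
  move=> cg; apply: riemann_sum_cvg => // u u0 => [ut|uT ut].
    apply: nearW => r; rewrite /c; apply/orP; right.
    by apply: le_lt_trans ut; rewrite lee_fin grid_index_le.
  have tfin : tau \is a fin_num.
    by rewrite ge0_fin_numE ?first_passage_time_ge0// (lt_trans ut) ?ltry.
  have tu : fine tau < u by rewrite -lte_fin fineK.
  have [v /andP[v0 vu] fv] := first_passage_after ut.
  (* By continuity, for a fine grid the sample just before v lies below eps. It does not come after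
     the one of u, so the chain has stopped by then. *)
  have fve : f v < eps by exact: le_lt_trans eps0.
  near=> r; rewrite /c negb_or; apply/andP; split.
    have vi : f ((grid_index r v)%:R / r.+1%:R) < eps.
      near: r; apply: cvgr_lt fve; exact: (cvg_comp _ _ (cvg_grid (ltW v0)) (cf v)).
    apply/negP => /aliveP /(_ (grid_index r v)); rewrite s2 ltnS.
    move=> /(_ _)/lt_trans/(_ vi); rewrite ltxx => h.
    suff /h : (grid_index r v <= grid_index r u)%N by [].
    by rewrite /grid_index le_truncn// ler_wpM2r// ltW.
  rewrite -[tau]fineK// lte_fin -leNgt; apply: ltW.
  by near: r; exact: cvgr_gt (cvg_grid u0) _ tu.
exists (l (fun=> 1)), (l f); split.
- exact/cvgl/cst_continuous.
- exact: cvgl.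
- move=> r; rewrite /Z chain_time// s2 ler_wpM2l// ler_sum// => k _; rewrite mulr1.
  by rewrite /c; case: (alive _ _ _ _).
- move=> r; rewrite /Z chain_area// s2 ler_wpM2l// ler_sum// => k _.
  rewrite /c; case: (alive _ _ _ _) => //=; rewrite mul0r.
  case ck : (_ < _)%E; rewrite ?mul0r// mul1r.
  by apply: first_passage_before_ge0; rewrite ?divr_ge0.
Unshelve. all: by end_near. Qed.

End path_limits.


(** * Paths extended to negative times and measurability of the passage time *)

Section clipped_path.
Context {R : realType}.
Implicit Types f : R -> R.

Lemma first_passage_time_eq f g : (forall t, 0 < t -> f t = g t) ->
  first_passage_time f = first_passage_time g.
Proof.
move=> fg; congr (ereal_inf (EFin @` _)); apply/seteqP.
by split => t /= [t0]; [rewrite fg|rewrite -fg].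
Qed.

Lemma first_passage_area_eq f g : (forall t, 0 <= t -> f t = g t) ->
  first_passage_area f = first_passage_area g.
Proof.
move=> fg; rewrite /first_passage_area (@first_passage_time_eq f g); last first.
  by move=> t /ltW /fg.
by apply: eq_integral => t; rewrite inE/= => -[t0 _]; rewrite fg.
Qed.

Lemma pos_part_continuous : continuous (@pos_part R).
Proof. by move=> t; apply: continuous_max; [exact: cvg_id|exact: cvg_cst]. Qed.

Lemma continuous_clip f : {within `[0, +oo[, continuous f} ->
  continuous (fun t => f (pos_part t)).
Proof.
move=> /subspace_continuousP cf t.
have pt : `[0, +oo[%classic (pos_part t) by rewrite /= in_itv/= andbT pos_part_ge0.
have pc : pos_part u @[u --> t] --> within `[0, +oo[ (nbhs (pos_part t)).
  move=> U /= nU; change (nbhs t (@pos_part R @^-1` U)).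
  have : nbhs t (@pos_part R @^-1` [set y | `[0, +oo[%classic y -> U y]).
    exact: pos_part_continuous nU.
  by apply: filterS => u /=; apply; rewrite in_itv/= andbT pos_part_ge0.
exact: (cvg_comp _ _ pc (cf _ pt)).
Qed.

(** Expresses the event by countably many rational times. The path takes arbitrarily small values on
    some compact interval [1/(i+1), c - 1/(j+1)], where its minimum is attained; the left end stays
    away from 0 because only t > 0 counts. *)
Lemma first_passage_time_lt f c : continuous f ->
  (first_passage_time f < c%:E)%E <->
  exists i j : nat, forall n : nat, exists q : rat,
    [/\ i.+1%:R^-1 <= ratr q :> R, ratr q <= c - j.+1%:R^-1 & f (ratr q) < n.+1%:R^-1].
Proof.
move=> cf; split.
  move=> /first_passage_after[u /andP[u0 uc] fu].
  have [i hi] : exists i : nat, i.+1%:R^-1 < u.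
    by have [i _ /(_ i (leqnn i))] := near_infty_natSinv_lt (PosNum u0); exists i.
  have cu0 : 0 < c - u by rewrite subr_gt0.
  have [j hj] : exists j : nat, j.+1%:R^-1 < c - u.
    by have [j _ /(_ j (leqnn j))] := near_infty_natSinv_lt (PosNum cu0); exists j.
  exists i, j => n.
  have fn : f u < n.+1%:R^-1 by rewrite (le_lt_trans fu)// invr_gt0.
  have : \forall t \near u, f t < n.+1%:R^-1.
    exact: (@cvgr_lt _ _ (nbhs u) _ f (f u) (cf u) _ fn).
  move=> /nbhs_ballP[e /= e0 he].
  pose a := Num.max (u - e) i.+1%:R^-1; pose b := Num.min (u + e) (c - j.+1%:R^-1).
  have ab : a < b.
    rewrite gt_max !lt_min; move: hi hj e0; rewrite /=.
    move: (i.+1%:R^-1) (j.+1%:R^-1) => a1 b1 *.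
    by apply/andP; split; apply/andP; split; lra.
  have [q] := rat_in_itvoo ab; rewrite in_itv/= gt_max lt_min.
  move=> /andP[/andP[q1 q2] /andP[q3 q4]]; exists q; split; [exact: ltW|exact: ltW|].
  by apply: he; rewrite /ball/= distrC ltr_norml; apply/andP; split; lra.
move=> [i [j h]]; have [q0 [q01 q02 _]] := h 0%N.
have [t] := EVT_min (le_trans q01 q02) (continuous_subspaceT cf).
rewrite in_itv/= => /andP[it tj] ht.
have t0 : 0 < t by rewrite (lt_le_trans _ it)// invr_gt0.
have ft : f t <= 0.
  apply/ler_addgt0Pl => e e0; rewrite addr0.
  have [n _ /(_ n (leqnn n)) hn] := near_infty_natSinv_lt (PosNum e0).
  have [q [q1 q2 q3]] := h n.
  by rewrite (le_trans (ht (ratr q) _)) ?in_itv/= ?q1 ?q2// ltW// (lt_trans q3).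
apply: (@le_lt_trans _ _ t%:E).
  by apply: ereal_inf_lbound; exists t.
by rewrite lte_fin (le_lt_trans tj)// ltrBlDr ltrDl invr_gt0.
Qed.

Lemma measurable_first_passage_time d (W : measurableType d) (F : R -> W -> R) :
  (forall w, continuous (F ^~ w)) -> (forall t, measurable_fun setT (F t)) ->
  measurable_fun setT (fun w => first_passage_time (F ^~ w)).
Proof.
move=> cF mF.
apply: (measurability _ (ErealGenInftyO.measurableE R)) => _ /= -[_ [c ->] <-].
rewrite (_ : _ `&` _ = \bigcup_i \bigcup_j \bigcap_n \bigcup_(q : rat)
   [set w | [/\ i.+1%:R^-1 <= ratr q :> R, ratr q <= c - j.+1%:R^-1 & F (ratr q) w < n.+1%:R^-1]]).
  apply: bigcup_measurable => i _; apply: bigcup_measurable => j _.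
  apply: bigcap_measurableType => n _; apply: bigcupT_measurable_rat => q.
  have [h1|h1] := boolP (i.+1%:R^-1 <= ratr q :> R); last first.
    by rewrite (_ : [set w | _] = set0)//; apply/seteqP; split => // w /= [].
  have [h2|h2] := boolP (ratr q <= c - j.+1%:R^-1); last first.
    by rewrite (_ : [set w | _] = set0)//; apply/seteqP; split => // w /= [].
  rewrite (_ : [set w | _] = [set: W] `&` F (ratr q) @^-1` `]-oo, n.+1%:R^-1[%classic).
    by apply: mF => //; exact: measurable_itv.
  apply/seteqP; split => w /=; rewrite in_itv/=; first by move=> [].
  by move=> [].
apply/seteqP; split => w /=; rewrite in_itv/=.
  move=> [_ /(first_passage_time_lt _ (cF w))[i [j h]]].
  exists i => //; exists j => // n _.
  by have [q hq] := h n; exists q.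
move=> [i _ [j _ h]]; split => //; apply/(first_passage_time_lt _ (cF w)).
by exists i, j => n; have [q _ hq] := h n I; exists q.
Qed.

End clipped_path.



Lemma measurable_chain {R : realType} (mu eps s x : R) d (W : measurableType d)
    (xi : nat -> W -> R) k : (forall i, measurable_fun setT (xi i)) ->
  measurable_fun setT (fun w => chain mu eps s x (fun i => xi i w) k).
Proof.
move=> mxi; elim: k => [|k IH]; first exact: measurable_cst.
have mk : measurable_fun setT (xi k : W -> measurableTypeR R) by exact: mxi.
exact: (measurableT_comp (measurable_chain_step mu eps s) (measurable_fun_pair IH mk)).
Qed.

(** * Expectations along Brownian paths *)

Section brownian_path.
Context {R : realType} {d : measure_display} {W : measurableType d}.
Variables (P : probability W R) (B : R -> {RV P >-> R}).
Hypothesis hB : brownian_motion B.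
Variable mu : R.
Hypothesis mu0 : 0 < mu.

Definition clipped_path (x : R) (w : W) (t : R) : R :=
  drifted_path (fun t => B t : W -> R) mu x w (pos_part t).

Lemma clipped_pathE x w t : 0 <= t ->
  clipped_path x w t = drifted_path (fun t => B t : W -> R) mu x w t.
Proof. by move=> t0; rewrite /clipped_path pos_part_id. Qed.

Lemma clipped_path0 x w : clipped_path x w 0 = x.
Proof.
by rewrite clipped_pathE// /drifted_path (bm_start hB) mulr0 subr0 addr0.
Qed.

Lemma clipped_path_shift x y w t : clipped_path (x + y) w t = clipped_path x w t + y.
Proof. by rewrite /clipped_path /drifted_path; ring. Qed.

Lemma clipped_path_continuous x w : continuous (clipped_path x w).
Proof.
have cd : continuous (fun t => x - mu * pos_part t).
  move=> t; apply: cvgB; first exact: cvg_cst.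
  by apply: cvgM; [exact: cvg_cst|exact: pos_part_continuous].
have cB := continuous_clip (@bm_continuous _ _ _ _ _ hB w).
by move=> t; apply: cvgD; [exact: cd|exact: cB].
Qed.

Lemma measurable_clipped_path x t : measurable_fun setT (fun w => clipped_path x w t).
Proof. by apply: measurable_funD => //. Qed.

Lemma joint_powerE m n x w : joint_power B m n mu x w =
  (first_passage_time (clipped_path x w) ^+ m *
   first_passage_area (clipped_path x w) ^+ n)%E.
Proof.
rewrite /joint_power; congr ((_ ^+ _) * (_ ^+ _))%E.
  by apply: first_passage_time_eq => t /ltW t0; rewrite clipped_pathE.
by apply: first_passage_area_eq => t t0; rewrite clipped_pathE.
Qed.

(** The standard deviation of an increment over one grid cell, whose length is its square. *)
Definition mesh (r : nat) : R := Num.sqrt r.+1%:R^-1.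

Lemma sqr_mesh r : mesh r ^+ 2 = r.+1%:R^-1.
Proof. by rewrite sqr_sqrtr. Qed.

Lemma mesh_gt0 r : 0 < mesh r. Proof. by rewrite sqrtr_gt0 invr_gt0. Qed.

Lemma mesh_cvg0 : mesh r @[r --> \oo] --> (0 : R).
Proof.
rewrite -[X in _ --> X]sqrtr0; apply: continuous_cvg; first exact: sqrt_continuous.
exact: cvg_harmonic.
Qed.

Definition increment (r i : nat) (w : W) : R :=
  B (i.+1%:R * mesh r ^+ 2) w - B (i%:R * mesh r ^+ 2) w.

Lemma measurable_increment r i : measurable_fun setT (increment r i).
Proof. exact: measurable_funB. Qed.

Lemma increment_path x w r k : increment r k w - mu * mesh r ^+ 2 =
  clipped_path x w (k.+1%:R * mesh r ^+ 2) - clipped_path x w (k%:R * mesh r ^+ 2).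
Proof.
rewrite !clipped_pathE ?mulr_ge0 ?(ltW (mesh_gt0 r))// /drifted_path /increment.
by rewrite -[k.+1%:R]natr1; ring.
Qed.

Definition brownian_chain (eps x : R) (T r : nat) (w : W) : R * R * R :=
  chain mu eps (mesh r) x (fun i => increment r i w) (T * r.+1).

Lemma measurable_brownian_chain eps x T r : measurable_fun setT (brownian_chain eps x T r).
Proof. by apply: measurable_chain => i; exact: measurable_increment. Qed.

Lemma brownian_chain_ge0 eps x T r w : 0 < eps ->
  [/\ 0 <= (brownian_chain eps x T r w).1.1,
      (brownian_chain eps x T r w).1.1 <= T%:R &
      0 <= (brownian_chain eps x T r w).1.2].
Proof.
move=> eps0; have [a b c] := chain_ge0 mu (mesh r) x (ltW eps0)
  (fun i => increment r i w) (T * r.+1).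
by split => //; rewrite (le_trans b)// sqr_mesh natrM mulfK.
Qed.

Lemma brownian_chain_cvg eps (T : nat) m n x e : 0 < eps -> 0 <= x -> 0 < e ->
  \forall r \near \oo,
  (\int[P]_w (mart_fun mu m n (brownian_chain eps x T r w))%:E <=
     ((moment_poly mu m n).[x] + e)%:E)%E /\
  (((moment_poly mu m n).[x])%:E <=
   \int[P]_w (mart_fun mu m n (brownian_chain eps x T r w))%:E + e%:E)%E.
Proof.
move=> eps0 x0 e0; have [C C0 hC] := chain_estimate mu0 eps0 (ler0n R T) m n x.
have : C * mesh r @[r --> \oo] --> (0 : R).
  rewrite -[X in _ --> X](mulr0 C); apply: cvgM; first exact: cvg_cst.
  exact: mesh_cvg0.
move=> /cvgr_lt /(_ _ e0); apply: filterS => r /ltW re.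
have mesh1 : mesh r <= 1.
  by rewrite -[leRHS]sqrtr1 ler_sqrt// invf_le1 ?ler1n.
have NT : (T * r.+1)%:R * mesh r ^+ 2 <= T%:R :> R.
  by rewrite sqr_mesh natrM mulfK.
have := hC _ W P _ (increment r) _ (mesh_gt0 r) mesh1 NT (measurable_increment r).
rewrite (pos_part_id x0); case.
- move=> i A mA.
  have dt : i.+1%:R * mesh r ^+ 2 - i%:R * mesh r ^+ 2 = mesh r ^+ 2.
    by rewrite -[i.+1%:R]natr1; ring.
  have i0 : 0 <= i%:R * mesh r ^+ 2 by rewrite mulr_ge0 ?sqr_ge0.
  have i1 : i%:R * mesh r ^+ 2 < i.+1%:R * mesh r ^+ 2.
    by rewrite -subr_gt0 dt exprn_gt0 ?mesh_gt0.
  have := bm_gaussian hB i0 i1 mA.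
  by rewrite dt sqrtr_sqr ger0_norm ?(ltW (mesh_gt0 r)).
- move=> k A mA.
  apply: (bm_independent hB (t := fun i => i%:R * mesh r ^+ 2)) => //.
    by rewrite mul0r.
  by move=> i _; rewrite ler_wpM2r ?sqr_ge0// ler_nat.
- move=> h1 h2; split.
    by apply: le_trans h1 _; rewrite lee_fin lerD2l.
  by apply: le_trans h2 _; rewrite leeD2l// lee_fin.
Qed.

End brownian_path.



(** * Upper bounds for the expectations *)

Section fatou_bounds.
Context {R : realType} {d : measure_display} {W : measurableType d}.
Implicit Types (mu : {measure set W -> \bar R}).

Lemma limn_einf_le (u : nat -> \bar R) c :
  (\forall n \near \oo, (u n <= c)%E) -> (limn_einf u <= c)%E.
Proof.
move=> [N _ uc]; rewrite limn_einf_lim; apply: lime_le.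
  exact: is_cvg_einfs.
apply: nearW => n; apply: (@le_trans _ _ (u (maxn n N))).
  by apply: ereal_inf_lbound; exists (maxn n N) => //=; exact: leq_maxl.
by apply: uc; exact: leq_maxr.
Qed.

Lemma fatou_le mu (f : nat -> W -> \bar R) (g : W -> \bar R) c :
  (forall n, measurable_fun setT (f n)) -> (forall n w, (0 <= f n w)%E) ->
  measurable_fun setT g -> {ae mu, forall w, f n w @[n --> \oo] --> g w} ->
  (\forall n \near \oo, (\int[mu]_w f n w <= c)%E) -> (\int[mu]_w g w <= c)%E.
Proof.
move=> mf f0 mg fg fc.
rewrite (@ae_eq_integral _ _ _ mu setT (fun w => limn_einf (f ^~ w))) //.
- apply: le_trans (fatou mu measurableT mf (fun n w _ => f0 n w)) _.
  exact: limn_einf_le.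
- apply: (emeasurable_fun_cvg (fun n w => einfs (f ^~ w) n)) => [n|w _].
    exact: measurable_fun_einfs.
  by rewrite limn_einf_lim; exact: is_cvg_einfs.
- by apply: filterS fg => w fw _; rewrite (cvg_limn_einf_sup fw).1.
Qed.

Lemma measurable_expe (f : W -> \bar R) n : measurable_fun setT f ->
  measurable_fun setT (fun w => f w ^+ n)%E.
Proof.
move=> mf; elim: n => [|n IH]; first by under eq_fun do rewrite expe0; exact: measurable_cst.
by under eq_fun do rewrite expeS; exact: emeasurable_funM.
Qed.

End fatou_bounds.

Lemma lee_expe {R : realType} (x y : \bar R) n :
  (0 <= x -> x <= y -> x ^+ n <= y ^+ n)%E.
Proof.
move=> x0 xy; elim: n => [|n IH]; first by rewrite !expe0.
by rewrite !expeS lee_pmul// expe_ge0.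
Qed.

Lemma capped_time {R : realType} (tau : \bar R) T : (0 <= tau)%E ->
  ((capped_integral (fun=> 1) tau T)%:E = Order.min tau T%:R%:E)%E.
Proof.
move=> tau0; rewrite capped_integralE; last exact: cst_continuous.
have h (b : R) : 0 <= b -> b <= T%:R ->
    (forall s, 0 <= s -> s < T%:R -> (s%:E < tau)%E = (s < b)) ->
    (\int[lebesgue_measure]_(s in `[0%R, T%:R[) (capped (fun=> 1) tau s)%:E = b%:E)%E.
  move=> b0 bT hb.
  transitivity (\int[@lebesgue_measure R]_(s in `[0%R, T%:R[) (\1_(`[0%R, b[) s)%:E)%E.
    apply: eq_integral => s; rewrite inE/= in_itv/= => /andP[s0 sT].
    rewrite /capped hb// indicE; case: ifPn => sb.
      by rewrite mem_set//= in_itv/= s0.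
    by rewrite memNset//= in_itv/= s0 (negbTE sb).
  rewrite integral_indic// setIidl; last first.
    move=> s /=; rewrite !in_itv/= => /andP[-> /lt_le_trans]; exact.
  rewrite /= lebesgue_measure_itv/= lte_fin; case: ltP => [_|b0'].
    by rewrite oppr0 adde0.
  by congr EFin; apply/eqP; rewrite eq_le b0 b0'.
case: tau tau0 h => [t| |]//= t0 h.
- rewrite lee_fin in t0; rewrite -EFin_min; apply: h.
  + by rewrite le_min t0/=.
  + by rewrite ge_min lexx orbT.
  + by move=> s _ sT; rewrite lte_fin lt_min sT andbT.
- rewrite min_r ?leey//; apply: h => //.
  by move=> s _ sT; rewrite ltry sT.
Qed.

Section upper_bound.
Context {R : realType} {d : measure_display} {W : measurableType d}.
Variables (P : probability W R) (B : R -> {RV P >-> R}).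
Hypothesis hB : brownian_motion B.
Variable mu : R.
Hypothesis mu0 : 0 < mu.
Local Notation X := (clipped_path B mu).
Local Notation tau x w := (first_passage_time (X x w)).

Lemma measurable_passage_time x : measurable_fun setT (fun w => tau x w).
Proof.
apply: (measurable_first_passage_time (F := fun t w => X x w t)) => [w|t].
  exact: clipped_path_continuous.
exact: measurable_clipped_path.
Qed.

Lemma measurable_low_sum x T r (g : W -> R -> R) :
  (forall t, measurable_fun setT (fun w => g w t)) ->
  measurable_fun setT (fun w => low_sum (g w) (tau x w) T r).
Proof.
move=> mg; apply: measurable_funM => //; apply: measurable_sum => k.
apply: measurable_funM; last exact: mg.
rewrite (_ : (fun w => _) = (fun w => if ((k%:R / r.+1%:R)%:E < tau x w)%E then 1 else 0)).
  apply: measurable_fun_ifT => //.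
  exact: measurable_fun_lte (measurable_passage_time x).
by apply/funext => w; case: ifP.
Qed.

Lemma measurable_capped_integral x T (g : W -> R -> R) :
  (forall w, continuous (g w)) -> (forall t, measurable_fun setT (fun w => g w t)) ->
  measurable_fun setT (fun w => capped_integral (g w) (tau x w) T).
Proof.
move=> cg mg.
apply: (@measurable_fun_cvg _ _ _ _ (fun r w => low_sum (g w) (tau x w) T r)).
  by move=> r; exact: measurable_low_sum.
move=> w _; apply: low_sum_cvg => //; exact: first_passage_time_ge0.
Qed.

Lemma clipped_path_before_ge0 x w s : 0 <= x ->
  0 <= s -> (s%:E < tau x w)%E -> 0 <= X x w s.
Proof.
by move=> x0; apply: first_passage_before_ge0; rewrite (clipped_path0 hB).
Qed.

Lemma measurable_passage_area x : 0 <= x ->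
  measurable_fun setT (fun w => first_passage_area (X x w)).
Proof.
move=> x0; apply: (@emeasurable_fun_cvg _ _ _ _
  (fun T w => (capped_integral (X x w) (tau x w) T)%:E)) => [T|w _].
  apply/measurable_EFinP; apply: measurable_capped_integral => [w|t].
    exact: clipped_path_continuous.
  exact: measurable_clipped_path.
apply: capped_integral_cvg.
- exact: clipped_path_continuous.
- exact: first_passage_time_ge0.
- by move=> s; exact: clipped_path_before_ge0.
Qed.

Lemma measurable_joint_power m n x : 0 <= x ->
  measurable_fun setT (joint_power B m n mu x).
Proof.
move=> x0; rewrite (funext (joint_powerE B mu m n x)).
apply: emeasurable_funM; apply: measurable_expe.
  exact: measurable_passage_time.
exact: measurable_passage_area.
Qed.

Lemma first_passage_area_ge0 x w : 0 <= x -> (0 <= first_passage_area (X x w))%E.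
Proof.
move=> x0.
rewrite /first_passage_area integral_capped; last 2 first.
- exact: clipped_path_continuous.
- exact: first_passage_time_ge0.
apply: integral_ge0 => s /=; rewrite in_itv/= andbT => s0.
by rewrite lee_fin capped_ge0// => u; exact: clipped_path_before_ge0.
Qed.

Lemma joint_power_ge0 m n x w : 0 <= x -> (0 <= joint_power B m n mu x w)%E.
Proof.
move=> x0; rewrite joint_powerE mule_ge0// expe_ge0//.
  exact: first_passage_time_ge0.
exact: first_passage_area_ge0.
Qed.

Definition capped_power (T m n : nat) (x : R) (w : W) : R :=
  capped_integral (fun=> 1) (tau x w) T ^+ m *
  capped_integral (X x w) (tau x w) T ^+ n.

Lemma measurable_capped_power T m n x : measurable_fun setT (capped_power T m n x).
Proof.
apply: measurable_funM; apply: measurable_funX; apply: measurable_capped_integral => // w.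
- exact: cst_continuous.
- exact: clipped_path_continuous.
- exact: measurable_clipped_path.
Qed.

Lemma capped_time_ge0 T x w : 0 <= capped_integral (fun=> 1) (tau x w) T.
Proof.
rewrite -lee_fin capped_time ?first_passage_time_ge0// le_min.
by rewrite first_passage_time_ge0/= lee_fin.
Qed.

Lemma capped_area_ge0 T x w : 0 <= x -> 0 <= capped_integral (X x w) (tau x w) T.
Proof.
move=> x0; rewrite -lee_fin capped_integralE; last exact: clipped_path_continuous.
apply: integral_ge0 => s /=; rewrite in_itv/= => /andP[s0 _].
by rewrite lee_fin capped_ge0// => u; exact: clipped_path_before_ge0.
Qed.

Lemma capped_power_ge0 T m n x w : 0 <= x -> 0 <= capped_power T m n x w.
Proof.
by move=> x0; rewrite mulr_ge0// exprn_ge0 ?capped_time_ge0 ?capped_area_ge0.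
Qed.

Lemma capped_power_le T m n x w : 0 <= x ->
  ((capped_power T m n x w)%:E <= joint_power B m n mu x w)%E.
Proof.
move=> x0; rewrite joint_powerE EFinM !EFin_expe; apply: lee_pmul.
- by rewrite expe_ge0// lee_fin capped_time_ge0.
- by rewrite expe_ge0// lee_fin capped_area_ge0.
- apply: lee_expe; first by rewrite lee_fin capped_time_ge0.
  by rewrite capped_time ?first_passage_time_ge0// ge_min lexx.
- apply: lee_expe; first by rewrite lee_fin capped_area_ge0.
  apply: capped_integral_le.
  + exact: clipped_path_continuous.
  + exact: first_passage_time_ge0.
  + by move=> s; exact: clipped_path_before_ge0.
Qed.

Lemma capped_power_eq T m n x w : 0 <= x -> (tau x w <= T%:R%:E)%E ->
  ((capped_power T m n x w)%:E = joint_power B m n mu x w)%E.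
Proof.
move=> x0 tT; rewrite joint_powerE EFinM !EFin_expe; congr (_ ^+ _ * _ ^+ _)%E.
  by rewrite capped_time ?first_passage_time_ge0// min_l.
apply: capped_integral_eq => //.
- exact: clipped_path_continuous.
- exact: first_passage_time_ge0.
Qed.

End upper_bound.



Lemma cvg_exprn {R : realType} (u : nat -> R) (l : R) n :
  u k @[k --> \oo] --> l -> u k ^+ n @[k --> \oo] --> l ^+ n.
Proof. by move=> ul; exact: (cvg_comp _ _ ul (@exprn_continuous R n l)). Qed.

Section upper_expectation.
Context {R : realType} {d : measure_display} {W : measurableType d}.
Variables (P : probability W R) (B : R -> {RV P >-> R}).
Hypothesis hB : brownian_motion B.
Variable mu : R.
Hypothesis mu0 : 0 < mu.
Local Notation X := (clipped_path B mu).
Local Notation tau x w := (first_passage_time (X x w)).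
Local Notation p := (moment_poly mu).

(** Fatou is applied to the low sums, which have the right limit, and not to the chain, which starts
    too high. The low sums lie below the time and area of the chain, where [mart_poly_ge]
    applies. *)
Lemma capped_power_mean_shift_le T m n y eps e : 0 <= y -> 0 < eps -> 0 < e ->
  (\int[P]_w (capped_power B mu T m n y w)%:E <= ((p m n).[y + 2 * eps] + e)%:E)%E.
Proof.
move=> y0 eps0 e0.
have y2 : 0 <= y + 2 * eps by lra.
pose Z r w := brownian_chain B mu eps (y + 2 * eps) T r w.
pose l1 r w := low_sum (fun=> 1) (tau y w) T r.
pose l2 r w := low_sum (X y w) (tau y w) T r.
have cX w : continuous (X y w) by exact: clipped_path_continuous.
have ml1 r : measurable_fun setT (l1 r) by exact: measurable_low_sum.
have ml2 r : measurable_fun setT (l2 r).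
  apply: (@measurable_low_sum _ _ _ _ _ hB mu y T r (X y)) => t.
  exact: measurable_clipped_path.
have l10 r w : 0 <= l1 r w by exact: low_sum_ge0.
have l20 r w : 0 <= l2 r w.
  by apply: low_sum_ge0 => t; exact: clipped_path_before_ge0.
have lZ r w : l1 r w <= (Z r w).1.1 /\ l2 r w <= (Z r w).1.2.
  have := @chain_lower _ mu eps eps0 (X y w) (X (y + 2 * eps) w)
    (fun i => increment B r i w) T r.
  rewrite /Z /brownian_chain !(clipped_path0 hB); apply => // [t _|k].
    exact: clipped_path_shift.
  exact: increment_path.
apply: (@fatou_le _ _ _ P (fun r w => (l1 r w ^+ m * l2 r w ^+ n)%:E)).
- move=> r; apply/measurable_EFinP; apply: measurable_funM; exact: measurable_funX.
- by move=> r w; rewrite lee_fin mulr_ge0// exprn_ge0.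
- by apply/measurable_EFinP; exact: measurable_capped_power.
- apply: nearW => w; apply: cvg_EFin; first exact: nearW.
  apply: cvgM; apply: cvg_exprn; apply: low_sum_cvg => //.
  + exact: cst_continuous.
  + exact: first_passage_time_ge0.
  + exact: first_passage_time_ge0.
- have := brownian_chain_cvg hB mu0 T m n eps0 y2 e0.
  apply: filterS => r [/(le_trans _)h _]; apply: h.
  apply: ge0_le_integral => //.
  + by move=> w _; rewrite lee_fin mulr_ge0// exprn_ge0.
  + apply/measurable_EFinP; apply: measurable_funM; exact: measurable_funX.
  + apply/measurable_EFinP; apply: (measurableT_comp (measurable_mart_fun mu m n)).
    exact: measurable_brownian_chain.
  + move=> w _; rewrite lee_fin; have [h1 h2] := lZ r w.
    have [t0 _ a0] := brownian_chain_ge0 B mu (y + 2 * eps) T r w eps0.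
    rewrite /mart_fun (pos_part_id t0) (pos_part_id a0).
    apply: le_trans (mart_poly_ge mu0 m n t0 a0 (pos_part_ge0 _)).
    by apply: ler_pM; rewrite ?exprn_ge0// lerXn2r// nnegrE.
Qed.

Lemma horner_shift_near (q : {poly R}) (y e : R) : 0 < e ->
  exists2 eps, 0 < eps & q.[y + 2 * eps] <= q.[y] + e.
Proof.
move=> e0; have : q.[y + 2 * eps] @[eps --> 0^'+] --> q.[y].
  rewrite -[in X in _ --> X](addr0 y) -[in X in _ --> X](mulr0 2).
  apply: continuous_cvg; first exact: continuous_horner.
  apply: cvgD; first exact: cvg_cst.
  by apply: cvgM; [exact: cvg_cst|exact: cvg_within].
move=> /cvgr_lt /(_ (q.[y] + e)); rewrite ltrDl => /(_ e0) h.
have [eps [/ltW h1 h2]] : exists eps : R, q.[y + 2 * eps] < q.[y] + e /\ 0 < eps.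
  apply: (@filter_ex _ (0 : R)^'+); near=> eps; split; near: eps => //.
  exact: nbhs_right_gt.
by exists eps.
Unshelve. all: by end_near. Qed.

Lemma capped_power_mean_le T m n y : 0 <= y ->
  (\int[P]_w (capped_power B mu T m n y w)%:E <= ((p m n).[y])%:E)%E.
Proof.
move=> y0; apply/lee_addgt0Pr => e e0; have e20 : 0 < e / 2 by rewrite divr_gt0.
have [eps eps0 he] := horner_shift_near (p m n) y e20.
apply: le_trans (capped_power_mean_shift_le T m n y0 eps0 e20) _.
by rewrite -EFinD lee_fin; lra.
Qed.

(** The bound for (1, 0) does not depend on T, so tau has finite mean. Finiteness is what lets the
    capped powers reach [joint_power] at a finite T. *)
Lemma passage_time_ae_fin y : 0 <= y -> {ae P, forall w, (tau y w < +oo)%E}.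
Proof.
move=> y0.
have mt : measurable_fun setT (fun w => tau y w) by exact: measurable_passage_time.
have t0 w : (0 <= tau y w)%E by exact: first_passage_time_ge0.
have I : (\int[P]_w tau y w <= ((p 1 0).[y])%:E)%E.
  apply: (@fatou_le _ _ _ P (fun T w => (capped_power B mu T 1 0 y w)%:E)) => //.
  - by move=> T; apply/measurable_EFinP; exact: measurable_capped_power.
  - by move=> T w; rewrite lee_fin capped_power_ge0.
  - apply: nearW => w; rewrite /capped_power.
    under eq_fun do rewrite expr1 expr0 mulr1 (capped_time _ (t0 w)).
    case: (tau y w) (t0 w) => [t| |]//= tpos.
      apply: cvg_near_cst; near=> T; apply/min_idPl; rewrite lee_fin.
      by near: T; exact: nbhs_infty_ger.
    under eq_fun do rewrite min_r ?leey//.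
    by apply/cvgeryP; exact: cvgr_idn.
  - by apply: nearW => T; exact: capped_power_mean_le.
have : P.-integrable setT (fun w => tau y w).
  apply/integrableP; split => //.
  rewrite (eq_integral (fun w => tau y w)); last by move=> w _; rewrite gee0_abs.
  by apply: le_lt_trans I _; rewrite ltry.
move=> /(integrable_ae measurableT); apply: filterS => w /(_ Logic.I).
by rewrite ge0_fin_numE.
Unshelve. all: by end_near. Qed.

Lemma joint_power_cvg m n y : 0 <= y -> {ae P, forall w,
  (capped_power B mu T m n y w)%:E @[T --> \oo] --> joint_power B m n mu y w}.
Proof.
move=> y0; apply: filterS (passage_time_ae_fin y0) => w tw.
have tf : tau y w \is a fin_num by rewrite ge0_fin_numE// first_passage_time_ge0.
apply: cvg_near_cst; near=> T; apply: capped_power_eq => //.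
rewrite -(fineK tf) lee_fin.
by near: T; exact: nbhs_infty_ger.
Unshelve. all: by end_near. Qed.

Lemma joint_power_mean_le m n y : 0 <= y ->
  (\int[P]_w joint_power B m n mu y w <= ((p m n).[y])%:E)%E.
Proof.
move=> y0.
apply: (@fatou_le _ _ _ P (fun T w => (capped_power B mu T m n y w)%:E)) => //.
- by move=> T; apply/measurable_EFinP; exact: measurable_capped_power.
- by move=> T w; rewrite lee_fin capped_power_ge0.
- exact: measurable_joint_power.
- exact: joint_power_cvg.
- by apply: nearW => T; exact: capped_power_mean_le.
Qed.

Lemma joint_power_integrable m n y : 0 <= y ->
  P.-integrable setT (joint_power B m n mu y).
Proof.
move=> y0; apply/integrableP; split; first exact: measurable_joint_power.
rewrite (eq_integral (joint_power B m n mu y)); last first.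
  by move=> w _; rewrite gee0_abs// joint_power_ge0.
by apply: le_lt_trans (joint_power_mean_le m n y0) _; rewrite ltry.
Qed.

End upper_expectation.



(** * Lower bounds for the expectations *)

Section mart_fun_bound.
Context {R : realType} (mu : R).
Hypothesis mu0 : 0 < mu.
Local Notation p := (moment_poly mu).
Local Notation F := (mart_poly mu).
Implicit Types t a y eps : R.

(** There is no constant term, and eps^k <= eps for k >= 1. *)
Lemma moment_poly_small i j eps : (0 < i + j)%N -> 0 <= eps -> eps <= 1 ->
  (p i j).[eps] <= eps * (p i j).[1].
Proof.
move=> ij e0 e1; rewrite !horner_coef mulr_sumr ler_sum// => k _.
have pk : 0 <= (p i j)`_k by exact: moment_poly_ge0 (ltW mu0) k.
rewrite expr1n mulr1 mulrC; case: (nat_of_ord k) pk => [|l] pk; last first.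
  by rewrite ler_wpM2r// exprS ler_piMr// exprn_ile1.
have /eqP := moment_poly_at0 mu ij; rewrite horner_coef0 => /eqP ->.
by rewrite !mulr0.
Qed.

Lemma expr_le1D t k m : 0 <= t -> (k <= m)%N -> t ^+ k <= 1 + t ^+ m.
Proof.
move=> t0 km; case: (leP t 1) => [t1|/ltW t1].
  by apply: (@le_trans _ _ 1); [exact: exprn_ile1|rewrite lerDl exprn_ge0].
by apply: ler_wpDl => //; rewrite ler_weXn2l.
Qed.

(** The term i = j = 0 is t^m a^n exactly. Every other term gains a factor eps, and [F m n 1 1 1]
    bounds the sum of their coefficients. *)
Lemma mart_poly_small m n t a eps : 0 <= t -> 0 <= a -> 0 <= eps -> eps <= 1 ->
  F m n t a eps <=
  t ^+ m * a ^+ n + eps * (F m n 1 1 1 * ((1 + t ^+ m) * (1 + a ^+ n))).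
Proof.
move=> t0 a0 e0 e1.
have -> : F m n t a eps = t ^+ m * a ^+ n + (F m n t a eps - t ^+ m * a ^+ n) by ring.
rewrite lerD2l.
have tm : 0 <= t ^+ m by rewrite exprn_ge0.
have an : 0 <= a ^+ n by rewrite exprn_ge0.
have -> : t ^+ m * a ^+ n = \sum_(i < m.+1) \sum_(j < n.+1)
    (if (i + j == 0)%N then t ^+ m * a ^+ n else 0).
  rewrite big_ord_recl/= big_ord_recl/= big1 ?addr0; last first.
    by move=> j _.
  by rewrite big1 ?addr0// => i _; rewrite big1.
rewrite /mart_poly -sumrB mulr_suml mulr_sumr ler_sum// => i _.
rewrite -sumrB mulr_suml mulr_sumr ler_sum// => j _.
have p1 : 0 <= (p i j).[1] by rewrite moment_poly_horner_ge0 ?(ltW mu0).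
rewrite !expr1n !mulr1 !mul1r.
case: (posnP (i + j)%N) => [/eqP|ij]; last rewrite subr0.
  rewrite addn_eq0 => /andP[/eqP -> /eqP ->] /=.
  rewrite !bin0 !subn0 !mul1r moment_poly00 !hornerC !mulr1 subrr.
  by rewrite !mulr_ge0// addr_ge0.
rewrite [leRHS](_ : _ = 'C(m, i)%:R * 'C(n, j)%:R *
  ((1 + t ^+ m) * (1 + a ^+ n) * (eps * (p i j).[1]))); last by ring.
rewrite ler_wpM2l ?mulr_ge0//; apply: ler_pM.
- by rewrite mulr_ge0// exprn_ge0.
- by rewrite moment_poly_horner_ge0 ?(ltW mu0).
- by apply: ler_pM; rewrite ?exprn_ge0// expr_le1D// leq_subr.
- exact: moment_poly_small.
Qed.

(* Either the chain survives, and its clock shows [T], or it stopped below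
   [eps], where the martingale polynomial is close to its leading term. *)
Lemma mart_fun_le m n t a y eps T (f : nat -> nat -> R) :
  (forall i j, f i j = mart_fun mu i j (t, a, y)) -> 0 < eps -> eps <= 1 -> 1 <= T ->
  0 <= t -> 0 <= a -> (eps < y -> t = T) ->
  f m n <= Num.min (t ^+ m * a ^+ n) T
    + (T^-1 * (f (2 * m)%N (2 * n)%N + f m.+1 n)
       + eps * (F m n 1 1 1 * (f 0 0 + f m 0 + (f 0 n + f m n)))).
Proof.
move=> fdef eps0 eps1 T1 t0 a0 yt.
have T0 : 0 < T by lra.
have fE i j : f i j = F i j t a (pos_part y).
  by rewrite fdef /mart_fun/= (pos_part_id t0) (pos_part_id a0).
have yp := pos_part_ge0 y.
have fge i j : t ^+ i * a ^+ j <= f i j by rewrite fE mart_poly_ge.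
have f0 i j : 0 <= f i j by rewrite fE mart_poly_ge0.
have K0 : 0 <= F m n 1 1 1 by rewrite mart_poly_ge0.
have z0 : 0 <= t ^+ m * a ^+ n by rewrite mulr_ge0 ?exprn_ge0.
have min0 : 0 <= Num.min (t ^+ m * a ^+ n) T by rewrite le_min z0 ltW.
have Ti : 0 < T^-1 by rewrite invr_gt0.
case: (ltP eps y) => [/yt tT|ye].
  have : f m n <= T^-1 * f m.+1 n.
    rewrite ler_pdivlMl// -[X in X * _]tT !fE; exact: mart_polyS_ge.
  have : 0 <= T^-1 * f (2 * m)%N (2 * n)%N by rewrite mulr_ge0// ltW.
  have : 0 <= eps * (F m n 1 1 1 * (f 0 0 + f m 0 + (f 0 n + f m n))).
    by rewrite mulr_ge0 ?(ltW eps0)// mulr_ge0// !addr_ge0.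
  rewrite [T^-1 * (_ + _)]mulrDr => h1 h2 h3; apply: (le_trans h3).
  by apply: ler_wpDl => //; apply: ler_wpDr => //; rewrite lerDr.
have h1 : f m n <= t ^+ m * a ^+ n +
    eps * (F m n 1 1 1 * (f 0 0 + f m 0 + (f 0 n + f m n))).
  rewrite {1}fE; apply: le_trans (mart_poly_le mu0 m n t0 a0 yp (y := eps) _) _.
    by rewrite /pos_part ge_max ye (ltW eps0).
  apply: le_trans (mart_poly_small m n t0 a0 (ltW eps0) eps1) _.
  rewrite lerD2l ler_wpM2l ?(ltW eps0)// ler_wpM2l//.
  (* The product (1 + t^m)(1 + a^n) expands into four monomials, each dominated by a value of f. *)
  rewrite mulrDl mul1r mulrDr mulr1 addrACA -addrA.
  have := fge 0 0; have := fge m 0; have := fge 0 n; have := fge m n.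
  rewrite !expr0 !mul1r mulr1 => *; lra.
(* If z = t^m a^n exceeds T then z <= z^2 / T, and z^2 is the monomial of index (2m, 2n). *)
have h2 : t ^+ m * a ^+ n <= Num.min (t ^+ m * a ^+ n) T + T^-1 * f (2 * m)%N (2 * n)%N.
  have := fge (2 * m)%N (2 * n)%N; rewrite !(mulnC 2) !exprM -exprMn.
  move: (t ^+ m * a ^+ n) z0 => z z0 h.
  case: (leP z T) => [_|/ltW Tz].
    by rewrite lerDl mulr_ge0// ltW.
  apply: ler_wpDl; first exact: ltW.
  rewrite ler_pdivlMl//; apply: le_trans h; rewrite expr2.
  by rewrite ler_wpM2r.
have h3 : 0 <= T^-1 * f m.+1 n by rewrite mulr_ge0// ltW.
rewrite [T^-1 * (_ + _)]mulrDr; apply: (le_trans h1); rewrite [leRHS]addrA lerD2r [leRHS]addrA.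
by apply: (le_trans h2); rewrite lerDl.
Qed.

End mart_fun_bound.

Section mean_bounds.
Context {R : realType} {d : measure_display} {W : measurableType d}.
Variable P : probability W R.
Implicit Types (f g : W -> R) (a b c : R).

(** Bundles what linear combinations of upper bounds require, so that the final estimate is
    assembled mechanically. *)
Definition mean_le f a : Prop := [/\ measurable_fun setT f, forall w, 0 <= f w &
  (\int[P]_w (f w)%:E <= a%:E)%E].

Lemma mean_leD f g a b : mean_le f a -> mean_le g b ->
  mean_le (fun w => f w + g w) (a + b).
Proof.
move=> [mf f0 fa] [mg g0 gb]; split; first exact: measurable_funD.
  by move=> w; rewrite addr_ge0.
under eq_integral do rewrite EFinD.
rewrite ge0_integralD//; [|by move=> w _; rewrite lee_fin|exact/measurable_EFinP
  |by move=> w _; rewrite lee_fin|exact/measurable_EFinP].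
by rewrite EFinD leeD.
Qed.

Lemma mean_leZ c f a : 0 <= c -> mean_le f a -> mean_le (fun w => c * f w) (c * a).
Proof.
move=> c0 [mf f0 fa]; split; first exact: measurable_funM.
  by move=> w; rewrite mulr_ge0.
under eq_integral do rewrite EFinM.
rewrite ge0_integralZl//; [|exact/measurable_EFinP|by move=> w _; rewrite lee_fin].
by rewrite EFinM lee_wpmul2l.
Qed.

End mean_bounds.



Section lower_expectation.
Context {R : realType} {d : measure_display} {W : measurableType d}.
Variables (P : probability W R) (B : R -> {RV P >-> R}).
Hypothesis hB : brownian_motion B.
Variable mu : R.
Hypothesis mu0 : 0 < mu.
Local Notation X := (clipped_path B mu).
Local Notation tau x w := (first_passage_time (X x w)).
Local Notation p := (moment_poly mu).

Section truncation.
Variables (m n T : nat) (x eps : R).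
Hypotheses (x0 : 0 <= x) (T0 : (0 < T)%N) (eps0 : 0 < eps) (eps1 : eps <= 1).

Let Z r w := brownian_chain B mu eps x T r w.
Let J w := capped_power B mu T m n x w.
(** As the chain may stop too early, its power is controlled in the limit by [J] only from above.
    The maximum with [J] restores convergence, and the minimum with T provides domination. *)
Let h r w := Num.min (Num.max ((Z r w).1.1 ^+ m * (Z r w).1.2 ^+ n) (J w)) T%:R.

Let J0 w : 0 <= J w. Proof. exact: capped_power_ge0. Qed.

Let h_ge0 r w : 0 <= h r w.
Proof. by rewrite /h le_min le_max J0 orbT ler0n. Qed.

Let h_leT r w : h r w <= T%:R.
Proof. by rewrite /h ge_min lexx orbT. Qed.

Let measurable_h r : measurable_fun setT (h r).
Proof.
have mZ : measurable_fun setT (Z r) by exact: measurable_brownian_chain.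
have m1 : measurable_fun [set: R * R * R] (fun u => u.1.1).
  by apply: measurableT_comp.
have m2 : measurable_fun [set: R * R * R] (fun u => u.1.2).
  by apply: measurableT_comp.
apply: measurable_minr => //; apply: measurable_maxr; last exact: measurable_capped_power.
apply: measurable_funM; apply: measurable_funX.
  exact: measurableT_comp m1 mZ.
exact: measurableT_comp m2 mZ.
Qed.

Let h_cvg w : h r w @[r --> \oo] --> Num.min (J w) T%:R.
Proof.
have cX : continuous (X x w) by exact: clipped_path_continuous.
have X0 : X x w 0 = x by exact: clipped_path0.
have zE r k := increment_path B mu x w r k.
have X00 : 0 <= X x w 0 by rewrite X0.
have [l1 [l2 [l1J l2J]]] := chain_upper eps0 T cX X00 zE.
rewrite X0 => Zl1 Zl2.
have lJ : l1 r ^+ m * l2 r ^+ n @[r --> \oo] --> J w.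
  by apply: cvgM; apply: cvg_exprn.
(* An upper envelope for [h], since max and min are 1-Lipschitz; the lower one is its limit. *)
have up : Num.min (J w) T%:R + `|l1 r ^+ m * l2 r ^+ n - J w| @[r --> \oo] -->
    Num.min (J w) T%:R.
  rewrite -[X in _ --> X]addr0; apply: cvgD; first exact: cvg_cst.
  rewrite -(normr0 R) -(subrr (J w)); apply: cvg_norm; apply: cvgB => //.
  exact: cvg_cst.
apply: squeeze_cvgr up; last exact: cvg_cst.
apply: nearW => r; apply/andP; split.
  by rewrite /h le_min; apply/andP; split; rewrite ge_min ?le_max lexx ?orbT.
have [t0 _ a0] := brownian_chain_ge0 B mu x T r w eps0.
have : (Z r w).1.1 ^+ m * (Z r w).1.2 ^+ n <= l1 r ^+ m * l2 r ^+ n.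
  by apply: ler_pM; rewrite ?exprn_ge0//; apply: lerXn2r; rewrite ?nnegrE//;
    [exact: le_trans (Zl1 r)|exact: Zl1|exact: le_trans (Zl2 r)|exact: Zl2].
rewrite /h; move: (_ * _) (_ * _) (J w) (T%:R : R) => l z j c zl.
have := ler_norm (l - j); have := normr_ge0 (l - j); move: `|l - j| => e e0 le.
by case: (leP z j) => h1; case: (leP j c) => h2; case: (leP z c) => h3; lra.
Qed.

Let h_mean_cvg :
  (\int[P]_w (h r w)%:E)%E @[r --> \oo] --> (\int[P]_w (Num.min (J w) T%:R)%:E)%E.
Proof.
have [] := @dominated_convergence _ _ _ P setT measurableT (fun r w => (h r w)%:E)
  (fun w => (Num.min (J w) T%:R)%:E) (cst T%:R%:E).
- by move=> r; exact/measurable_EFinP.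
- apply/measurable_EFinP; apply: measurable_minr => //.
  exact: measurable_capped_power.
- by apply: nearW => w _; apply: cvg_EFin; [exact: nearW|exact: h_cvg].
- by apply: finite_measure_integrable_cst.
- by apply: nearW => w r _; rewrite lee_fin ger0_norm.
- by [].
Qed.

(** Each [+ 1] after a polynomial value is the slack e = 1 granted to [brownian_chain_cvg]. Neither
    constant depends on T, eps or the mesh. *)
Let C1 := (p (2 * m)%N (2 * n)%N).[x] + 1 + ((p m.+1 n).[x] + 1).

Let C2 := mart_poly mu m n 1 1 1 * ((p 0 0).[x] + 1 + ((p m 0).[x] + 1) +
  ((p 0 n).[x] + 1 + ((p m n).[x] + 1))).

Lemma capped_power_mean_ge : (((p m n).[x])%:E <=
  \int[P]_w (J w)%:E + (T%:R^-1 * C1 + eps * (C2 + 1))%:E)%E.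
Proof.
have hfin r : (\int[P]_w (h r w)%:E)%E \is a fin_num.
  rewrite ge0_fin_numE; last by apply: integral_ge0 => w _; rewrite lee_fin.
  apply: (@le_lt_trans _ _ (\int[P]_w (T%:R)%:E)%E).
    apply: ge0_le_integral => //; try by move=> w _; rewrite lee_fin.
    exact/measurable_EFinP.
  by rewrite integral_cst//= probability_setT mule1 ltry.
have hmean r : mean_le P (h r) (fine (\int[P]_w (h r w)%:E)).
  by split => //; rewrite fineK.
have Fmean i j : \forall r \near \oo,
    mean_le P (fun w => mart_fun mu i j (Z r w)) ((p i j).[x] + 1).
  have := brownian_chain_cvg hB mu0 T i j eps0 x0 ltr01.
  apply: filterS => r [FI _]; split => // [|w].
    apply: (measurableT_comp (measurable_mart_fun mu i j)).
    exact: measurable_brownian_chain.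
  by rewrite mart_poly_ge0 ?pos_part_ge0.
apply: (@le_trans _ _ (\int[P]_w (Num.min (J w) T%:R)%:E +
    (T%:R^-1 * C1 + eps * (C2 + 1))%:E)%E); last first.
  rewrite leeD2r//; apply: ge0_le_integral => //.
  - by move=> w _; rewrite lee_fin le_min J0 ler0n.
  - apply/measurable_EFinP; apply: measurable_minr => //.
    exact: measurable_capped_power.
  - by apply/measurable_EFinP; exact: measurable_capped_power.
  - by move=> w _; rewrite lee_fin ge_min lexx.
have : (\int[P]_w (h r w)%:E + (T%:R^-1 * C1 + eps * (C2 + 1))%:E)%E @[r --> \oo] -->
    (\int[P]_w (Num.min (J w) T%:R)%:E + (T%:R^-1 * C1 + eps * (C2 + 1))%:E)%E.
  apply: cvgeD; [by rewrite fin_num_adde_defl|exact: h_mean_cvg|exact: cvg_cst].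
move=> hcvg; rewrite -(cvg_lim _ hcvg)//; apply: lime_ge.
  by apply/cvg_ex; eexists; exact: hcvg.
near=> r.
(* The slack taken here is eps itself; it accounts for the [+ 1] in [C2 + 1]. *)
have [_ lowF] : (\int[P]_w (mart_fun mu m n (Z r w))%:E <= ((p m n).[x] + eps)%:E)%E /\
    (((p m n).[x])%:E <= \int[P]_w (mart_fun mu m n (Z r w))%:E + eps%:E)%E.
  by near: r; exact: brownian_chain_cvg.
apply: (le_trans lowF).
have f22 : mean_le P (fun w => mart_fun mu (2 * m)%N (2 * n)%N (Z r w))
    ((p (2 * m)%N (2 * n)%N).[x] + 1).
  by near: r; exact: Fmean.
have f1 : mean_le P (fun w => mart_fun mu m.+1 n (Z r w)) ((p m.+1 n).[x] + 1).
  by near: r; exact: Fmean.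
have f00 : mean_le P (fun w => mart_fun mu 0 0 (Z r w)) ((p 0 0).[x] + 1).
  by near: r; exact: Fmean.
have fm0 : mean_le P (fun w => mart_fun mu m 0 (Z r w)) ((p m 0).[x] + 1).
  by near: r; exact: Fmean.
have f0n : mean_le P (fun w => mart_fun mu 0 n (Z r w)) ((p 0 n).[x] + 1).
  by near: r; exact: Fmean.
have fmn : mean_le P (fun w => mart_fun mu m n (Z r w)) ((p m n).[x] + 1).
  by near: r; exact: Fmean.
have K0 : 0 <= mart_poly mu m n 1 1 1 by rewrite mart_poly_ge0.
have Ti0 : 0 <= T%:R^-1 :> R by rewrite invr_ge0.
have [mG _ G] := mean_leD (hmean r) (mean_leD (mean_leZ Ti0 (mean_leD f22 f1))
  (mean_leZ (ltW eps0) (mean_leZ K0 (mean_leD (mean_leD f00 fm0) (mean_leD f0n fmn))))).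
rewrite [eps * (C2 + 1)]mulrDr mulr1 addrA [in leRHS]EFinD addeA; apply: leeD2r.
rewrite -[X in (_ <= X + _)%E](fineK (hfin r)) -EFinD; apply: le_trans G.
apply: ge0_le_integral => //.
- by move=> w _; rewrite lee_fin mart_poly_ge0 ?pos_part_ge0.
- by apply/measurable_EFinP; case: fmn.
- exact/measurable_EFinP.
- move=> w _; rewrite lee_fin.
  have [t0 tT a0] := brownian_chain_ge0 B mu x T r w eps0.
  have tE : eps < (Z r w).2 -> (Z r w).1.1 = T%:R.
    move=> ey; have := chain_survives (f := X x w) (z := fun i => increment B r i w)
      (increment_path B mu x w r) (k := (T * r.+1)%N).
    rewrite (clipped_path0 hB) => /(_ _ ey).
    by rewrite sqr_mesh natrM mulfK.
  have T1 : 1 <= T%:R :> R by rewrite ler1n.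
  have := @mart_fun_le _ mu mu0 m n (Z r w).1.1 (Z r w).1.2 (Z r w).2 eps T%:R
    (fun i j => mart_fun mu i j (Z r w)) _ eps0 eps1 T1 t0 a0 tE.
  move=> /(_ _)/le_trans; apply; first by move=> i j; case: (Z r w) => [[]].
  rewrite lerD2r /h le_min ge_min le_max lexx/=.
  by rewrite ge_min lexx orbT.
Unshelve. all: by end_near. Qed.

End truncation.

Lemma joint_power_mean_ge m n x : 0 <= x ->
  (((p m n).[x])%:E <= \int[P]_w joint_power B m n mu x w)%E.
Proof.
move=> x0; apply/lee_addgt0Pr => e e0.
set C1 : R := (p (2 * m)%N (2 * n)%N).[x] + 1 + ((p m.+1 n).[x] + 1).
set C2 : R := mart_poly mu m n 1 1 1 * ((p 0 0).[x] + 1 + ((p m 0).[x] + 1) +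
  ((p 0 n).[x] + 1 + ((p m n).[x] + 1))) + 1.
have p0 i j : 0 <= (p i j).[x] by rewrite moment_poly_horner_ge0 ?(ltW mu0).
have p1 i j : 0 < (p i j).[x] + 1 by rewrite ltr_wpDl.
have C10 : 0 < C1 by rewrite /C1 addr_gt0.
have C20 : 0 < C2.
  by rewrite /C2 ltr_wpDl// mulr_ge0 ?mart_poly_ge0// !addr_ge0// ltW.
(* The errors [C1 / T.+1] and [eps * C2] receive e / 2 each. *)
pose eps := Num.min 1 (e / 2 / C2).
have eps0 : 0 < eps by rewrite lt_min ltr01 !divr_gt0.
have eps1 : eps <= 1 by rewrite ge_min lexx.
have e20 : 0 < e / 2 / C1 by rewrite !divr_gt0.
have [T _ /(_ T (leqnn T)) hT] := near_infty_natSinv_lt (PosNum e20).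
have := capped_power_mean_ge m n x0 (ltn0Sn T) eps0 eps1 => /le_trans; apply.
apply: leeD.
  apply: ge0_le_integral => //.
  - by move=> w _; rewrite lee_fin capped_power_ge0.
  - by apply/measurable_EFinP; exact: measurable_capped_power.
  - exact: measurable_joint_power.
  - by move=> w _; exact: capped_power_le.
rewrite lee_fin -/C1 -/C2.
have h1 : T.+1%:R^-1 * C1 <= e / 2 by rewrite -ler_pdivlMr// ltW.
have h2 : eps * C2 <= e / 2 by rewrite -ler_pdivlMr// ge_min lexx orbT.
by move: h1 h2; move: (_ * C1) (_ * C2) => *; lra.
Qed.

Lemma joint_power_mean m n x : 0 <= x ->
  (\int[P]_w joint_power B m n mu x w = ((p m n).[x])%:E)%E.
Proof.
move=> x0; apply/eqP; rewrite eq_le (joint_power_mean_ge m n x0) andbT.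
exact: joint_power_mean_le.
Qed.

End lower_expectation.



(** * The boundary value problem for the moments *)

Lemma joint_momentE {R : realType} {d : measure_display} {T : measurableType d}
    {P : probability T R} (B : R -> {RV P >-> R}) (hB : brownian_motion B)
    (m n : nat) (mu x : R) : 0 < mu -> 0 <= x ->
  joint_moment B m n mu x = (moment_poly mu m n).[x].
Proof. by move=> mu0 x0; rewrite /joint_moment (joint_power_mean hB mu0 m n x0). Qed.

Lemma near_eq_poly_derive {R : realType} (f : R -> R) (p : {poly R}) (x : R) :
  (\forall y \near x, f y = p.[y]) ->
  derivable f x 1 /\ derive1 f x = p^`().[x].
Proof.
move=> fp; have dp : is_derive x 1 (horner p) p^`().[x] by exact: is_derive_poly.
have pf : \forall y \near x, horner p y = f y by apply: filterS fp.
split; first by apply: near_eq_derivable pf _; case: dp.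
by rewrite derive1E (near_eq_derive _ fp) derive_val.
Qed.

Theorem theorem2p4 (R : realType) (d : measure_display) (T : measurableType d)
    (P : probability T R) (B : R -> {RV P >-> R}) (hB : brownian_motion B)
    (m n : nat) (hmn : (0 < m + n)%N) :
  let V (h k : nat) (mu x : R) := joint_moment B h k mu x in
  [/\ forall (h k : nat) (mu x : R), (h <= m)%N -> (k <= n)%N -> 0 < mu -> 0 <= x ->
        P.-integrable setT (joint_power B h k mu x),
      forall mu x : R, 0 < mu -> 0 < x ->
        [/\ derivable (V m n mu) x 1,
            derivable (derive1 (V m n mu)) x 1 &
            2^-1 * derive1 (derive1 (V m n mu)) x - mu * derive1 (V m n mu) x =
              - (m%:R * V m.-1 n mu x) - n%:R * x * V m n.-1 mu x],
      forall mu : R, 0 < mu ->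
        V m n mu 0 = 0 /\ V m n mu x @[x --> 0^'+] --> 0 &
      forall x : R, 0 < x -> V m n mu x @[mu --> +oo] --> 0].
Proof.
move=> V.
have VE h k mu x : 0 < mu -> 0 <= x -> V h k mu x = (moment_poly mu h k).[x].
  exact: joint_momentE.
split.
- by move=> h k mu x _ _ mu0 x0; exact: joint_power_integrable.
- move=> mu x mu0 x0.
  (* Agreement with the polynomial holds only on the positive half-line, which is open. The second
     derivative needs the first one identified on a neighbourhood of x, hence the statement for
     every y > 0. *)
  have Vnear (y : R) : 0 < y -> \forall z \near y, V m n mu z = (moment_poly mu m n).[z].
    by move=> y0; apply: filterS (lt_nbhsr y0) => z /ltW z0; rewrite VE.
  have dnear : \forall y \near x, derive1 (V m n mu) y = (moment_poly mu m n)^`().[y].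
    apply: filterS (lt_nbhsr x0) => y y0.
    exact: (near_eq_poly_derive (Vnear y y0)).2.
  have [dV V1] := near_eq_poly_derive (Vnear x x0).
  have [ddV V2] := near_eq_poly_derive dnear.
  split => //; rewrite V1 V2 !VE ?(ltW x0)//.
  have := congr1 (horner ^~ x) (moment_poly_ode m n (lt0r_neq0 mu0)).
  rewrite /moment_source !(hornerD, hornerN, hornerZ, hornerM, hornerX) => ->; ring.
- move=> mu mu0; split; first by rewrite VE// moment_poly_at0.
  rewrite -[X in _ --> X](moment_poly_at0 mu hmn).
  have : (moment_poly mu m n).[x] @[x --> 0^'+] --> (moment_poly mu m n).[0].
    exact/cvg_at_right_filter/continuous_horner.
  apply: cvg_trans; apply: near_eq_cvg.
  by apply: filterS (nbhs_right_gt 0) => x x0; rewrite VE// ltW.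
- move=> x x0.
  (* Squeeze between 0 and 1 / mu times the value for drift 1, valid once mu >= 1. *)
  have : mu^-1 * (moment_poly 1 m n).[x] @[mu --> +oo] --> (0 : R).
    rewrite -[X in _ --> X](mul0r (moment_poly 1 m n).[x]); apply: cvgM; last exact: cvg_cst.
    by apply: (gtr0_cvgV0 (f := id) _).2; [exact: nbhs_pinfty_gt|exact: cvg_id].
  apply: squeeze_cvgr; last exact: cvg_cst.
  near=> mu.
  have mu1 : 1 <= mu by near: mu; apply: nbhs_pinfty_ge; exact: num_real.
  have mu0 : 0 < mu by exact: lt_le_trans mu1.
  rewrite VE ?(ltW x0)// moment_poly_horner_ge0 ?(ltW x0) ?(ltW mu0)//=.
  exact: moment_poly_horner_le (ltW x0) _.
Unshelve. all: by end_near. Qed.
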